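(* Let $d\ge 1$ and let $\Phi(N,n)=\left(\sum_{k=-\infty}^{+\infty}\Psi(N^{-1}k)\right)^{-1}\Psi(N^{-1}n)$ for integers $N\ge 1$ and $n\in\mathbb Z$, with $$\Psi(t)=\begin{cases}1&\text{if }|t|\le 1,\\0&\text{if }|t|>1.\end{cases}$$ Let $0<\vartheta\le 1$. Then there exists $K>0$ such that $\left|\sum_{n}\Phi(N,n)e^{2\pi i n t}\right|\le K(1+N\|t\|)^{-\vartheta}$ for every integer $N\ge 1$ and every $t\in\mathbb R$, and consequently: (a) If $f\in W^{\delta,2}(\mathbb T^d)$, with $\delta>d/2$ if $\vartheta<1$ and $\delta>d\vartheta-d/2$ if $\vartheta\geq 1$, then for almost every $\alpha$ there exists $c(f,\alpha)>0$ such that $\sup_{x\in\mathbb T^d}|\mathcal D_N^{\Phi,\alpha}f(x)|\le c(f,\alpha)N^{-\vartheta}$ for every positive integer $N$. (b) If $\alpha\in\mathbb R^d$ is irrational and there exist $H>0$, $\sigma\ge d$ such that $\|\alpha\cdot m\|\ge H|m|^{-\sigma}$ for every $m\in\mathbb Z^d\setminus\{0\}$, and if $\delta>d/2$, then there exists $c>0$ such that $\sup_{x\in\mathbb T^d}|\mathcal D_N^{\Phi,\alpha}f(x)|\le cN^{-\vartheta}X(d,\delta,\vartheta,\sigma,N)\|f\|_{\delta,2}$ for every $f\in W^{\delta,2}(\mathbb T^d)$ and every positive integer $N$. (c) With $C(t)=\limsup_{N\to+\infty}\left\{N^{\vartheta}\left|\sum_n\Phi(N,n)e^{2\pi i n t}\right|\right\}$,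 for every integrable $f$ on $\mathbb T^d$, every $m\in\mathbb Z^d\setminus\{0\}$ and every $\alpha\in\mathbb T^d$ one has $\limsup_{N\to+\infty}\left\{N^{\vartheta}\sup_{x\in\mathbb T^d}|\mathcal D_N^{\Phi,\alpha}f(x)|\right\}\ge C(m\cdot\alpha)|\widehat f(m)|$ (with $(+\infty)\cdot 0=0$).
   Context: $\mathbb T^d=\mathbb R^d/\mathbb Z^d$; functions on $\mathbb T^d$ are identified with $\mathbb Z^d$-periodic functions on $\mathbb R^d$. For real $t$, $\|t\|=\inf_{n\in\mathbb Z}|t-n|$. A vector $\alpha=(\alpha_1,\dots,\alpha_d)\in\mathbb R^d$ is irrational if $1,\alpha_1,\dots,\alpha_d$ are linearly independent over $\mathbb Q$. Fourier coefficients: $\widehat f(m)=\int_{\mathbb T^d}f(x)e^{-2\pi i m\cdot x}dx$. For $\delta>0$, $W^{\delta,2}(\mathbb T^d)$ is the space of distributions on $\mathbb T^d$ with $\|f\|_{\delta,2}=\left(\sum_{m\in\mathbb Z^d}(1+|m|^2)^\delta|\widehat f(m)|^2\right)^{1/2}<\infty$; when $\delta>d/2$ its elements are identified with their continuous representatives. The weighted discrepancy is $\mathcal D_N^{\Phi,\alpha}f(x)=\sum_{n=-\infty}^{+\infty}\Phi(N,n)f(x+n\alpha)-\int_{\mathbb T^d}f(y)\,dy$. The quantity $X$ is $$X(d,\delta,\vartheta,\sigma,N)=\begin{cases} N^{\frac{-\delta+\vartheta\sigma-d\vartheta+d/2}{\sigma-d}} & \text{if }\vartheta<1/2,\ \delta<\vartheta\sigma-d(\vartheta-1/2),\\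 \log^{1/2}(1+N) & \text{if }\vartheta<1/2,\ \delta=\vartheta\sigma-d(\vartheta-1/2),\\ 1 & \text{if }\vartheta<1/2,\ \delta>\vartheta\sigma-d(\vartheta-1/2),\\ N^{\frac{\sigma/2-\delta}{\sigma-d}}\log^{1/2}(1+N) & \text{if }\vartheta=1/2,\ \delta<\sigma/2,\\ \log(1+N) & \text{if }\vartheta=1/2,\ \delta=\sigma/2,\\ 1 & \text{if }\vartheta=1/2,\ \delta>\sigma/2,\\ N^{\frac{\vartheta(\vartheta\sigma-\delta)}{\vartheta\sigma-d/2}} & \text{if }\vartheta>1/2,\ \delta<\vartheta\sigma,\\ \log^{1/2}(1+N) & \text{if }\vartheta>1/2,\ \delta=\vartheta\sigma,\\ 1 & \text{if }\vartheta>1/2,\ \delta>\vartheta\sigma. \end{cases}$$ *)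

(* Defs.v *)
From HB Require Import structures.
From mathcomp Require Import all_boot all_order all_algebra.
From mathcomp Require Import all_classical all_reals all_analysis.
From mathcomp.real_closed Require Export complex.

Set Implicit Arguments.
Unset Strict Implicit.
Unset Printing Implicit Defensive.

Import Order.TTheory GRing.Theory Num.Theory.
Import numFieldNormedType.Exports.
Export Normc.

Local Open Scope classical_set_scope.
Local Open Scope ring_scope.
Local Open Scope complex_scope.

(* The Borel sigma-algebra of R^d, generated by the coordinate projections
   (same construction as for n.-tuple in the library). *)
Section measurable_rV.
Variables (R : realType) (d : nat).

Let coord (i : 'I_d) (x : 'rV[R]_d) : R := x ord0 i.

Let rV_set0 : g_sigma_preimage coord set0.
Proof. exact: sigma_algebra0. Qed.

Let rV_setC A : g_sigma_preimage coord A -> g_sigma_preimage coord (~` A).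
Proof. exact: sigma_algebraC. Qed.

Let rV_bigcup (F : _^nat) : (forall i, g_sigma_preimage coord (F i)) ->
  g_sigma_preimage coord (\bigcup_i (F i)).
Proof. exact: sigma_algebra_bigcup. Qed.

HB.instance Definition _ :=
  @isMeasurable.Build (measure_tuple_display default_measure_display)
    'rV[R]_d (g_sigma_preimage coord) rV_set0 rV_setC rV_bigcup.

End measurable_rV.

Lemma measurable_fun_rVP (R : realType) (d : nat) (disp : measure_display)
    (T : measurableType disp) (f : T -> 'rV[R]_d) :
  (forall i, measurable_fun [set: T] (fun x => f x ord0 i)) ->
  measurable_fun [set: T] f.
Proof.
move=> mf _ A; rewrite setTI => mA; move: A mA.
apply: smallest_sub.
  split=> [|A mA|F mF].
  - by rewrite /= preimage_set0; exact: measurable0.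
  - by rewrite /= setTD preimage_setC; exact: measurableC.
  - by rewrite /= preimage_bigcup; exact: bigcup_measurable.
rewrite -bigcup_seq/= => A [i _] [B mB]; rewrite setTI => <-.
by rewrite -comp_preimage -[_ @^-1` _]setTI; exact: mf.
Qed.

Definition consV (R : realType) (d : nat) (p : measurableTypeR R * 'rV[R]_d) : 'rV[R]_d.+1 :=
  \row_i oapp (p.2 ord0) p.1 (unlift ord0 i).

Lemma consVE0 (R : realType) (d : nat) (p : measurableTypeR R * 'rV[R]_d) :
  consV p ord0 ord0 = p.1.
Proof. by rewrite mxE unlift_none. Qed.

Lemma consVES (R : realType) (d : nat) (p : measurableTypeR R * 'rV[R]_d) (i : 'I_d) :
  consV p ord0 (lift ord0 i) = p.2 ord0 i.
Proof. by rewrite mxE liftK. Qed.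

Lemma measurable_coord (R : realType) d (i : 'I_d) :
  measurable_fun [set: 'rV[R]_d] (fun x : 'rV[R]_d => x ord0 i).
Proof.
move=> _ Y mY; rewrite setTI; apply: sub_sigma_algebra => /=.
rewrite -bigcup_seq/=; exists i => /=; first by rewrite mem_index_enum.
by exists Y => //; rewrite setTI.
Qed.

Lemma measurable_consV (R : realType) d :
  measurable_fun [set: measurableTypeR R * 'rV[R]_d] (@consV R d).
Proof.
apply: measurable_fun_rVP => i.
case: (unliftP ord0 i) => [j|] ->.
- under eq_fun do rewrite consVES.
  exact: (measurableT_comp (measurable_coord j) measurable_snd).
- under eq_fun do rewrite consVE0.
  exact: measurable_fst.
Qed.


Lemma measurable_tailV (R : realType) (d : nat) :
  measurable_fun [set: 'rV[R]_d.+1]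
    (fun v : 'rV[R]_d.+1 => \row_i v ord0 (lift ord0 i) : 'rV[R]_d).
Proof.
apply: measurable_fun_rVP => i; under eq_fun do rewrite mxE.
exact: measurable_coord.
Qed.

Section lebesgue_step.
Variables (R : realType) (d : nat).
Variable mu : {sigma_finite_measure set 'rV[R]_d -> \bar R}.

Let pm : {measure set (measurableTypeR R * 'rV[R]_d)%type -> \bar R} :=
  (@lebesgue_measure R \x mu)%E.

Definition lebesgue_step : set 'rV[R]_d.+1 -> \bar R :=
  pushforward (@lebesgue_measure R \x mu)%E (@consV R d).

Let step0 : lebesgue_step set0 = 0%E.
Proof. by rewrite /lebesgue_step /pushforward preimage_set0 (measure0 pm). Qed.

Let step_ge0 A : (0 <= lebesgue_step A)%E.
Proof. exact: (measure_ge0 pm). Qed.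

Let step_sigma_additive : semi_sigma_additive lebesgue_step.
Proof.
move=> F mF tF mUF; rewrite /lebesgue_step /pushforward preimage_bigcup.
have mp A : measurable A -> measurable (@consV R d @^-1` A).
  by move=> mA; rewrite -[X in measurable X]setTI; exact: measurable_consV.
apply: (@measure_semi_sigma_additive _ _ _ pm) => [n||]; first exact: mp.
  apply/trivIsetP => /= i j _ _ ij; rewrite -preimage_setI.
  by move/trivIsetP : tF => /(_ _ _ _ _ ij) ->//; rewrite preimage_set0.
by rewrite -preimage_bigcup; exact: mp.
Qed.

HB.instance Definition _ := isMeasure.Build _ _ _ lebesgue_step
  step0 step_ge0 step_sigma_additive.

Let step_sigma_finite : sigma_finite setT lebesgue_step.
Proof.
have /sigma_finiteP[F [TF ndF Foo]] := sigma_finiteT (@lebesgue_measure R).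
have /sigma_finiteP[G [TG ndG Goo]] := sigma_finiteT mu.
pose hd (v : 'rV[R]_d.+1) : R := v ord0 ord0.
pose tl (v : 'rV[R]_d.+1) : 'rV[R]_d := \row_i v ord0 (lift ord0 i).
exists (fun n => hd @^-1` F n `&` tl @^-1` G n).
  rewrite predeqE => v; split=> // _.
  have [n _ Fn] : (\bigcup_n F n) (hd v) by rewrite -TF.
  have [k _ Gk] : (\bigcup_n G n) (tl v) by rewrite -TG.
  exists (maxn n k) => //; split.
  - by have /subsetPset/(_ _ Fn) := ndF _ _ (leq_maxl n k).
  - by have /subsetPset/(_ _ Gk) := ndG _ _ (leq_maxr n k).
move=> n; have [mF Fn] := Foo n; have [mG Gn] := Goo n.
split.
  apply: measurableI; rewrite -[X in measurable X]setTI.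
  - exact: measurable_coord.
  - exact: measurable_tailV.
rewrite /lebesgue_step /pushforward (_ : _ @^-1` _ = F n `*` G n).
  by rewrite product_measure1E// lte_mul_pinfty// ge0_fin_numE.
rewrite predeqE => p /=; rewrite /hd /tl consVE0.
suff -> : \row_i consV p ord0 (lift ord0 i) = p.2 by [].
by apply/rowP => i; rewrite mxE consVES.
Qed.

HB.instance Definition _ := Measure_isSigmaFinite.Build _ _ _ lebesgue_step
  step_sigma_finite.

End lebesgue_step.

Fixpoint lebesgue_rV (R : realType) (d : nat) :
    {sigma_finite_measure set 'rV[R]_d -> \bar R} :=
  if d is d'.+1 then lebesgue_step (lebesgue_rV R d')
  else @dirac _ 'rV[R]_0 0 R.

Lemma lebesgue_rV_box (R : realType) (d : nat) (A : 'I_d -> set R) :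
  (forall i, measurable (A i)) ->
  lebesgue_rV R d [set x : 'rV[R]_d | forall i, A i (x ord0 i)] =
  (\prod_(i < d) lebesgue_measure (A i))%E.
Proof.
elim: d A => [|d IHd] A mA /=.
  rewrite big_ord0 diracE (_ : _ \in _ = true) //.
  by apply/mem_set => -[].
rewrite big_ord_recl -IHd => [|i]; last exact: mA.
rewrite /lebesgue_step /pushforward -product_measure1E; last 2 first.
- exact: mA.
- rewrite (_ : [set _ | _] = \bigcap_(i in [set: 'I_d])
      ((fun x : 'rV[R]_d => x ord0 i) @^-1` A (lift ord0 i))); last first.
    by apply/seteqP; split=> x h i; [move=> _; exact: h|exact: (h i I)].
  apply: fin_bigcap_measurable => [|i _]; first exact: finite_finset.
  by rewrite -[X in measurable X]setTI; exact: measurable_coord.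
congr (product_measure1 _ _ _); apply/seteqP; split=> p /=.
- move=> h; split=> [|i]; first by have := h ord0; rewrite consVE0.
  by have := h (lift ord0 i); rewrite consVES.
- move=> [h0 hS] i; case: (unliftP ord0 i) => [j|] ->.
  + by rewrite consVES.
  + by rewrite consVE0.
Qed.

Section torus.
Variables (R : realType) (d : nat).
Implicit Types (f : 'rV[R]_d -> R[i]) (m : 'rV[int]_d) (x alpha : 'rV[R]_d).

Definition Zperiodic f :=
  forall (m : 'rV[int]_d) x, f (x + map_mx intr m) = f x.

Definition unit_cube : set 'rV[R]_d :=
  [set x | forall i, 0 <= x ord0 i < 1].

Definition torus_integral f : R[i] :=
  (\int[lebesgue_rV R d]_(x in unit_cube) complex.Re (f x)) +i*
  (\int[lebesgue_rV R d]_(x in unit_cube) complex.Im (f x)).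

(* Lebesgue measurability is expressed as almost everywhere equality with a
   Borel function. *)
Definition torus_integrable f :=
  Zperiodic f /\
  exists g : 'rV[R]_d -> R[i],
    [/\ (lebesgue_rV R d).-integrable unit_cube (EFin \o @complex.Re R \o g),
        (lebesgue_rV R d).-integrable unit_cube (EFin \o @complex.Im R \o g) &
        {ae lebesgue_rV R d, forall x, unit_cube x -> f x = g x}].

Definition torus_continuous f :=
  [/\ Zperiodic f, continuous (@complex.Re R \o f) &
      continuous (@complex.Im R \o f)].

(* exp(2 pi i t) *)
Definition expi (t : R) : R[i] := cos (2 * pi * t) +i* sin (2 * pi * t).

Definition dotZ m x : R := \sum_(i < d) (m ord0 i)%:~R * x ord0 i.

Definition normZ m : R := Num.sqrt (\sum_(i < d) (m ord0 i)%:~R ^+ 2).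

Definition fourier_coef f m : R[i] :=
  torus_integral (fun x => f x * expi (- dotZ m x)).

Definition partial_derivative (i : 'I_d) (g : 'rV[R]_d -> R) : 'rV[R]_d -> R :=
  fun x => 'D_(delta_mx ord0 i) g x.

Definition iter_partial (s : seq 'I_d) (g : 'rV[R]_d -> R) : 'rV[R]_d -> R :=
  foldr partial_derivative g s.

Definition smooth (g : 'rV[R]_d -> R) :=
  forall s : seq 'I_d, continuous (iter_partial s g) /\
    forall (i : 'I_d) x, derivable (iter_partial s g) x (delta_mx ord0 i).

Definition test_function (phi : 'rV[R]_d -> R[i]) :=
  [/\ Zperiodic phi, smooth (@complex.Re R \o phi) &
      smooth (@complex.Im R \o phi)].

(* A distribution is a linear functional on test functions bounded by some
   C^k norm; values on other functions are irrelevant. *)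
Definition distribution (u : ('rV[R]_d -> R[i]) -> R[i]) :=
  (forall (a : R[i]) phi psi, test_function phi -> test_function psi ->
    u (fun x => a * phi x + psi x) = a * u phi + u psi) /\
  exists (C : R) (k : nat), forall phi (M : R), test_function phi ->
    (forall s : seq 'I_d, (size s <= k)%N -> forall x,
       `|iter_partial s (@complex.Re R \o phi) x| <= M /\
       `|iter_partial s (@complex.Im R \o phi) x| <= M) ->
    normc (u phi) <= C * M.

Definition distribution_coef (u : ('rV[R]_d -> R[i]) -> R[i]) m : R[i] :=
  u (fun x => expi (- dotZ m x)).

Definition sobolev_norm (delta : R) (u : ('rV[R]_d -> R[i]) -> R[i]) : \bar R :=
  poweR (\esum_(m in [set: 'rV[int]_d])
          ((1 + normZ m ^+ 2) `^ delta * normc (distribution_coef u m) ^+ 2)%:E)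
        2^-1.

Definition sobolev_space (delta : R) (u : ('rV[R]_d -> R[i]) -> R[i]) :=
  distribution u /\ (sobolev_norm delta u < +oo)%E.

Definition continuous_representative (u : ('rV[R]_d -> R[i]) -> R[i]) f :=
  torus_continuous f /\
  forall phi, test_function phi -> u phi = torus_integral (fun x => f x * phi x).

Definition irrational_vector alpha :=
  forall (q0 : rat) (q : 'I_d -> rat),
    ratr q0 + \sum_(i < d) ratr (q i) * alpha ord0 i = 0 :> R ->
    q0 = 0 /\ forall i, q i = 0.

(* W N is assumed to have finite support, so that the sum over Z is a
   finite-support sum (it is 0 by convention otherwise). *)
Definition discrepancy (W : nat -> int -> R) alpha f (N : nat) x : R[i] :=
  \sum_(n \in [set: int]) (W N n)%:C * f (x + n%:~R *: alpha)
  - torus_integral f.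

Definition sup_norm (g : 'rV[R]_d -> R[i]) : \bar R :=
  ereal_sup [set (normc (g x))%:E | x in [set: 'rV[R]_d]].

End torus.

Definition dist_int (R : realType) (t : R) : R :=
  inf [set `|t - n%:~R| | n in [set: int]].

Definition Psi (R : realType) (t : R) : R := if `|t| <= 1 then 1 else 0.

(* For N >= 1 the sum is finite; Phi 0 is a junk value. *)
Definition Phi (R : realType) (N : nat) (n : int) : R :=
  (\sum_(k \in [set: int]) Psi (N%:R^-1 * k%:~R : R))^-1
  * Psi (N%:R^-1 * n%:~R).

Definition exp_sum (R : realType) (W : nat -> int -> R) (N : nat) (t : R) :
    R[i] :=
  \sum_(n \in [set: int]) (W N n)%:C * expi (n%:~R * t).

Definition Climsup (R : realType) (theta t : R) : \bar R :=
  limn_esup (fun N : nat =>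
    (N%:R `^ theta * normc (exp_sum (@Phi R) N t))%:E).

Definition Xrate (R : realType) (d : nat) (delta theta sigma : R) (N : nat) :
    R :=
  let dd : R := d%:R in
  let NR : R := N%:R in
  let L : R := ln (1 + NR) in
  if theta < 2^-1 then
    let thr := theta * sigma - dd * (theta - 2^-1) in
    if delta < thr then
      NR `^ ((- delta + theta * sigma - dd * theta + dd / 2) / (sigma - dd))
    else if delta == thr then L `^ 2^-1
    else 1
  else if theta == 2^-1 then
    if delta < sigma / 2 then
      NR `^ ((sigma / 2 - delta) / (sigma - dd)) * L `^ 2^-1
    else if delta == sigma / 2 then L
    else 1
  else
    if delta < theta * sigma then
      NR `^ (theta * (theta * sigma - delta) / (theta * sigma - dd / 2))
    else if delta == theta * sigma then L `^ 2^-1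
    else 1.

(* Main.v *)
Require Import Defs.
From mathcomp Require Import all_boot all_order all_algebra.
From mathcomp Require Import all_classical all_reals all_analysis measurable_realfun.
From mathcomp Require Import ring lra zify.

(* The weights Phi(N, .) average over [-N, N], so their Fourier sum is a Dirichlet
   kernel, bounded by min(1, 1/(N||t||)). The m-th Fourier coefficient of the
   discrepancy of f is the Fourier sum at m.alpha times that of f, and Fejer
   summation bounds the supremum of a continuous periodic function by the sum of
   the moduli of its Fourier coefficients.
   - (b): after Cauchy-Schwarz against the Sobolev weights, the Diophantine
     condition separates the points m.alpha of a dyadic shell |m| ~ 2^k; summing
     over separated points, or trivially over all points of the shell, gives two
     geometric bounds, and X is read off the shell where they cross.
   - (a): the coefficients a_m are in l^p for some p < 1. On every box the set where
     ||m.alpha|| < e has measure O(e) uniformly in m, so that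
     (a_m ||m.alpha||^(-theta))^p is almost everywhere summable in m, and so is
     a_m ||m.alpha||^(-theta).
   - (c): a Fourier coefficient of the discrepancy is at most its supremum. *)

Set Implicit Arguments.
Unset Strict Implicit.
Unset Printing Implicit Defensive.

Import Order.TTheory GRing.Theory Num.Theory.
Import numFieldNormedType.Exports.

Local Open Scope classical_set_scope.
Local Open Scope ring_scope.
Local Open Scope complex_scope.

(** * Complex moduli, distance to the integers and the Dirichlet kernel *)

(** The Fejer kernel is positive, so finite sums of moduli of coefficients already control the
    supremum; both upper bounds therefore speak of arbitrary finite duplicate-free lists of
    frequencies. In (a) the obstacle is [theta = 1]: [||t||^-1] is not integrable. A power [p < 1]
    makes [p * theta < 1], and it is affordable because [delta > d/2] is strict: the coefficients
    are in l^p once [delta * p / (2 - p) > d/2], which at [p = 1] reads [delta > d/2] and persists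
    for some [p < 1]. In (b) the threshold [theta = 1/2] appears because Cauchy-Schwarz squares the
    kernel: along points with spacing [h] one sums [(j h)^(-2 theta)], a convergent series exactly
    for [theta > 1/2]. In (c) [f] is only almost everywhere equal to a Borel function while the
    supremum is over all points, so null sets have to be followed through the translations. *)

Lemma normcE2 (R : realType) (z : R[i]) :
  normc z = Num.sqrt (complex.Re z ^+ 2 + complex.Im z ^+ 2).
Proof. by case: z. Qed.

Lemma normc_ge0 (R : realType) (z : R[i]) : 0 <= normc z.
Proof. by rewrite normcE2 sqrtr_ge0. Qed.

Lemma sqr_normcE (R : realType) (z : R[i]) :
  normc z ^+ 2 = complex.Re z ^+ 2 + complex.Im z ^+ 2.
Proof. by rewrite normcE2 sqr_sqrtr// addr_ge0// sqr_ge0. Qed.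

Lemma normc_real (R : realType) (x : R) : normc x%:C = `|x|.
Proof. by rewrite normcE2 /= expr0n addr0 sqrtr_sqr. Qed.

Lemma normr_Re_le (R : realType) (z : R[i]) : `|complex.Re z| <= normc z.
Proof.
by rewrite -(@ler_pXn2r _ 2) ?nnegrE ?normc_ge0// sqr_normcE real_normK ?num_real// lerDl sqr_ge0.
Qed.

Lemma normr_Im_le (R : realType) (z : R[i]) : `|complex.Im z| <= normc z.
Proof.
by rewrite -(@ler_pXn2r _ 2) ?nnegrE ?normc_ge0// sqr_normcE real_normK ?num_real// lerDr sqr_ge0.
Qed.

Lemma normc_leReIm (R : realType) (z : R[i]) :
  normc z <= `|complex.Re z| + `|complex.Im z|.
Proof.
rewrite -(@ler_pXn2r _ 2) ?nnegrE ?addr_ge0 ?normc_ge0//.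
rewrite sqr_normcE sqrrD !real_normK ?num_real// addrAC lerDl.
by rewrite mulrn_wge0// mulr_ge0.
Qed.

Lemma normcDle (R : realType) (z w : R[i]) : normc (z + w) <= normc z + normc w.
Proof. exact: complex.le_normcD. Qed.

Lemma normcN' (R : realType) (z : R[i]) : normc (- z) = normc z.
Proof. by rewrite !normcE2; case: z => a b /=; rewrite !sqrrN. Qed.

Lemma le_normc_sum (R : realType) (I : Type) (s : seq I) (P : pred I) (F : I -> R[i]) :
  normc (\sum_(i <- s | P i) F i) <= \sum_(i <- s | P i) normc (F i).
Proof.
elim/big_ind2: _ => [|z1 r1 z2 r2 h1 h2|//]; first by rewrite normc0.
by rewrite (le_trans (normcDle _ _))// lerD.
Qed.

Lemma cRe_sum (R : realType) (I : Type) (s : seq I) (P : pred I) (F : I -> R[i]) :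
  complex.Re (\sum_(i <- s | P i) F i) = \sum_(i <- s | P i) complex.Re (F i).
Proof. by elim/big_rec2: _ => // i _ y _ <-; case: (F i) y => [? ?] [? ?]. Qed.

Lemma cIm_sum (R : realType) (I : Type) (s : seq I) (P : pred I) (F : I -> R[i]) :
  complex.Im (\sum_(i <- s | P i) F i) = \sum_(i <- s | P i) complex.Im (F i).
Proof. by elim/big_rec2: _ => // i _ y _ <-; case: (F i) y => [? ?] [? ?]. Qed.

Lemma cReM (R : realType) (z w : R[i]) : complex.Re (z * w) =
  complex.Re z * complex.Re w - complex.Im z * complex.Im w.
Proof. by case: z w => [? ?] [? ?]. Qed.

Lemma cImM (R : realType) (z w : R[i]) : complex.Im (z * w) =
  complex.Re z * complex.Im w + complex.Im z * complex.Re w.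
Proof. by case: z w => [? ?] [? ?]. Qed.

Lemma cReD (R : realType) (z w : R[i]) :
  complex.Re (z + w) = complex.Re z + complex.Re w.
Proof. by case: z w => [? ?] [? ?]. Qed.

Lemma cImD (R : realType) (z w : R[i]) :
  complex.Im (z + w) = complex.Im z + complex.Im w.
Proof. by case: z w => [? ?] [? ?]. Qed.

Lemma complexP (R : realType) (z w : R[i]) :
  complex.Re z = complex.Re w -> complex.Im z = complex.Im w -> z = w.
Proof. by case: z w => [? ?] [? ?] /= -> ->. Qed.

Lemma expi0 (R : realType) : expi (0 : R) = 1.
Proof. by rewrite /expi mulr0 cos0 sin0. Qed.

Lemma expiD (R : realType) (s t : R) : expi (s + t) = expi s * expi t.
Proof.
rewrite /expi mulrDr cosD sinD; apply: complexP; rewrite ?cReM ?cImM//=.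
by rewrite addrC.
Qed.

Lemma normc_expi (R : realType) (t : R) : normc (expi t) = 1.
Proof. by rewrite normcE2 /= cos2Dsin2 sqrtr1. Qed.

Lemma expi_nat (R : realType) (n : nat) : expi (n%:R : R) = 1.
Proof.
rewrite /expi.
have -> : 2 * pi * n%:R = 0 + (pi *+ 2) *+ n :> R.
  by rewrite add0r -mulr_natr -(mulr_natr pi 2); ring.
by rewrite (periodicn (@cosD2pi R)) (periodicn (@sinD2pi R)) cos0 sin0.
Qed.

Lemma expi_int (R : realType) (n : int) : expi (n%:~R : R) = 1.
Proof.
case: n => n; first exact: expi_nat.
rewrite NegzE mulrNz; apply: (@mulrI _ (expi n.+1%:R)).
  by rewrite expi_nat unitr1.
by rewrite -expiD addrN expi0 expi_nat mulr1.
Qed.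

Lemma expiDint (R : realType) (t : R) (n : int) : expi (t + n%:~R) = expi t.
Proof. by rewrite expiD expi_int mulr1. Qed.

Lemma expi_sum (R : realType) (I : Type) (s : seq I) (P : pred I) (F : I -> R) :
  expi (\sum_(i <- s | P i) F i) = \prod_(i <- s | P i) expi (F i).
Proof. by elim/big_ind2: _ => [|? ? ? ? <- <-|//]; rewrite ?expi0 ?expiD. Qed.

Lemma dist_intP (R : realType) (t : R) :
  exists n : int, dist_int t = `|t - n%:~R| /\ `|t - n%:~R| <= 2^-1.
Proof.
have /andP[h1 h2] := floor_itv (t + 2^-1).
exists (Num.floor (t + 2^-1)); move: h1 h2; set n := Num.floor _; rewrite intrD => h1 h2.
have hn : `|t - n%:~R| <= 2^-1 by rewrite ler_norml; lra.
split=> //; rewrite /dist_int; apply/eqP; rewrite eq_le; apply/andP; split.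
  apply: ge_inf; last by exists n.
  by exists 0 => _ [k _ <-].
apply: lb_le_inf; first by exists `|t - n%:~R|, n.
move=> _ [k _ <-].
have [->//|nk] := eqVneq n k.
have h : 1 <= `|n%:~R - k%:~R : R|.
  by rewrite -intrB -intr_norm ler1z -gtz0_ge1 normr_gt0 subr_eq0.
have := ler_normD (n%:~R - t) (t - k%:~R); rewrite addrA subrK (distrC _ t).
by lra.
Qed.

Lemma dist_int_ge0 (R : realType) (t : R) : 0 <= dist_int t.
Proof. by have [n [-> _]] := dist_intP t. Qed.

Lemma dist_int_le_half (R : realType) (t : R) : dist_int t <= 2^-1.
Proof. by have [n [-> ]] := dist_intP t. Qed.

Lemma dist_int_le (R : realType) (t : R) (n : int) : dist_int t <= `|t - n%:~R|.
Proof.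
apply: ge_inf; last by exists n.
by exists 0 => _ [k _ <-].
Qed.

(** With [c = cos (pi / 3)], the angle [2 pi / 3 = pi - pi / 3] gives [2 c^2 - 1 = - c], that is
    [(2 c - 1)(c + 1) = 0], and [c >= 0] excludes [-1]. *)
Lemma cos_pi_third (R : realType) : cos (pi / 3 : R) = 2^-1.
Proof.
have pi0 := pi_gt0 R.
have h : cos (pi / 3 *+ 2) = - cos (pi / 3 : R).
  have -> : pi / 3 *+ 2 = - (pi / 3) + pi :> R by rewrite mulr2n; field.
  by rewrite cosDpi cosN.
have c0 : 0 <= cos (pi / 3 : R).
  by apply: cos_ge0_pihalf; apply/andP; split; lra.
rewrite cos_mulr2n in h.
have : (2 * cos (pi / 3 : R) - 1) * (cos (pi / 3) + 1) = 0.
  by move: h; rewrite -mulr_natr expr2 => h; nra.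
by move/eqP; rewrite mulf_eq0 => /orP[] /eqP; lra.
Qed.

(* On [0, pi/3] the mean value theorem and [cos >= 1/2] give [x/2], beyond
   that [sin >= sin (pi/3) >= 1/2]. *)
Lemma sin_ge_quarter (R : realType) (x : R) :
  0 <= x -> x <= pi / 2 -> x / 4 <= sin x.
Proof.
move=> x0 xpi.
have pi2 := pihalf_ge1 R; have pi4 := pihalf_lt2 R.
have cd : forall y z : R, 0 <= y -> y <= z -> z <= pi -> cos z <= cos y.
  move=> y z y0 yz zpi; rewrite leNgt ltr_cos ?in_itv /= -?leNgt//; lra.
have [x3|x3] := leP x (pi / 3).
  have [->|xn0] := eqVneq x 0; first by rewrite sin0 mul0r.
  have xp : 0 < x by rewrite lt_neqAle eq_sym xn0.
  have [c|c cx] := @MVT R sin cos 0 x xp (fun c _ => is_derive_sin c).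
    by apply: continuous_subspaceT; exact: continuous_sin.
  rewrite sin0 !subr0 => ->.
  move: cx; rewrite in_itv /= => /andP[c0 cx].
  have := cd c (pi / 3) (ltW c0) _ _; rewrite cos_pi_third => h.
  have : 2^-1 <= cos c by apply: h; lra.
  by nra.
have s3 : 2^-1 <= sin (pi / 3 : R).
  have h0 : 0 <= sin (pi / 3 : R) by apply: sin_ge0_pi; apply/andP; split; lra.
  have := sin2cos2 (pi / 3 : R); rewrite cos_pi_third => h.
  rewrite leNgt; apply/negP => h1; move: h; rewrite !expr2; nra.
apply: (@le_trans _ _ (sin (pi / 3))); first lra.
by rewrite leNgt ltr_sin ?in_itv /= -?leNgt; try (apply/andP; split); lra.
Qed.

Lemma cos2sin (R : realType) (x : R) : 1 - cos (2 * x) = 2 * sin x ^+ 2.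
Proof.
rewrite (_ : 2 * x = x *+ 2) ?cos_mulr2n; last by rewrite mulr_natl.
by rewrite sin2cos2 -mulr_natr; ring.
Qed.

Lemma sqr_normc_1sub_expi (R : realType) (t : R) :
  normc (1 - expi t) ^+ 2 = 4 * sin (pi * t) ^+ 2.
Proof.
rewrite sqr_normcE /=.
have := cos2Dsin2 (2 * pi * t); have := cos2sin (pi * t); rewrite mulrA.
set c := cos (2 * pi * t); set s := sin (2 * pi * t); set s1 := sin (pi * t).
by move=> h1 h2; rewrite add0r sqrrN; rewrite !expr2 in h1 h2 *; nra.
Qed.

(** The nearest integer can be subtracted inside [|sin (pi t)|], which is half of [|1 - expi t|] and
    so has period [1]. There remains an angle in [[0, pi / 2]], where
    [sin (pi y) >= pi y / 4 >= y / 2]. *)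
Lemma sin_pi_dist (R : realType) (t : R) : dist_int t <= 2 * `|sin (pi * t)|.
Proof.
have [n [-> hn]] := dist_intP t.
have pi0 := pi_gt0 R; have pi2 := pi_ge2 R.
suff h : `|sin (pi * (t - n%:~R))| = `|sin (pi * t)|.
  rewrite -h.
  have hsg : `|sin (pi * (t - n%:~R))| = `|sin (pi * `|t - n%:~R|)|.
    case: (ger0P (t - n%:~R)) => // _; by rewrite mulrN sinN normrN.
  rewrite hsg; set y := `|t - n%:~R| in hn *.
  have y0 : 0 <= y by exact: normr_ge0.
  have hy := @sin_ge_quarter R (pi * y) _ _.
  have : pi * y / 4 <= sin (pi * y) by apply: hy; nra.
  move=> hh; rewrite (le_trans _ (ler_wpM2l _ (ler_norm _)))//.
  by nra.
have e : forall z : R, `|sin (pi * z)| ^+ 2 = normc (1 - expi z) ^+ 2 / 4.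
  by move=> z; rewrite sqr_normc_1sub_expi real_normK ?num_real//; field.
apply/eqP; rewrite -(@eqrXn2 _ 2)//; apply/eqP; rewrite !e.
by rewrite -mulrNz expiDint.
Qed.

Lemma dist_le_1sub_expi (R : realType) (t : R) :
  dist_int t <= normc (1 - expi t).
Proof.
apply: le_trans (sin_pi_dist t) _.
rewrite -(@ler_pXn2r _ 2) ?nnegrE ?normc_ge0 ?mulr_ge0//.
rewrite sqr_normc_1sub_expi exprMn real_normK ?num_real//.
by rewrite ler_wpM2r ?sqr_ge0// expr2; lra.
Qed.

(** Multiplied by [1 - expi t] the geometric sum telescopes to [1 - expi (n t)]. The product form
    also covers integer [t], where the quotient degenerates. *)
Lemma normc_geom_expi (R : realType) (t : R) (n : nat) :
  normc (\sum_(j < n) expi (j%:R * t)) * normc (1 - expi t) <= 2.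
Proof.
rewrite -normcM.
have -> : (\sum_(j < n) expi (j%:R * t)) * (1 - expi t) = 1 - expi (n%:R * t).
  elim: n => [|n IH]; first by rewrite big_ord0 mul0r mul0r expi0 subrr.
  rewrite big_ord_recr /= mulrDl IH mulrBr mulr1 -expiD.
  by rewrite addrA subrK; congr (_ - expi _); rewrite -natr1 mulrDl mul1r.
rewrite (le_trans (normcDle _ _))// normcN' normc_expi.
by rewrite (_ : normc 1 = 1) ?normc1//.
Qed.

Lemma geom_expi_shift (R : realType) (t : R) (n N : nat) :
  \sum_(j < n) expi ((j%:R - N%:R) * t) =
  expi (- (N%:R * t)) * \sum_(j < n) expi (j%:R * t).
Proof.
rewrite mulr_sumr; apply: eq_bigr => j _; rewrite -expiD.
by congr expi; rewrite mulrBl addrC.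
Qed.

Lemma PsiE (R : realType) (N : nat) (n : int) : (0 < N)%N ->
  Psi (N%:R^-1 * n%:~R : R) = if (`|n| <= N)%N then 1 else 0.
Proof.
move=> N0; rewrite /Psi normrM ger0_norm ?invr_ge0// ler_pdivrMl ?ltr0n// mulr1.
by rewrite -intr_norm -[N%:R]mulrz_nat ler_int; case: ifPn; case: ifPn => //; lia.
Qed.

Lemma fsum_symm (V : zmodType) (N : nat) (F : int -> V) :
  (forall n : int, (N < `|n|)%N -> F n = 0) ->
  \sum_(n \in [set: int]) F n = \sum_(j < (N.*2).+1) F (j%:Z - N%:Z).
Proof.
move=> F0; pose r := [seq (j%:Z - N%:Z) | j <- iota 0 (N.*2).+1].
rewrite (@fsbigE _ _ _ _ _ r) => [| |i|i _].
- rewrite (eq_bigl xpredT) => [|j]; last by rewrite mem_set.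
  by rewrite /r big_map -(big_mkord xpredT (fun j => F (j%:Z - N%:Z))) /index_iota subn0.
- by rewrite map_inj_uniq ?iota_uniq// => a b /addIr [].
- by [].
- move=> ir; apply: F0; rewrite ltnNge; apply: contra ir => iN.
  apply/mapP; exists (absz (i + N%:Z)); last first.
    by rewrite gez0_abs ?addrK// -lerBlDr sub0r; lia.
  by rewrite mem_iota /= add0n ltnS; lia.
Qed.

Lemma sum_Psi (R : realType) (N : nat) : (0 < N)%N ->
  \sum_(k \in [set: int]) Psi (N%:R^-1 * k%:~R : R) = (N.*2.+1)%:R.
Proof.
move=> N0; rewrite (@fsum_symm _ N) => [|n hn].
  rewrite (eq_bigr (fun=> 1)) ?sumr_const ?card_ord// => j _.
  by rewrite PsiE// ifT//; have := ltn_ord j; lia.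
by rewrite PsiE// leqNgt hn.
Qed.

Lemma Phi_sum (R : realType) (N : nat) (g : int -> R[i]) : (0 < N)%N ->
  \sum_(n \in [set: int]) (Phi R N n)%:C * g n =
  ((N.*2.+1)%:R^-1)%:C * \sum_(j < (N.*2).+1) g (j%:Z - N%:Z).
Proof.
move=> N0; rewrite (@fsum_symm _ N) => [|n hn]; last first.
  by rewrite /Phi PsiE// leqNgt hn /= mulr0 mul0r.
rewrite mulr_sumr; apply: eq_bigr => j _; congr (_%:C * _).
by rewrite /Phi sum_Psi// PsiE// ifT ?mulr1//; have := ltn_ord j; lia.
Qed.

Lemma exp_sumE (R : realType) (N : nat) (t : R) : (0 < N)%N ->
  exp_sum (@Phi R) N t =
  ((N.*2.+1)%:R^-1)%:C * \sum_(j < (N.*2).+1) expi ((j%:R - N%:R) * t).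
Proof.
move=> N0; rewrite /exp_sum Phi_sum//; congr (_ * _); apply: eq_bigr => j _.
by rewrite intrB.
Qed.

Lemma exp_sum_le1 (R : realType) (N : nat) (t : R) : (0 < N)%N ->
  normc (exp_sum (@Phi R) N t) <= 1.
Proof.
move=> N0; rewrite exp_sumE// normcM normc_real ger0_norm ?invr_ge0//.
rewrite ler_pdivrMl ?ltr0n// mulr1 (le_trans (le_normc_sum _ _ _))//.
by rewrite (eq_bigr (fun=> 1)) ?sumr_const ?card_ord// => j _; rewrite normc_expi.
Qed.

(** The geometric bound [2 / ||t||] is divided by the [2 N + 1 >= 2 N] terms of the average; the
    phase that recentres the window has modulus one. *)
Lemma exp_sum_dist (R : realType) (N : nat) (t : R) : (0 < N)%N ->
  normc (exp_sum (@Phi R) N t) * (N%:R * dist_int t) <= 1.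
Proof.
move=> N0; rewrite exp_sumE// geom_expi_shift !normcM normc_expi mul1r.
rewrite normc_real ger0_norm ?invr_ge0//.
have := normc_geom_expi t (N.*2).+1.
have := dist_le_1sub_expi t; have := dist_int_ge0 t.
have := normc_ge0 (\sum_(j < (N.*2).+1) expi (j%:R * t)).
set S := normc _; set D := normc (1 - _); set dd := dist_int t => S0 d0 dD SD.
have Sd : S * dd <= 2 by apply: le_trans SD; rewrite ler_wpM2l.
rewrite -mulrA ler_pdivrMl ?ltr0n// mulr1 -addn1 -mul2n natrD natrM.
have n0 : 0 <= N%:R :> R by [].
have -> : S * (N%:R * dd) = S * dd * N%:R by ring.
by nra.
Qed.

(** Adding [S <= 1] and [S * (N ||t||) <= 1] gives [S * (1 + N ||t||) <= 2], the case [theta = 1];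
    smaller exponents follow because the base is at least [1]. *)
Lemma exp_sum_bound (R : realType) (theta : R) (N : nat) (t : R) :
  theta <= 1 -> (0 < N)%N ->
  normc (exp_sum (@Phi R) N t) <= 2 * (1 + N%:R * dist_int t) `^ (- theta).
Proof.
move=> t1 N0; have h1 := exp_sum_le1 t N0; have h2 := exp_sum_dist t N0.
have n0 : 0 <= N%:R * dist_int t :> R by rewrite mulr_ge0// dist_int_ge0.
apply: (@le_trans _ _ (2 * (1 + N%:R * dist_int t) `^ (- 1))).
  rewrite powR_inv1; last by lra.
  rewrite ler_pdivlMr; last by lra.
  by rewrite mulrDr mulr1; lra.
by rewrite ler_wpM2l// ler_powR//; lra.
Qed.

(** * Rotations of the torus *)

Definition fracr (R : realType) (x : R) : R := x - (Num.floor x)%:~R.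

Lemma fracr_itv (R : realType) (x : R) : 0 <= fracr x < 1.
Proof.
have /andP[h1 h2] := floor_itv x; rewrite /fracr; move: h2; rewrite intrD => h2.
by apply/andP; split; lra.
Qed.

Lemma fracr_id (R : realType) (x : R) : 0 <= x < 1 -> fracr x = x.
Proof.
move=> h; rewrite /fracr (@floor_def _ x 0) ?subr0//.
Qed.

Lemma fracrDz (R : realType) (x : R) (n : int) : fracr (x + n%:~R) = fracr x.
Proof.
rewrite /fracr; have /andP[h1 h2] := floor_itv x.
rewrite (@floor_def _ (x + n%:~R) (Num.floor x + n)).
  by rewrite intrD; ring.
by move: h2; rewrite !intrD => h2; apply/andP; split; lra.
Qed.

Lemma measurable_fracr (R : realType) :
  measurable_fun [set: measurableTypeR R] (@fracr R : measurableTypeR R -> measurableTypeR R).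
Proof.
apply: measurable_funB => //; apply: nondecreasing_measurable => //.
by move=> x y xy; rewrite ler_int le_floor.
Qed.

Lemma lebesgue_measure_shift (R : realType) (v : R) (A : set R) : measurable A ->
  pushforward (@lebesgue_measure R)
    (fun s : measurableTypeR R => (s + v : measurableTypeR R)) A = lebesgue_measure A.
Proof.
have mv : measurable_fun [set: measurableTypeR R]
    (fun s : measurableTypeR R => (s + v : measurableTypeR R)).
  exact: measurable_funD.
move=> mA; apply/esym/lebesgue_measure_unique => //= _ [[a b]] _ <-.
rewrite /pushforward.
rewrite (_ : _ @^-1` _ = `]a - v, b - v]%classic).
  rewrite !lebesgue_measure_itv/= !lte_fin ltrD2r.
  by case: ifPn => // _; rewrite -!EFinB; congr EFin; ring.
by apply/seteqP; split => s /=; rewrite !in_itv/= ltrBlDr lerBrDr.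
Qed.

(** A rotation exchanges two intervals: with [w] the fractional part of [v], points below [1 - w]
    move by [w], the others by [w - 1]. The pieces [A1] and [A2] cut [A] at [w], and each is handled
    by translation invariance. *)
Lemma lebesgue_rotation (R : realType) (v : R) (A : set R) : measurable A ->
  lebesgue_measure (`[0, 1[%classic `&` (fun s => fracr (s + v)) @^-1` A) =
  lebesgue_measure (`[0, 1[%classic `&` A).
Proof.
move=> mA; pose w := fracr v.
have /andP[w0 w1] : 0 <= w < 1 := fracr_itv v.
have -> : (fun s => fracr (s + v)) = (fun s => fracr (s + w)).
  by apply/funext => s; rewrite /w [fracr v]/fracr -[RHS](fracrDz _ (Num.floor v)) addrA subrK.
pose A1 := `[w, 1[%classic `&` A; pose A2 := `[0, w[%classic `&` A.
have mA1 : measurable A1 by exact: measurableI.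
have mA2 : measurable A2 by exact: measurableI.
have fE1 s : w <= s + w < 1 -> fracr (s + w) = s + w.
  by move=> h; rewrite fracr_id//; lra.
have fE2 s : 1 <= s + w < 1 + w -> fracr (s + w) = s + (w - 1).
  move=> h; rewrite -(fracrDz _ (-1)) fracr_id; first by rewrite mulrN1z; ring.
  by rewrite mulrN1z; lra.
have e1 : `[0, 1[%classic `&` (fun s => fracr (s + w)) @^-1` A =
   ((fun s : measurableTypeR R => (s + w : measurableTypeR R)) @^-1` A1) `|`
   ((fun s : measurableTypeR R => (s + (w - 1) : measurableTypeR R)) @^-1` A2).
  apply/seteqP; split=> s /=; rewrite /A1 /A2 /= !in_itv /=.
    move=> [/andP[s0 s1] h]; have [sw|sw] := ltP (s + w) 1.
      left; split; first by apply/andP; split; lra.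
      by rewrite fE1 in h => //; apply/andP; split; lra.
    right; split; first by apply/andP; split; lra.
    by rewrite fE2 in h => //; apply/andP; split; lra.
  move=> [] [/andP[h1 h2] h].
    rewrite fE1; last by apply/andP; split; lra.
    by split=> //; apply/andP; split; lra.
  rewrite fE2; last by apply/andP; split; lra.
  by split=> //; apply/andP; split; lra.
have e2 : `[0, 1[%classic `&` A = A1 `|` A2.
  rewrite /A1 /A2 -setIUl; congr (_ `&` _).
  apply/seteqP; split=> s /=; rewrite !in_itv/=; last by move=> [] /andP[? ?]; lra.
  by move=> /andP[s0 s1]; have [?|?] := ltP s w; [right|left]; lra.
have msh u : measurable_fun [set: measurableTypeR R]
    (fun s : measurableTypeR R => (s + u : measurableTypeR R)).
  exact: measurable_funD.
rewrite e1 e2 !measureU //; last 4 first.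
- apply/seteqP; split=> s //=; rewrite /A1 /A2 /= !in_itv /=.
  by move=> [[/andP[? ?] _] [/andP[? ?] _]]; lra.
- by rewrite -[X in measurable X]setTI; exact: msh.
- by rewrite -[X in measurable X]setTI; exact: msh.
- apply/seteqP; split=> s //=; rewrite /A1 /A2 /= !in_itv /=.
  by move=> [[/andP[? ?] _] [/andP[? ?] _]]; lra.
by congr (_ + _)%E; exact: lebesgue_measure_shift.
Qed.

(** * Maps preserving a measure on a subset *)

Section preserving.
Context d (T : measurableType d) (R : realType).
Variables (mu : {measure set T -> \bar R}) (D : set T).
Hypothesis mD : measurable D.

Lemma integral_mrestr (k : T -> \bar R) :
  measurable_fun [set: T] k -> (forall x, 0 <= k x)%E ->
  (\int[mrestr mu mD]_x k x = \int[mu]_(x in D) k x)%E.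
Proof.
move=> mk k0; rewrite (@ge0_negligible_integral _ _ _ _ setT (~` D))//.
- rewrite setTD setCK; apply: eq_measure_integral => A mA AD.
  by rewrite /= /mrestr setIidl.
- exact: measurableC.
- by rewrite /= /mrestr setICl measure0.
Qed.

Variable g : T -> T.
Hypotheses (mg : measurable_fun [set: T] g) (gD : forall x, D (g x)).
Hypothesis pres : forall A, measurable A -> mu (D `&` g @^-1` A) = mu (D `&` A).

(** After extension of [h] by zero this is the change of variables for the image under [g] of the
    measure restricted to [D]; [pres] says that this image is the restricted measure itself. *)
Lemma preserving_ge0_integral (h : T -> \bar R) :
  measurable_fun D h -> (forall x, D x -> 0 <= h x)%E ->
  (\int[mu]_(x in D) h (g x) = \int[mu]_(x in D) h x)%E.
Proof.
move=> mh h0; pose h1 := (h \_ D)%E.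
have mh1 : measurable_fun [set: T] h1.
  by apply/(measurable_restrictT _ _).1.
have h10 x : (0 <= h1 x)%E.
  by rewrite /h1 patchE; case: ifPn => // /set_mem; exact: h0.
transitivity (\int[mu]_(x in D) (h1 \o g) x)%E.
  by apply: eq_integral => x _; rewrite /h1 /= patchE mem_set.
rewrite -integral_mrestr; last 2 first.
- exact: measurableT_comp.
- by move=> x; exact: h10.
transitivity (\int[pushforward (mrestr mu mD) g]_x h1 x)%E.
  by rewrite ge0_integral_pushforward.
transitivity (\int[mrestr mu mD]_x h1 x)%E.
  apply: eq_measure_integral => A mA _ /=.
  by rewrite /pushforward /mrestr /= ![_ `&` D]setIC pres.
rewrite integral_mrestr//; apply: eq_integral => x xD.
by rewrite /h1 patchE xD.
Qed.

Lemma preserving_measurable (dU : measure_display) (X : measurableType dU) (h : T -> X) :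
  measurable_fun D h -> measurable_fun D (h \o g).
Proof.
move=> mh; apply: (@measurable_comp _ _ _ _ _ _ D) => //.
  by move=> _ [x _ <-]; exact: gD.
exact: measurable_funS mg.
Qed.

Lemma preserving_integrable (h : T -> R) :
  mu.-integrable D (EFin \o h) -> mu.-integrable D (EFin \o (h \o g)).
Proof.
move=> /integrableP[mh ih]; apply/integrableP; split.
  exact: (@preserving_measurable _ _ (EFin \o h)).
rewrite (@preserving_ge0_integral (fun x => `|(h x)%:E|%E))//.
exact: measurableT_comp.
Qed.

Lemma preserving_Rintegral (h : T -> R) :
  mu.-integrable D (EFin \o h) ->
  \int[mu]_(x in D) h (g x) = \int[mu]_(x in D) h x.
Proof.
move=> /integrableP[mh ih]; rewrite /Rintegral; congr fine.
rewrite integralE [RHS]integralE; congr (_ - _)%E.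
- rewrite -(@preserving_ge0_integral ((fun x => (h x)%:E)^\+)%E) //.
    by apply: eq_integral => x _; rewrite !funeposE.
  exact: measurable_funepos.
- rewrite -(@preserving_ge0_integral ((fun x => (h x)%:E)^\-)%E) //.
    by apply: eq_integral => x _; rewrite !funenegE.
  exact: measurable_funeneg.
Qed.

End preserving.

(** The torus translation by [v] read in the fundamental domain: it differs from [x + v] by an
    integer vector, which periodic functions do not see, and its values lie in the unit cube, over
    which all integrals are taken. *)
Definition rotV (R : realType) (d : nat) (v x : 'rV[R]_d) : 'rV[R]_d :=
  \row_i fracr (x ord0 i + v ord0 i).

Lemma measurable_rotV (R : realType) (d : nat) (v : 'rV[R]_d) :
  measurable_fun [set: 'rV[R]_d] (rotV v).
Proof.
apply: measurable_fun_rVP => i; under eq_fun do rewrite mxE.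
apply: (measurableT_comp (@measurable_fracr R)).
apply: measurable_funD => //; exact: measurable_coord.
Qed.

Lemma rotV_cube (R : realType) (d : nat) (v x : 'rV[R]_d) : @unit_cube R d (rotV v x).
Proof. by move=> i; rewrite mxE fracr_itv. Qed.

Lemma measurable_cube (R : realType) (d : nat) : measurable (@unit_cube R d).
Proof.
rewrite (_ : @unit_cube R d = \bigcap_(i in [set: 'I_d])
      ((fun x : 'rV[R]_d => x ord0 i) @^-1` `[0, 1[%classic)).
  apply: fin_bigcap_measurable => [|i _]; first exact: finite_finset.
  by rewrite -[X in measurable X]setTI; exact: measurable_coord.
apply/seteqP; split=> x /= h i; first by move=> _; rewrite /= in_itv; exact: h.
by have := h i I; rewrite /= in_itv.
Qed.

Lemma cube_measure (R : realType) (d : nat) : lebesgue_rV R d (@unit_cube R d) = 1%E.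
Proof.
rewrite (_ : @unit_cube R d = [set x : 'rV[R]_d | forall i, `[0, 1[%classic (x ord0 i)]).
  rewrite (@lebesgue_rV_box R d (fun=> `[0, 1[%classic)) => [|i]; last by [].
  by rewrite big1// => i _; rewrite lebesgue_measure_itv/= lte_fin ltr01 oppr0 adde0.
by apply/seteqP; split=> x /= h i; have := h i; rewrite in_itv.
Qed.

Lemma lebesgue_rVS (R : realType) (d : nat) (A : set 'rV[R]_d.+1) :
  lebesgue_rV R d.+1 A =
  (\int[@lebesgue_measure R]_s
     lebesgue_rV R d [set y | A (consV (s, y))])%E.
Proof.
rewrite /= /lebesgue_step /pushforward /product_measure1.
apply: eq_integral => s _ /=; congr (lebesgue_rV R d _).
by rewrite xsectionE.
Qed.

Lemma measurable_section (R : realType) (d : nat) (A : set 'rV[R]_d.+1) :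
  measurable A ->
  measurable_fun [set: measurableTypeR R]
    (fun s : measurableTypeR R => lebesgue_rV R d [set y | A (consV (s, y))]).
Proof.
move=> mA.
have := @measurable_fun_xsection _ _ (measurableTypeR R) 'rV[R]_d R (lebesgue_rV R d)
  (@consV R d @^-1` A) _.
rewrite (_ : _ \o _ = (fun s : measurableTypeR R => lebesgue_rV R d [set y | A (consV (s, y))])).
  by apply; rewrite -[X in measurable X]setTI; exact: measurable_consV.
apply/funext => s /=; congr (lebesgue_rV R d _).
by rewrite xsectionE.
Qed.

(** Induction on the dimension, slicing along the first coordinate: the induction hypothesis removes
    the rotation from each slice, and the one-dimensional rotation [g] is then removed from the
    outer integral of the slice measures [phi]. *)
Lemma rotV_preserving (R : realType) (d : nat) (v : 'rV[R]_d) (A : set 'rV[R]_d) :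
  measurable A ->
  lebesgue_rV R d (@unit_cube R d `&` rotV v @^-1` A) =
  lebesgue_rV R d (@unit_cube R d `&` A).
Proof.
elim: d v A => [|d IH] v A mA.
  congr (lebesgue_rV R 0 _); apply/seteqP; split=> x /=.
    by rewrite (_ : rotV v x = x) //; apply/rowP => -[].
  by rewrite (_ : rotV v x = x) //; apply/rowP => -[].
rewrite !lebesgue_rVS.
pose I01 : set (measurableTypeR R) := `[0, 1[%classic.
pose phi (s : measurableTypeR R) := lebesgue_rV R d (@unit_cube R d `&` [set y | A (consV (s, y))]).
pose v' : 'rV[R]_d := \row_i v ord0 (lift ord0 i).
pose g (s : measurableTypeR R) : measurableTypeR R := fracr (s + v ord0 ord0).
have mI : measurable I01 by exact: measurable_itv.
have mAs s : measurable [set y | A (@consV R d (s, y))].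
  have -> : [set y | A (@consV R d (s, y))] = xsection (@consV R d @^-1` A) s.
    by rewrite xsectionE.
  by apply: measurable_xsection; rewrite -[X in measurable X]setTI; exact: measurable_consV.
have cubeS s y : @unit_cube R d.+1 (consV (s, y)) <-> I01 s /\ @unit_cube R d y.
  rewrite /I01 /= in_itv /=; split.
    move=> h; split; first by have := h ord0; rewrite consVE0.
    by move=> i; have := h (lift ord0 i); rewrite consVES.
  move=> [h0 h] i; case: (unliftP ord0 i) => [j|] ->.
    by rewrite consVES; exact: h.
  by rewrite consVE0.
have eL s : lebesgue_rV R d [set y | (@unit_cube R d.+1 `&` rotV v @^-1` A) (consV (s, y))]
   = ((phi \o g) \_ I01) s.
  rewrite patchE; case: ifPn => [/set_mem sI|/negP sI].
    rewrite /= /phi -(IH v')//; congr (lebesgue_rV R d _).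
    have rE y : rotV v (consV (s, y)) = consV (g s, rotV v' y).
      apply/rowP => i; rewrite [LHS]mxE; case: (unliftP ord0 i) => [j|] ->.
        by rewrite !consVES !mxE.
      by rewrite !consVE0.
    apply/seteqP; split=> y /=; rewrite rE; first by move=> [/cubeS[_ ?] ?].
    by move=> [? ?]; split=> //; apply/cubeS.
  rewrite (_ : [set _ | _] = set0) ?measure0//.
  by apply/seteqP; split=> y //= [/cubeS[h _] _]; apply: sI; exact: mem_set.
have eR s : lebesgue_rV R d [set y | (@unit_cube R d.+1 `&` A) (consV (s, y))]
   = (phi \_ I01) s.
  rewrite patchE; case: ifPn => [/set_mem sI|/negP sI].
    rewrite /= /phi; congr (lebesgue_rV R d _).
    apply/seteqP; split=> y /=; first by move=> [/cubeS[_ ?] ?].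
    by move=> [? ?]; split=> //; apply/cubeS.
  rewrite (_ : [set _ | _] = set0) ?measure0//.
  by apply/seteqP; split=> y //= [/cubeS[h _] _]; apply: sI; exact: mem_set.
under eq_integral do rewrite eL.
under [RHS]eq_integral do rewrite eR.
rewrite -!integral_mkcond.
apply: (@preserving_ge0_integral _ _ _ (@lebesgue_measure R) I01 mI g) => //.
- apply: (measurableT_comp (@measurable_fracr R)).
  exact: measurable_funD.
- by move=> s; rewrite /I01 /= in_itv /= fracr_itv.
- by move=> B mB; exact: lebesgue_rotation.
- apply: (eq_measurable_fun (fun s => lebesgue_rV R d [set y | (@unit_cube R d.+1 `&` A) (consV (s, y))])).
    by move=> s sI; rewrite eR patchE sI.
  apply: measurable_funTS; apply: measurable_section; apply: measurableI => //.
  exact: measurable_cube.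
Qed.

(** * Fourier coefficients of the discrepancy *)

Definition cube_integrable (R : realType) (d : nat) (f : 'rV[R]_d -> R) :=
  (lebesgue_rV R d).-integrable (@unit_cube R d) (EFin \o f).

Definition cintegrable (R : realType) (d : nat) (f : 'rV[R]_d -> R[i]) :=
  cube_integrable (@complex.Re R \o f) /\ cube_integrable (@complex.Im R \o f).

Definition cmeasurable (R : realType) (d : nat) (f : 'rV[R]_d -> R[i]) :=
  measurable_fun [set: 'rV[R]_d] (@complex.Re R \o f) /\
  measurable_fun [set: 'rV[R]_d] (@complex.Im R \o f).

Lemma cube_integrable_bounded (R : realType) (d : nat) (f : 'rV[R]_d -> R) (M : R) :
  measurable_fun [set: 'rV[R]_d] f ->
  (forall x, unit_cube x -> `|f x| <= M) -> cube_integrable f.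
Proof.
move=> mf fM; apply: measurable_bounded_integrable.
- exact: measurable_cube.
- by apply: (@eq_ind_r _ 1%E (fun x => x < +oo)%E _ _ (cube_measure R d)); rewrite ltry.
- exact: measurable_funTS.
- exists M; split; first exact: num_real.
  by move=> y My x cx; rewrite /= (le_trans (fM x cx))// ltW.
Qed.

Lemma cube_integrableM (R : realType) (d : nat) (f h : 'rV[R]_d -> R) (M : R) :
  cube_integrable f -> measurable_fun [set: 'rV[R]_d] h ->
  (forall x, `|h x| <= M) -> cube_integrable (fun x => f x * h x).
Proof.
move=> fi mh hM.
rewrite /cube_integrable (_ : _ \o _ = ((EFin \o f) \* (EFin \o h))%E).
  apply: integrableMl => //; first exact: measurable_cube.
    exact: measurable_funTS.
  exists M; split; first exact: num_real.
  by move=> y My x cx; rewrite /= (le_trans (hM x))// ltW.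
by apply/funext => x /=; rewrite EFinM.
Qed.

Lemma cube_integrableD (R : realType) (d : nat) (f h : 'rV[R]_d -> R) :
  cube_integrable f -> cube_integrable h -> cube_integrable (fun x => f x + h x).
Proof.
move=> fi hi; rewrite /cube_integrable (_ : _ \o _ = ((EFin \o f) \+ (EFin \o h))%E) //.
by apply: integrableD => //; exact: measurable_cube.
Qed.

Lemma cube_integrableB (R : realType) (d : nat) (f h : 'rV[R]_d -> R) :
  cube_integrable f -> cube_integrable h -> cube_integrable (fun x => f x - h x).
Proof.
move=> fi hi; rewrite /cube_integrable (_ : _ \o _ = ((EFin \o f) \- (EFin \o h))%E) //.
by apply: integrableB => //; exact: measurable_cube.
Qed.

Lemma cube_integrable_cst (R : realType) (d : nat) (c : R) :
  cube_integrable (fun _ : 'rV[R]_d => c).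
Proof. by apply: (@cube_integrable_bounded _ _ _ `|c|). Qed.

Lemma cube_integrableZ (R : realType) (d : nat) (c : R) (f : 'rV[R]_d -> R) :
  cube_integrable f -> cube_integrable (fun x => c * f x).
Proof.
move=> fi; have := @cube_integrableM _ _ f (fun=> c) `|c| fi (@measurable_cst _ _ _ _ _ _) (fun=> lexx _).
by under [X in _ -> cube_integrable X]eq_fun do rewrite mulrC.
Qed.

Lemma cube_integrable_sum (R : realType) (d : nat) (I : Type) (s : seq I) (F : I -> 'rV[R]_d -> R) :
  (forall i, cube_integrable (F i)) -> cube_integrable (fun x => \sum_(i <- s) F i x).
Proof.
move=> Fi; elim: s => [|i s IH].
  by under eq_fun do rewrite big_nil; exact: cube_integrable_cst.
by under eq_fun do rewrite big_cons; exact: cube_integrableD.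
Qed.

Lemma Rintegral_cube_cst (R : realType) (d : nat) (c : R) :
  \int[lebesgue_rV R d]_(x in @unit_cube R d) c = c.
Proof.
rewrite Rintegral_cst; last exact: measurable_cube.
transitivity (c * fine 1%E); last by rewrite mulr1.
by congr (c * fine _); exact: cube_measure.
Qed.

Lemma natrC (R : realType) (n : nat) : (n%:R : R)%:C = n%:R.
Proof.
elim: n => [//|n IH]; rewrite -!natr1 -IH.
by apply: complexP; rewrite /= ?addr0.
Qed.

Section torus_integral_theory.
Variables (R : realType) (d : nat).
Implicit Types f g h : 'rV[R]_d -> R[i].

Lemma cintegrable_bounded f (M : R) : cmeasurable f ->
  (forall x, unit_cube x -> normc (f x) <= M) -> cintegrable f.
Proof.
move=> [m1 m2] fM; split; apply: (@cube_integrable_bounded _ _ _ M) => // x cx.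
  by rewrite (le_trans (normr_Re_le _))// fM.
by rewrite (le_trans (normr_Im_le _))// fM.
Qed.

Lemma cintegrableD f g : cintegrable f -> cintegrable g ->
  cintegrable (fun x => f x + g x).
Proof.
move=> [f1 f2] [g1 g2]; split.
  by rewrite (_ : _ \o _ = fun x => (@complex.Re R \o f) x + (@complex.Re R \o g) x);
    [exact: cube_integrableD|apply/funext => x /=; rewrite cReD].
by rewrite (_ : _ \o _ = fun x => (@complex.Im R \o f) x + (@complex.Im R \o g) x);
  [exact: cube_integrableD|apply/funext => x /=; rewrite cImD].
Qed.

Lemma cintegrableM f h (M : R) : cintegrable f -> cmeasurable h ->
  (forall x, normc (h x) <= M) -> cintegrable (fun x => f x * h x).
Proof.
move=> [f1 f2] [h1 h2] hM.
have r1 x : `|complex.Re (h x)| <= M by rewrite (le_trans (normr_Re_le _)).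
have r2 x : `|complex.Im (h x)| <= M by rewrite (le_trans (normr_Im_le _)).
split.
  rewrite (_ : _ \o _ = fun x => (@complex.Re R \o f) x * (@complex.Re R \o h) x - (@complex.Im R \o f) x * (@complex.Im R \o h) x); last by apply/funext => x /=; rewrite cReM.
  by apply: cube_integrableB; apply: (@cube_integrableM _ _ _ _ M).
rewrite (_ : _ \o _ = fun x => (@complex.Re R \o f) x * (@complex.Im R \o h) x + (@complex.Im R \o f) x * (@complex.Re R \o h) x); last by apply/funext => x /=; rewrite cImM.
by apply: cube_integrableD; apply: (@cube_integrableM _ _ _ _ M).
Qed.

Lemma cintegrable_cst (c : R[i]) : cintegrable (fun _ : 'rV[R]_d => c).
Proof. by split; apply: cube_integrable_cst. Qed.

Lemma cintegrableZ (c : R[i]) f : cintegrable f -> cintegrable (fun x => c * f x).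
Proof.
move=> fi; under eq_fun do rewrite mulrC.
by apply: (@cintegrableM _ (fun=> c) (normc c)) => //; split; exact: measurable_cst.
Qed.

Lemma cintegrable_sum (I : Type) (s : seq I) (F : I -> 'rV[R]_d -> R[i]) :
  (forall i, cintegrable (F i)) -> cintegrable (fun x => \sum_(i <- s) F i x).
Proof.
move=> Fi; elim: s => [|i s IH].
  by under eq_fun do rewrite big_nil; exact: cintegrable_cst.
by under eq_fun do rewrite big_cons; exact: cintegrableD.
Qed.

Lemma torus_integral_cst (c : R[i]) : torus_integral (fun _ : 'rV[R]_d => c) = c.
Proof.
by rewrite /torus_integral !Rintegral_cube_cst; case: c.
Qed.

Lemma torus_integralD f g : cintegrable f -> cintegrable g ->
  torus_integral (fun x => f x + g x) = torus_integral f + torus_integral g.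
Proof.
move=> [f1 f2] [g1 g2]; apply: complexP; rewrite ?cReD ?cImD /=.
  under eq_Rintegral do rewrite cReD.
  by rewrite RintegralD//; exact: measurable_cube.
under eq_Rintegral do rewrite cImD.
by rewrite RintegralD//; exact: measurable_cube.
Qed.

Lemma torus_integralZ (c : R[i]) f : cintegrable f ->
  torus_integral (fun x => c * f x) = c * torus_integral f.
Proof.
have mc := @measurable_cube R d.
move=> [f1 f2]; apply: complexP; rewrite ?cReM ?cImM /=.
  under eq_Rintegral do rewrite cReM.
  rewrite RintegralB//; [|exact: (cube_integrableZ _ f1)|exact: (cube_integrableZ _ f2)].
  by rewrite !RintegralZl.
under eq_Rintegral do rewrite cImM.
rewrite RintegralD//; [|exact: (cube_integrableZ _ f2)|exact: (cube_integrableZ _ f1)].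
by rewrite !RintegralZl.
Qed.

Lemma torus_integral_sum (I : Type) (s : seq I) (F : I -> 'rV[R]_d -> R[i]) :
  (forall i, cintegrable (F i)) ->
  torus_integral (fun x => \sum_(i <- s) F i x) = \sum_(i <- s) torus_integral (F i).
Proof.
move=> Fi; elim: s => [|i s IH].
  under eq_fun do rewrite big_nil.
  by rewrite big_nil torus_integral_cst.
under eq_fun do rewrite big_cons.
by rewrite big_cons torus_integralD// ?IH//; exact: cintegrable_sum.
Qed.

(* Rotate the value of the integral to the positive real axis and compare
   real parts. *)
Lemma normc_torus_integral_le f (k : 'rV[R]_d -> R) : cintegrable f ->
  cube_integrable k -> (forall x, unit_cube x -> normc (f x) <= k x) ->
  normc (torus_integral f) <= \int[lebesgue_rV R d]_(x in @unit_cube R d) k x.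
Proof.
move=> fi ki fk; set I := torus_integral f.
have mc := @measurable_cube R d.
have [I0|I0] := eqVneq I 0.
  rewrite I0 normc0; apply: Rintegral_ge0 => x cx.
  by rewrite (le_trans _ (fk x cx))// normc_ge0.
have nI : normc I != 0 by apply: contra_neq I0 => /eq0_normc.
pose w : R[i] := (normc I)%:C / I.
have nw : normc w = 1.
  by rewrite normcM normc_real normcV ger0_norm ?normc_ge0// divff.
have wI : w * I = (normc I)%:C by rewrite /w divfK.
have <- : complex.Re (w * I) = normc I by rewrite wI.
rewrite -torus_integralZ// /=; apply: le_Rintegral => //.
  exact: (cintegrableZ w fi).1.
move=> x cx; rewrite (le_trans (ler_norm _))// (le_trans (normr_Re_le _))//.
by rewrite normcM nw mul1r fk.
Qed.

Lemma normc_torus_integral_bound f (M : R) : cintegrable f ->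
  (forall x, unit_cube x -> normc (f x) <= M) -> normc (torus_integral f) <= M.
Proof.
move=> fi fM; apply: le_trans (normc_torus_integral_le fi (cube_integrable_cst d M) fM) _.
by rewrite Rintegral_cube_cst.
Qed.

Lemma cintegrable_rotV f (v : 'rV[R]_d) : cintegrable f -> cintegrable (f \o rotV v).
Proof.
have p := @rotV_preserving R d v; have mc := @measurable_cube R d.
move=> [f1 f2]; split.
  exact: (@preserving_integrable _ _ _ _ _ mc _ (measurable_rotV v) (rotV_cube v) p (@complex.Re R \o f)).
exact: (@preserving_integrable _ _ _ _ _ mc _ (measurable_rotV v) (rotV_cube v) p (@complex.Im R \o f)).
Qed.

Lemma torus_integral_rotV f (v : 'rV[R]_d) : cintegrable f ->
  torus_integral (f \o rotV v) = torus_integral f.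
Proof.
have p := @rotV_preserving R d v; have mc := @measurable_cube R d.
move=> [f1 f2]; rewrite /torus_integral; congr (_ +i* _).
  exact: (@preserving_Rintegral _ _ _ _ _ mc _ (measurable_rotV v) (rotV_cube v) p (@complex.Re R \o f)).
exact: (@preserving_Rintegral _ _ _ _ _ mc _ (measurable_rotV v) (rotV_cube v) p (@complex.Im R \o f)).
Qed.

Lemma rotVE (v x : 'rV[R]_d) :
  rotV v x = x + v + map_mx intr (- \row_i Num.floor (x ord0 i + v ord0 i)).
Proof. by apply/rowP => i; rewrite !mxE /fracr mulrNz. Qed.

Lemma periodic_rotV f (v x : 'rV[R]_d) : Zperiodic f -> f (rotV v x) = f (x + v).
Proof. by move=> pf; rewrite rotVE pf. Qed.

Lemma torus_integral_translate f (v : 'rV[R]_d) : Zperiodic f -> cintegrable f ->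
  torus_integral (fun x => f (x + v)) = torus_integral f.
Proof.
move=> pf fi; rewrite -(torus_integral_rotV v fi); congr torus_integral.
by apply/funext => x /=; rewrite periodic_rotV.
Qed.

Lemma cintegrable_translate f (v : 'rV[R]_d) : Zperiodic f -> cintegrable f ->
  cintegrable (fun x => f (x + v)).
Proof.
move=> pf fi; have := cintegrable_rotV v fi; rewrite (_ : f \o _ = fun x => f (x + v))//.
by apply/funext => x /=; rewrite periodic_rotV.
Qed.

Implicit Types m : 'rV[int]_d.

Lemma dotZDr m (x y : 'rV[R]_d) : dotZ m (x + y) = dotZ m x + dotZ m y.
Proof. by rewrite /dotZ -big_split; apply: eq_bigr => i _; rewrite mxE mulrDr. Qed.

Lemma dotZDl m n (x : 'rV[R]_d) : dotZ (m + n) x = dotZ m x + dotZ n x.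
Proof. by rewrite /dotZ -big_split; apply: eq_bigr => i _; rewrite mxE intrD mulrDl. Qed.

Lemma dotZNl m (x : 'rV[R]_d) : dotZ (- m) x = - dotZ m x.
Proof. by rewrite /dotZ -sumrN; apply: eq_bigr => i _; rewrite mxE mulrNz mulNr. Qed.

Lemma dotZBl m n (x : 'rV[R]_d) : dotZ (m - n) x = dotZ m x - dotZ n x.
Proof. by rewrite dotZDl dotZNl. Qed.

Lemma dotZZr m (a : R) (x : 'rV[R]_d) : dotZ m (a *: x) = a * dotZ m x.
Proof. by rewrite /dotZ mulr_sumr; apply: eq_bigr => i _; rewrite mxE mulrCA. Qed.

Lemma dotZ0l (x : 'rV[R]_d) : dotZ (0 : 'rV[int]_d) x = 0.
Proof. by rewrite /dotZ big1// => i _; rewrite mxE mul0r. Qed.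

Lemma dotZ_int m (k : 'rV[int]_d) :
  dotZ m (map_mx intr k : 'rV[R]_d) = (\sum_(i < d) m ord0 i * k ord0 i)%:~R.
Proof.
rewrite (big_morph (fun z : int => z%:~R : R) (@intrD R) (mulr0z _)).
by apply: eq_bigr => i _; rewrite mxE intrM.
Qed.

Lemma periodic_expi m : Zperiodic (fun x : 'rV[R]_d => expi (dotZ m x)).
Proof. by move=> k x; rewrite dotZDr dotZ_int expiDint. Qed.

Lemma measurable_dotZ m : measurable_fun [set: 'rV[R]_d] (fun x => dotZ m x).
Proof.
apply: measurable_sum => i; apply: measurable_funM => //.
exact: measurable_coord.
Qed.

Lemma cmeasurable_expi (w : 'rV[R]_d -> R) : measurable_fun [set: 'rV[R]_d] w ->
  cmeasurable (fun x => expi (w x)).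
Proof.
move=> mw; have m2 : measurable_fun [set: 'rV[R]_d] (fun x => 2 * pi * w x).
  exact: measurable_funM.
split; rewrite /comp /=.
  exact: (measurableT_comp (continuous_measurable_fun (@continuous_cos R)) m2).
exact: (measurableT_comp (continuous_measurable_fun (@continuous_sin R)) m2).
Qed.

Lemma cmeasurable_expi_dotZ m : cmeasurable (fun x : 'rV[R]_d => expi (dotZ m x)).
Proof. exact: (cmeasurable_expi (measurable_dotZ m)). Qed.

Lemma cintegrable_expi m : cintegrable (fun x : 'rV[R]_d => expi (dotZ m x)).
Proof.
apply: (@cintegrable_bounded _ 1); first exact: cmeasurable_expi_dotZ.
by move=> x _; rewrite normc_expi.
Qed.

Lemma cintegrableM_expi f m : cintegrable f ->
  cintegrable (fun x => f x * expi (dotZ m x)).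
Proof.
move=> fi; apply: (@cintegrableM _ _ 1) => //; first exact: cmeasurable_expi_dotZ.
by move=> x; rewrite normc_expi.
Qed.

(* A translation by half a period of the character flips the sign of the
   integral. *)
Lemma torus_integral_expi m : m != 0 ->
  torus_integral (fun x : 'rV[R]_d => expi (dotZ m x)) = 0.
Proof.
move=> m0; have [i mi] : exists i, m ord0 i != 0.
  apply/existsP; apply: contra_neqT m0; rewrite negb_exists => /forallP h.
  by apply/rowP => i; rewrite mxE; apply/eqP; have := h i; rewrite negbK.
pose v : 'rV[R]_d := ((m ord0 i)%:~R^-1 / 2) *: delta_mx ord0 i.
have vE : dotZ m v = 2^-1.
  rewrite dotZZr /dotZ (bigD1 i)//= mxE !eqxx mulr1 big1 ?addr0 => [|j ji].
    by rewrite mulrAC mulVf ?mul1r// intr_eq0.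
  by rewrite mxE eqxx (negbTE ji) mulr0.
have e2 : expi (2^-1 : R) = -1.
  by rewrite /expi mulrAC divff ?pnatr_eq0// mul1r cospi sinpi; apply: complexP; rewrite /= ?oppr0.
have := torus_integral_translate v (periodic_expi m) (cintegrable_expi m).
under eq_fun do rewrite dotZDr vE expiD e2 mulrC.
rewrite torus_integralZ; last exact: cintegrable_expi.
set I := torus_integral _ => h; have : I + I = 0 by rewrite -{1}h mulN1r addNr.
by rewrite -mulr2n => /eqP; rewrite mulrn_eq0 /= => /eqP.
Qed.

Lemma fourier_coef_translate f m (v : 'rV[R]_d) : Zperiodic f -> cintegrable f ->
  fourier_coef (fun x => f (x + v)) m = expi (dotZ m v) * fourier_coef f m.
Proof.
move=> pf fi; rewrite /fourier_coef.
pose h x := f x * expi (dotZ (- m) x).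
have hi : cintegrable h by exact: cintegrableM_expi.
have ph : Zperiodic h by move=> k x; rewrite /h pf periodic_expi.
have -> : (fun x => f x * expi (- dotZ m x)) = h by apply/funext => x; rewrite /h dotZNl.
rewrite -(torus_integral_translate v ph hi) -torus_integralZ; last exact: cintegrable_translate.
congr torus_integral; apply/funext => x; rewrite /h mulrCA; congr (_ * _).
by rewrite -expiD dotZNl dotZDr; congr expi; ring.
Qed.

Lemma discrepancyE f (alpha x : 'rV[R]_d) (N : nat) : (0 < N)%N ->
  discrepancy (@Phi R) alpha f N x =
  ((N.*2.+1)%:R^-1)%:C * \sum_(j < (N.*2).+1) f (x + (j%:R - N%:R) *: alpha)
  - torus_integral f.
Proof.
move=> N0; rewrite /discrepancy Phi_sum//; congr (_ * _ - _).
by apply: eq_bigr => j _; rewrite intrB.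
Qed.

Lemma fourier_coefB f g m : cintegrable f -> cintegrable g ->
  fourier_coef (fun x => f x - g x) m = fourier_coef f m - fourier_coef g m.
Proof.
move=> fi gi; rewrite /fourier_coef.
have e : (fun x : 'rV[R]_d => expi (- dotZ m x)) = fun x => expi (dotZ (- m) x).
  by apply/funext => x; rewrite dotZNl.
have E k : (fun x => k x * expi (- dotZ m x)) = (fun x => k x * expi (dotZ (- m) x)) :> ('rV[R]_d -> R[i]).
  by apply/funext => x; rewrite dotZNl.
rewrite !E -[X in _ = _ + X]mulN1r -torus_integralZ; last exact: cintegrableM_expi.
rewrite -torus_integralD; [|exact: cintegrableM_expi|by apply: cintegrableZ; exact: cintegrableM_expi].
by congr torus_integral; apply/funext => x; rewrite mulrBl mulN1r.
Qed.

Lemma fourier_coef_cst (c : R[i]) m : m != 0 ->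
  fourier_coef (fun _ : 'rV[R]_d => c) m = 0.
Proof.
move=> m0; rewrite /fourier_coef.
under eq_fun do rewrite -dotZNl.
by rewrite torus_integralZ ?torus_integral_expi ?mulr0 ?oppr_eq0//; exact: cintegrable_expi.
Qed.

Lemma fourier_coef0 f : fourier_coef f 0 = torus_integral f.
Proof.
by rewrite /fourier_coef; congr torus_integral; apply/funext => x; rewrite dotZ0l oppr0 expi0 mulr1.
Qed.

Lemma cintegrable_average f (alpha : 'rV[R]_d) (N : nat) : Zperiodic f -> cintegrable f ->
  cintegrable (fun x => ((N.*2.+1)%:R^-1)%:C *
    \sum_(j < (N.*2).+1) f (x + (j%:R - N%:R) *: alpha)).
Proof.
move=> pf fi; apply: cintegrableZ; apply: cintegrable_sum => j.
exact: cintegrable_translate.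
Qed.

(** The translate by [(j - N) alpha] multiplies the coefficient by the phase
    [expi ((j - N) m.alpha)]; the average of these phases is [exp_sum] at [m.alpha]. *)
Lemma fourier_coef_average f (alpha : 'rV[R]_d) (N : nat) m :
  (0 < N)%N -> Zperiodic f -> cintegrable f ->
  fourier_coef (fun x => ((N.*2.+1)%:R^-1)%:C *
    \sum_(j < (N.*2).+1) f (x + (j%:R - N%:R) *: alpha)) m =
  exp_sum (@Phi R) N (dotZ m alpha) * fourier_coef f m.
Proof.
move=> N0 pf fi; rewrite exp_sumE// -mulrA mulr_suml.
rewrite [LHS](_ : _ = ((N.*2.+1)%:R^-1)%:C *
    \sum_(j < (N.*2).+1) fourier_coef (fun x => f (x + (j%:R - N%:R) *: alpha)) m).
  congr (_ * _); apply: eq_bigr => j _.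
  by rewrite fourier_coef_translate// dotZZr.
have ci j : cintegrable (fun x => f (x + (j%:R - N%:R) *: alpha) * expi (- dotZ m x)).
  under eq_fun do rewrite -dotZNl.
  by apply: cintegrableM_expi; exact: cintegrable_translate.
rewrite /fourier_coef -torus_integral_sum; last by move=> j; exact: ci.
rewrite -torus_integralZ; last by apply: cintegrable_sum => j; exact: ci.
by congr torus_integral; apply/funext => x; rewrite -mulrA mulr_suml.
Qed.

Lemma cintegrable_discrepancy f (alpha : 'rV[R]_d) (N : nat) :
  (0 < N)%N -> Zperiodic f -> cintegrable f ->
  cintegrable (discrepancy (@Phi R) alpha f N).
Proof.
move=> N0 pf fi.
rewrite (_ : discrepancy _ _ _ _ = fun x => ((N.*2.+1)%:R^-1)%:C * \sum_(j < (N.*2).+1) f (x + (j%:R - N%:R) *: alpha) + (- torus_integral f)).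
  by apply: cintegrableD; [exact: cintegrable_average|exact: cintegrable_cst].
by apply/funext => x; rewrite discrepancyE.
Qed.

Lemma fourier_coef_discrepancy f (alpha : 'rV[R]_d) (N : nat) m :
  (0 < N)%N -> Zperiodic f -> cintegrable f -> m != 0 ->
  fourier_coef (discrepancy (@Phi R) alpha f N) m =
  exp_sum (@Phi R) N (dotZ m alpha) * fourier_coef f m.
Proof.
move=> N0 pf fi m0; rewrite -fourier_coef_average//.
rewrite -[RHS]subr0 -[X in _ = _ - X](fourier_coef_cst (torus_integral f) m0).
rewrite -fourier_coefB; [|exact: cintegrable_average|exact: cintegrable_cst].
by congr fourier_coef; apply/funext => x; rewrite discrepancyE.
Qed.

Lemma fourier_coef_discrepancy0 f (alpha : 'rV[R]_d) (N : nat) :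
  (0 < N)%N -> Zperiodic f -> cintegrable f ->
  fourier_coef (discrepancy (@Phi R) alpha f N) 0 = 0.
Proof.
move=> N0 pf fi.
rewrite [X in fourier_coef X](_ : _ = fun x => ((N.*2.+1)%:R^-1)%:C * \sum_(j < (N.*2).+1) f (x + (j%:R - N%:R) *: alpha) - (torus_integral f)); last first.
  by apply/funext => x; rewrite discrepancyE.
rewrite fourier_coefB; [|exact: cintegrable_average|exact: cintegrable_cst].
rewrite fourier_coef_average// !fourier_coef0 torus_integral_cst dotZ0l exp_sumE//.
rewrite (eq_bigr (fun=> 1)) => [|j _]; last by rewrite mulr0 expi0.
rewrite sumr_const card_ord -mulrA.
have -> : ((N.*2.+1)%:R^-1)%:C * (1 *+ N.*2.+1 * torus_integral f) = torus_integral f.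
  rewrite mulrA -natrC -rmorphM /= mulVf ?mul1r//.
by rewrite subrr.
Qed.

Lemma periodic_discrepancy f (alpha : 'rV[R]_d) (N : nat) :
  (0 < N)%N -> Zperiodic f -> Zperiodic (discrepancy (@Phi R) alpha f N).
Proof.
move=> N0 pf k x; rewrite !discrepancyE//; congr (_ * _ - _).
by apply: eq_bigr => j _; rewrite addrAC pf.
Qed.

End torus_integral_theory.

(** * Fejer summation *)

(** The sigma-algebra on row vectors is generated by the coordinates, not by open sets. So [g] is
    written as the pointwise limit of its samples on grids of mesh [1 / (k + 1)], each constant on
    countably many measurable cells. *)
Lemma measurable_continuous_rV (R : realType) (d : nat) (g : 'rV[R]_d -> R) :
  continuous g -> measurable_fun [set: 'rV[R]_d] g.
Proof.
move=> cg.
pose pt (k : nat) (z : 'rV[int]_d) : 'rV[R]_d := \row_i ((z ord0 i)%:~R / k.+1%:R).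
pose cell (k : nat) (x : 'rV[R]_d) : 'rV[int]_d := \row_i Num.floor (k.+1%:R * x ord0 i).
apply: (@measurable_fun_cvg _ _ _ setT (fun k x => g (pt k (cell k x)))) => [k|x _].
- move=> _ Y mY; rewrite setTI.
  rewrite (_ : _ @^-1` Y = \bigcup_(z in [set: 'rV[int]_d])
     (if `[< Y (g (pt k z)) >] then [set x | cell k x = z] else set0)).
    apply: countable_bigcupT_measurable; first exact: countableP.
    move=> z; case: ifPn => // _.
    rewrite (_ : [set x | cell k x = z] = \bigcap_(i in [set: 'I_d])
      ((fun x : 'rV[R]_d => x ord0 i) @^-1` `[(z ord0 i)%:~R / k.+1%:R, (z ord0 i + 1)%:~R / k.+1%:R[%classic)).
      apply: fin_bigcap_measurable => [|i _]; first exact: finite_finset.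
      by rewrite -[X in measurable X]setTI; exact: measurable_coord.
    apply/seteqP; split=> x /=.
      move=> <- i _; rewrite /= in_itv /= mxE.
      rewrite ler_pdivrMr// ltr_pdivlMr// ![x ord0 i * _]mulrC.
      exact: floor_itv.
    move=> h; apply/rowP => i; rewrite mxE; apply: floor_def.
    have := h i I; rewrite /= in_itv /= ler_pdivrMr// ltr_pdivlMr//.
    by rewrite ![x ord0 i * _]mulrC.
  apply/seteqP; split=> x /=.
    by move=> Yx; exists (cell k x) => //; rewrite asboolT.
  by move=> [z _]; case: asboolP => //= Yz xz; rewrite xz.
apply: (@cvg_comp _ _ _ (fun k => pt k (cell k x)) g _ (nbhs x)); last exact: cg.
apply/cvg_ballP => e e0.
near=> k.
split=> // i j; rewrite (ord1 i) !mxE /ball /=.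
have k0 : 0 < k.+1%:R :> R by rewrite ltr0n.
have /andP[h1 h2] := floor_itv (k.+1%:R * x ord0 j).
set fl := Num.floor _ in h1 h2 *; rewrite intrD in h2.
have -> : x ord0 j - fl%:~R / k.+1%:R = (k.+1%:R * x ord0 j - fl%:~R) / k.+1%:R.
  by rewrite mulrBl mulrAC mulfV ?mul1r// lt0r_neq0.
rewrite ger0_norm; last by rewrite divr_ge0//; lra.
rewrite ltr_pdivrMr//.
have : e^-1 < k.+1%:R.
  apply: lt_trans (truncnS_gt _) _.
  by rewrite ltr_nat; near: k; exact: nbhs_infty_gt.
rewrite -(ltr_pM2r e0) mulVf ?gt_eqF// mulrC => h.
by lra.
Unshelve. all: by end_near. Qed.

Lemma periodic_continuous_bounded (R : realType) (d : nat) (g : 'rV[R]_d -> R) :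
  (forall (k : 'rV[int]_d) x, g (x + map_mx intr k) = g x) -> continuous g ->
  exists M : R, forall x, `|g x| <= M.
Proof.
move=> pg cg.
pose K : set 'rV[R]_d := [set v | forall i, `[0, 1]%classic (v ord0 i)].
have cK : compact K by apply: (@rV_compact R d (fun=> `[0, 1]%classic)) => i; exact: segment_compact.
have : compact (g @` K).
  by apply: continuous_compact => //; exact: continuous_subspaceT.
move=> /compact_bounded [M [_ hM]]; exists (M + 1) => x.
have -> : g x = g (rotV 0 x) by rewrite rotVE pg addr0.
apply: (hM (M + 1)); first by rewrite ltrDl.
exists (rotV 0 x) => // i; rewrite /= in_itv /=.
by have /andP[-> /ltW ->] := rotV_cube 0 x i.
Qed.

Section torus_continuous_theory.
Variables (R : realType) (d : nat).
Implicit Types f g h : 'rV[R]_d -> R[i].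

Lemma torus_continuous_measurable f : torus_continuous f -> cmeasurable f.
Proof. by move=> [_ c1 c2]; split; exact: measurable_continuous_rV. Qed.

Lemma torus_continuous_bounded f : torus_continuous f ->
  exists M : R, forall x, normc (f x) <= M.
Proof.
move=> [pf c1 c2].
have [M1 h1] : exists M, forall x, `|(@complex.Re R \o f) x| <= M.
  by apply: periodic_continuous_bounded => // k x /=; rewrite pf.
have [M2 h2] : exists M, forall x, `|(@complex.Im R \o f) x| <= M.
  by apply: periodic_continuous_bounded => // k x /=; rewrite pf.
by exists (M1 + M2) => x; rewrite (le_trans (normc_leReIm _))// lerD ?h1 ?h2.
Qed.

Lemma torus_continuous_integrable f : torus_continuous f -> cintegrable f.
Proof.
move=> cf; have [M hM] := torus_continuous_bounded cf.
by apply: (@cintegrable_bounded _ _ _ M) => //; exact: torus_continuous_measurable.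
Qed.

(** Continuity handles the points all of whose coordinates are [r]-close to those of [x0] modulo
    integers; elsewhere some [sin^2] is at least [r^2 / 4] and pays for the oscillation. The penalty
    is [sin^2] because this is what the Fejer kernel absorbs. *)
Lemma torus_continuous_modulus f (x0 : 'rV[R]_d) (e : R) : torus_continuous f ->
  0 < e -> exists2 C : R, 0 <= C & forall y,
    normc (f y - f x0) <= e + C * \sum_(i < d) sin (pi * (y - x0) ord0 i) ^+ 2.
Proof.
move=> cf e0; have [M hM] := torus_continuous_bounded cf.
have M0 : 0 <= M by rewrite (le_trans _ (hM 0))// normc_ge0.
case: cf => pf c1 c2.
have e2 : 0 < e / 2 by rewrite divr_gt0.
have /cvg_ballP/(_ (e / 2) e2) n1 := c1 x0.
have /cvg_ballP/(_ (e / 2) e2) n2 := c2 x0.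
have [r /= r0 hr] : exists2 r : R, 0 < r & forall z, ball x0 r z -> normc (f z - f x0) <= e.
  have /nbhs_ballP[r /= r0 hr] : nbhs x0 [set z | ball ((@complex.Re R \o f) x0) (e / 2) ((@complex.Re R \o f) z) /\
      ball ((@complex.Im R \o f) x0) (e / 2) ((@complex.Im R \o f) z)].
    exact: filterI.
  exists r => // z /hr /= [h1 h2].
  rewrite (le_trans (normc_leReIm _))//.
  move: h1 h2; rewrite /ball /= => h1 h2.
  have e3 (w v : R[i]) : complex.Re (w - v) = complex.Re w - complex.Re v by case: w v => ? ? [].
  have e4 (w v : R[i]) : complex.Im (w - v) = complex.Im w - complex.Im v by case: w v => ? ? [].
  by rewrite e3 e4 ![`|_ (f z) - _|]distrC; lra.
(* Times the lower bound [r^2 / 4] this is [2 M], the largest possible oscillation. *)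
exists (8 * M / r ^+ 2) => [|y].
  by apply: divr_ge0; [exact: mulr_ge0|exact: sqr_ge0].
have [k kE] : exists k : 'rV[int]_d, forall i,
    dist_int ((y - x0) ord0 i) = `|(y - x0) ord0 i - (k ord0 i)%:~R|.
  have nn := fun i => cid (dist_intP ((y - x0) ord0 i)).
  by exists (\row_i projT1 (nn i)) => i; rewrite [X in X%:~R]mxE; exact: (projT2 (nn i)).1.
have s0 : 0 <= \sum_(i < d) sin (pi * (y - x0) ord0 i) ^+ 2.
  by apply: sumr_ge0 => i _; exact: sqr_ge0.
have [hd|] := pselect (forall i, dist_int ((y - x0) ord0 i) < r).
  have -> : f y = f (y + map_mx intr (- k)) by rewrite pf.
  rewrite (le_trans (hr _ _))//; last by rewrite lerDl !mulr_ge0 ?invr_ge0 ?sqr_ge0.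
  split=> // i j; rewrite (ord1 i) /ball /= distrC; have := hd j; rewrite kE.
  rewrite !mxE mulrNz.
  by congr (`|_| < _); ring.
move=> /existsNP[i /negP]; rewrite -leNgt => ri.
apply: (@le_trans _ _ (M + M)).
  by rewrite (le_trans (normcDle _ _))// normcN' lerD.
have si : r ^+ 2 / 4 <= \sum_(i < d) sin (pi * (y - x0) ord0 i) ^+ 2.
  rewrite (bigD1 i)//=; apply: (@le_trans _ _ (sin (pi * (y - x0) ord0 i) ^+ 2)).
    have h : r <= 2 * `|sin (pi * (y - x0) ord0 i)|.
      exact: le_trans ri (sin_pi_dist _).
    rewrite ler_pdivrMr// -[X in _ <= X * _](@real_normK _ (sin _)) ?num_real//.
    have := normr_ge0 (sin (pi * (y - x0) ord0 i)).
    by rewrite !expr2; nra.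
  by rewrite lerDl; apply: sumr_ge0 => j _; exact: sqr_ge0.
have r2 : 0 < r ^+ 2 by rewrite exprn_gt0.
apply: (@le_trans _ _ (8 * M / r ^+ 2 * (r ^+ 2 / 4))).
  rewrite mulrA divfK ?gt_eqF//; lra.
apply: (@le_trans _ _ (8 * M / r ^+ 2 * \sum_(i < d) sin (pi * (y - x0) ord0 i) ^+ 2)).
  by rewrite ler_wpM2l// divr_ge0 ?mulr_ge0// ltW.
by rewrite lerDr ltW.
Qed.

End torus_continuous_theory.

Lemma sqr_normc_sum_expi (R : realType) (I : finType) (A : {set I}) (t : I -> R) :
  (normc (\sum_(J in A) expi (t J)) ^+ 2)%:C =
  \sum_(J in A) \sum_(L in A) expi (t J - t L).
Proof.
have sq (z : R[i]) : (normc z ^+ 2)%:C = z * (z^*)%C.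
  by apply: complexP; rewrite ?cReM ?cImM sqr_normcE; case: z => a b /=; ring.
rewrite sq rmorph_sum mulr_suml; apply: eq_bigr => J _.
rewrite mulr_sumr; apply: eq_bigr => L _; rewrite expiD; congr (_ * _).
by rewrite /expi mulrN cosN sinN.
Qed.

Section fejer.
Variables (R : realType) (d M : nat).
Notation idx := {ffun 'I_d -> 'I_M.+1}.

Definition freq (J : idx) : 'rV[int]_d := \row_i (J i)%:Z.

Definition dirichlet (A : {set idx}) (y : 'rV[R]_d) : R[i] :=
  \sum_(J in A) expi (dotZ (freq J) y).

(** For the full index set this is [(M + 1)^d] times the product Fejer kernel. Unnormalised, it has
    mass [#|A|] over the cube. *)
Definition fejer (A : {set idx}) (y : 'rV[R]_d) : R := normc (dirichlet A y) ^+ 2.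

(** Freezing the [i]-th frequency at zero deletes the [i]-th factor of the product kernel. *)
Definition slice (i : 'I_d) : {set idx} := [set J : idx | J i == ord0].

Lemma freq_inj : injective freq.
Proof.
by move=> J L /rowP h; apply/ffunP => i; apply/val_inj; have := h i; rewrite !mxE => -[].
Qed.

Lemma dirichlet_prod (Q : 'I_d -> pred 'I_M.+1) (y : 'rV[R]_d) :
  dirichlet [set J in family Q] y = \prod_i \sum_(j | Q i j) expi (j%:R * y ord0 i).
Proof.
rewrite bigA_distr_big_dep; apply: eq_big => J; first by rewrite inE.
by move=> _; rewrite -expi_sum; congr expi; apply: eq_bigr => i _; rewrite mxE.
Qed.

Lemma dirichlet_slice (i : 'I_d) (y : 'rV[R]_d) :
  dirichlet [set: idx]%SET y = (\sum_(j < M.+1) expi (j%:R * y ord0 i)) * dirichlet (slice i) y.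
Proof.
have -> : [set: idx]%SET = [set J in family (fun=> predT : pred 'I_M.+1)] :> {set idx}.
  by apply/setP => J; rewrite !inE; apply/esym/familyP.
have -> : slice i = [set J in family (fun k => if k == i then (pred1 ord0 : pred 'I_M.+1) else predT)].
  apply/setP => J; rewrite !inE; apply/idP/familyP => [Ji k|/(_ i)].
    by case: eqP => [->|].
  by rewrite eqxx.
rewrite !dirichlet_prod (bigD1 i)//= [in RHS](bigD1 i)//= eqxx big_pred1_eq mul0r expi0 mul1r.
by congr (_ * _); apply: eq_bigr => k ki; rewrite (negbTE ki).
Qed.

Lemma dirichlet0 (A : {set idx}) : dirichlet A 0 = #|A|%:R.
Proof.
rewrite /dirichlet (eq_bigr (fun=> 1)) ?sumr_const// => J _.
by rewrite /dotZ big1 ?expi0// => i _; rewrite !mxE mulr0.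
Qed.

(** The product formula at the origin, where each kernel counts its terms. *)
Lemma card_slice (i : 'I_d) : #|idx|%:R = M.+1%:R * #|slice i|%:R :> R.
Proof.
have := dirichlet_slice i 0; rewrite !dirichlet0 cardsT.
rewrite (eq_bigr (fun=> 1)) => [|j _]; last by rewrite mxE mulr0 expi0.
rewrite sumr_const card_ord -!natrC -rmorphM /= => h.
exact: (congr1 (@complex.Re R) h).
Qed.

(** In direction [i] the squared geometric sum times [sin^2] is at most [1]. As the slice kernel has
    only the fraction [1 / (M + 1)] of the total mass, this expresses the concentration of the
    kernel at the origin. *)
Lemma fejer_slice (i : 'I_d) (y : 'rV[R]_d) :
  fejer [set: idx]%SET y * sin (pi * y ord0 i) ^+ 2 <= fejer (slice i) y.
Proof.
rewrite /fejer (dirichlet_slice i) normcM exprMn.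
have h := normc_geom_expi (y ord0 i) M.+1.
have h2 : normc (\sum_(j < M.+1) expi (j%:R * y ord0 i)) ^+ 2 * sin (pi * y ord0 i) ^+ 2 <= 1.
  have := sqr_normc_1sub_expi (y ord0 i).
  have : (normc (\sum_(j < M.+1) expi (j%:R * y ord0 i)) * normc (1 - expi (y ord0 i))) ^+ 2 <= 2 ^+ 2.
    by rewrite ler_pXn2r ?nnegrE ?mulr_ge0 ?normc_ge0.
  by rewrite exprMn => h1 h3; move: h1; rewrite h3; lra.
by rewrite mulrAC -[X in _ <= X]mul1r ler_wpM2r// exprn_ge0// normc_ge0.
Qed.

Lemma measurable_fejer (A : {set idx}) (x0 : 'rV[R]_d) :
  cmeasurable (fun y => (fejer A (y - x0))%:C).
Proof.
split; last exact: measurable_cst.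
rewrite [X in measurable_fun _ X](_ : _ = fun y => \sum_(J in A) \sum_(L in A)
   complex.Re (expi (dotZ (freq J - freq L) (y - x0)))); last first.
  apply/funext => y; rewrite /fejer /dirichlet /comp sqr_normc_sum_expi cRe_sum.
  by apply: eq_bigr => J _; rewrite cRe_sum; apply: eq_bigr => L _; rewrite dotZBl.
have mJ J L : measurable_fun [set: 'rV[R]_d] (fun y : 'rV[R]_d => complex.Re (expi (dotZ (freq J - freq L) (y - x0)))).
  have [] := @cmeasurable_expi R d (fun y => dotZ (freq J - freq L) (y - x0)) _ => //.
  by under eq_fun do rewrite dotZDr; apply: measurable_funD => //; exact: measurable_dotZ.
under eq_fun do rewrite -big_enum /=.
apply: measurable_sum => J; under eq_fun do rewrite -big_enum /=.
by apply: measurable_sum => L; exact: mJ.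
Qed.

Lemma fejer_le (A : {set idx}) (y : 'rV[R]_d) : 0 <= fejer A y <= #|A|%:R ^+ 2.
Proof.
rewrite /fejer exprn_ge0 ?normc_ge0//= ler_pXn2r ?nnegrE ?normc_ge0//.
rewrite (le_trans (le_normc_sum _ _ _))// (eq_bigr (fun=> 1)) ?sumr_const// => J _.
by rewrite normc_expi.
Qed.

Lemma cintegrableM_fejer (F : 'rV[R]_d -> R[i]) (A : {set idx}) (x0 : 'rV[R]_d) :
  cintegrable F -> cintegrable (fun y => F y * (fejer A (y - x0))%:C).
Proof.
move=> Fi; apply: (@cintegrableM _ _ _ _ (#|A|%:R ^+ 2)) => //.
  exact: measurable_fejer.
move=> y; have /andP[h1 h2] := fejer_le A (y - x0).
by rewrite normc_real ger0_norm.
Qed.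

Lemma torus_integral_fejer (F : 'rV[R]_d -> R[i]) (A : {set idx}) (x0 : 'rV[R]_d) :
  cintegrable F ->
  torus_integral (fun y => F y * (fejer A (y - x0))%:C) =
  \sum_(J in A) \sum_(L in A)
    expi (- dotZ (freq J - freq L) x0) * fourier_coef F (freq L - freq J).
Proof.
move=> Fi.
have ci J L : cintegrable (fun y => F y * expi (- dotZ (freq L - freq J) y)).
  by under eq_fun do rewrite -dotZNl; exact: cintegrableM_expi.
rewrite -big_enum /=.
under eq_bigr do rewrite -big_enum /=.
rewrite (_ : (fun y => _) = fun y => \sum_(J <- enum A) \sum_(L <- enum A)
   expi (- dotZ (freq J - freq L) x0) * (F y * expi (- dotZ (freq L - freq J) y))).
  rewrite torus_integral_sum => [|J]; last first.
    by apply: cintegrable_sum => L; exact: cintegrableZ.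
  apply: eq_bigr => J _.
  rewrite torus_integral_sum => [|L]; last exact: cintegrableZ.
  by apply: eq_bigr => L _; rewrite torus_integralZ.
apply/funext => y; rewrite /fejer /dirichlet sqr_normc_sum_expi -big_enum /= mulr_sumr.
apply: eq_bigr => J _; rewrite -big_enum /= mulr_sumr.
apply: eq_bigr => L _; rewrite mulrCA; congr (_ * _).
rewrite -expiD; congr expi.
by rewrite !dotZBl !dotZDr -(scaleN1r x0) !dotZZr; ring.
Qed.

Lemma torus_integral_fejer1 (A : {set idx}) (x0 : 'rV[R]_d) :
  \int[lebesgue_rV R d]_(y in @unit_cube R d) fejer A (y - x0) = #|A|%:R.
Proof.
have := torus_integral_fejer A x0 (cintegrable_cst d (1 : R[i])).
under eq_fun do rewrite mul1r.
move=> /(congr1 (@complex.Re R)) /= => ->.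
rewrite cRe_sum (eq_bigr (fun=> 1)) ?sumr_const// => J JA.
rewrite (bigD1 J)//= subrr dotZ0l oppr0 expi0 mul1r fourier_coef0 torus_integral_cst.
rewrite big1 ?addr0//= => L /andP[LA LJ].
by rewrite fourier_coef_cst ?mulr0// subr_eq0 (inj_eq freq_inj).
Qed.

Lemma cube_integrable_fejer (A : {set idx}) (x0 : 'rV[R]_d) :
  cube_integrable (fun y => fejer A (y - x0)).
Proof.
have [+ _] := cintegrableM_fejer A x0 (cintegrable_cst d (1 : R[i])).
by rewrite (_ : _ \o _ = fun y => fejer A (y - x0))//; apply/funext => y; rewrite /comp mul1r.
Qed.

(** For fixed [J] the frequencies [freq L - freq J] are pairwise distinct, so the inner sum runs
    over one of the lists bounded by [B]; there are [#|A|] choices of [J]. *)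
Lemma normc_torus_integral_fejer (F : 'rV[R]_d -> R[i]) (A : {set idx}) (x0 : 'rV[R]_d) (B : R) :
  cintegrable F ->
  (forall s : seq 'rV[int]_d, uniq s -> \sum_(m <- s) normc (fourier_coef F m) <= B) ->
  normc (torus_integral (fun y => F y * (fejer A (y - x0))%:C)) <= #|A|%:R * B.
Proof.
move=> Fi hB; rewrite torus_integral_fejer// (le_trans (le_normc_sum _ _ _))//.
rewrite mulr_natl -sumr_const; apply: ler_sum => J _.
rewrite (le_trans (le_normc_sum _ _ _))//.
rewrite (eq_bigr (fun L => normc (fourier_coef F (freq L - freq J)))) => [|L _]; last first.
  by rewrite normcM normc_expi mul1r.
rewrite -big_enum /= -(big_map (fun L => freq L - freq J) xpredT (fun m => normc (fourier_coef F m))).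
apply: hB; rewrite map_inj_uniq ?enum_uniq// => L1 L2 /addIr.
exact: freq_inj.
Qed.

End fejer.

(* Fejer summation at a point: the kernel means of [F] are bounded by the sum
   of the coefficients and converge to [F x0]. *)
Lemma normc_le_fourier_sum (R : realType) (d : nat) (F : 'rV[R]_d -> R[i]) (x0 : 'rV[R]_d) (B : R) :
  torus_continuous F ->
  (forall s : seq 'rV[int]_d, uniq s -> \sum_(m <- s) normc (fourier_coef F m) <= B) ->
  normc (F x0) <= B.
Proof.
move=> cF hB; have Fi := torus_continuous_integrable cF.
suff H (e : R) : 0 < e -> normc (F x0) <= B + e by apply/ler_addgt0Pr.
move=> e0.
have e2 : 0 < e / 2 by rewrite divr_gt0.
have [C C0 hC] := torus_continuous_modulus x0 cF e2.
(* The order is so large that the off-centre error [C d / (M + 1)] is at most [e / 2]. *)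
pose M := Num.truncn (C * d%:R / (e / 2)).
have hM : C * d%:R / M.+1%:R <= e / 2.
  rewrite ler_pdivrMr ?ltr0n// [e / 2 * _]mulrC -ler_pdivrMr//.
  by apply: ltW; exact: truncnS_gt.
pose T := [set: {ffun 'I_d -> 'I_M.+1}]%SET.
pose n : R := #|T|%:R.
have n0 : 0 < n.
  rewrite ltr0n; apply/card_gt0P; exists [ffun=> ord0]; by rewrite inE.
(* Under the kernel, [F x0] is [F y] plus an increment: the first is bounded by the coefficients in
   [h3], the second by the modulus of continuity in [h2]. *)
have iE : (fun y => F x0 * (fejer T (y - x0))%:C) =
   (fun y => F y * (fejer T (y - x0))%:C + (F x0 - F y) * (fejer T (y - x0))%:C).
  by apply/funext => y; rewrite -mulrDl [F y + _]addrC subrK.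
have di : cintegrable (fun y => F x0 - F y).
  rewrite (_ : (fun y => _) = fun y => F x0 + (-1) * F y).
    by apply: cintegrableD; [exact: cintegrable_cst|exact: cintegrableZ].
  by apply/funext => y; rewrite mulN1r.
have h1 : normc (torus_integral (fun y => F x0 * (fejer T (y - x0))%:C)) = n * normc (F x0).
  rewrite torus_integralZ; last first.
    have := cintegrableM_fejer T x0 (cintegrable_cst d (1 : R[i])).
    by under eq_fun do rewrite mul1r.
  rewrite normcM mulrC; congr (_ * _).
  have -> : torus_integral (fun y => (fejer T (y - x0))%:C) = n%:C.
    apply: complexP => /=; first by rewrite torus_integral_fejer1.
    by rewrite Rintegral_cube_cst.
  by rewrite normc_real gtr0_norm.
have h2 : normc (torus_integral (fun y => (F x0 - F y) * (fejer T (y - x0))%:C)) <=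
    n * (e / 2) + C * d%:R * n / M.+1%:R.
  (* The modulus of continuity times the kernel, with each [sin^2] traded for a slice kernel of mass
     [n / (M + 1)]. *)
  pose k y := e / 2 * fejer T (y - x0) + C * \sum_(i < d) fejer (slice M i) (y - x0).
  have ki : cube_integrable k.
    apply: cube_integrableD; apply: cube_integrableZ.
      exact: cube_integrable_fejer.
    by apply: cube_integrable_sum => i; exact: cube_integrable_fejer.
  rewrite (le_trans (normc_torus_integral_le (cintegrableM_fejer T x0 di) ki _))//.
    move=> y _; rewrite normcM normc_real ger0_norm; last by case/andP: (fejer_le T (y - x0)).
    rewrite -normcN' opprB.
    apply: (le_trans (ler_wpM2r _ (hC y))); first by case/andP: (fejer_le T (y - x0)).
    rewrite mulrDl lerD2l -mulrA ler_wpM2l// mulr_suml; apply: ler_sum => i _.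
    by rewrite mulrC fejer_slice.
  have mc := @measurable_cube R d.
  rewrite /k RintegralD//; last 2 first.
  - by apply: cube_integrableZ; exact: cube_integrable_fejer.
  - by apply: cube_integrableZ; apply: cube_integrable_sum => i; exact: cube_integrable_fejer.
  rewrite !RintegralZl//; last 2 first.
  - by apply: cube_integrable_sum => i; exact: cube_integrable_fejer.
  - exact: cube_integrable_fejer.
  rewrite torus_integral_fejer1 [e / 2 * _]mulrC lerD2l.
  have sI (s : seq 'I_d) : \int[lebesgue_rV R d]_(y in @unit_cube R d) (\sum_(i <- s) fejer (slice M i) (y - x0)) =
     \sum_(i <- s) #|slice M i|%:R.
    elim: s => [|i s IH].
      under eq_Rintegral do rewrite big_nil.
      by rewrite big_nil Rintegral_cube_cst.
    under eq_Rintegral do rewrite big_cons.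
    rewrite RintegralD// ?IH ?big_cons ?torus_integral_fejer1//.
      exact: cube_integrable_fejer.
    by apply: cube_integrable_sum => j; exact: cube_integrable_fejer.
  rewrite sI (eq_bigr (fun=> n / M.+1%:R)) => [|i _].
    rewrite sumr_const card_ord le_eqVlt; apply/orP; left; apply/eqP.
    by rewrite -mulr_natr; ring.
  by rewrite /n cardsT (card_slice R M i) mulrAC mulfV ?mul1r// pnatr_eq0.
have h3 := normc_torus_integral_fejer T x0 Fi hB.
have : n * normc (F x0) <= n * B + (n * (e / 2) + C * d%:R * n / M.+1%:R).
  rewrite -h1 iE torus_integralD; [|exact: cintegrableM_fejer|exact: cintegrableM_fejer].
  by rewrite (le_trans (normcDle _ _))// lerD.
have -> : C * d%:R * n / M.+1%:R = n * (C * d%:R / M.+1%:R).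
  by rewrite mulrAC [RHS]mulrC.
rewrite -!mulrDr ler_pM2l// => h.
by rewrite (le_trans h)// lerD2l [leRHS]splitr lerD2l.
Qed.

Lemma continuous_average (R : realType) (d n : nat) (g : 'rV[R]_d -> R)
    (v : 'I_n -> 'rV[R]_d) (a b : R) : continuous g ->
  continuous (fun x : 'rV[R]_d => a * \sum_(j < n) g (x + v j) - b : R).
Proof.
move=> cg x.
have gv j : (fun y : 'rV[R]_d => g (y + v j)) @ x --> g (x + v j).
  apply: (@continuous_comp _ _ _ (fun y : 'rV[R]_d => y + v j) g x); last exact: cg.
  exact: (@cvgD R 'rV[R]_d _ (nbhs x) _ id (fun=> v j) x (v j) (@cvg_id _ _)
    (@cvg_cst 'rV[R]_d _ _ (nbhs x) _)).
have cs (s : seq 'I_n) : (fun x : 'rV[R]_d => \sum_(j <- s) g (x + v j) : R) @ x -->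
    (\sum_(j <- s) g (x + v j) : R).
  elim: s => [|j s IH].
    have -> : (fun x : 'rV[R]_d => \sum_(j <- [::]) g (x + v j) : R) = (fun=> 0).
      by apply/funext => y; rewrite big_nil.
    by rewrite big_nil; exact: (@cvg_cst R _ _ (nbhs x)).
  have -> : (fun x : 'rV[R]_d => \sum_(i <- j :: s) g (x + v i) : R) =
      (fun y => g (y + v j) + \sum_(i <- s) g (y + v i)).
    by apply/funext => y; rewrite big_cons.
  by rewrite big_cons; exact: (@cvgD R R _ (nbhs x) _ _ _ _ _ (gv j) IH).
have cm : (fun x : 'rV[R]_d => a * \sum_(j < n) g (x + v j) : R) @ x -->
    (a * \sum_(j < n) g (x + v j) : R).
  exact: (@cvgM R _ (nbhs x) _ _ _ _ _ (@cvg_cst R a _ (nbhs x) _) (cs (index_enum _))).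
exact: (@cvgB R R _ (nbhs x) _ _ _ _ _ cm (@cvg_cst R b _ (nbhs x) _)).
Qed.

Lemma torus_continuous_discrepancy (R : realType) (d : nat) (f : 'rV[R]_d -> R[i])
    (alpha : 'rV[R]_d) (N : nat) : (0 < N)%N -> torus_continuous f ->
  torus_continuous (discrepancy (@Phi R) alpha f N).
Proof.
move=> N0 [pf c1 c2]; split; first exact: periodic_discrepancy.
  rewrite (_ : _ \o _ = fun x => (N.*2.+1)%:R^-1 *
      \sum_(j < (N.*2).+1) (@complex.Re R \o f) (x + (j%:R - N%:R) *: alpha)
      - complex.Re (torus_integral f)).
    exact: continuous_average.
  apply/funext => x; rewrite /comp discrepancyE// cReD cReM cRe_sum /= mul0r subr0.
  by case: (torus_integral f).
rewrite (_ : _ \o _ = fun x => (N.*2.+1)%:R^-1 *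
    \sum_(j < (N.*2).+1) (@complex.Im R \o f) (x + (j%:R - N%:R) *: alpha)
    - complex.Im (torus_integral f)).
  exact: continuous_average.
apply/funext => x; rewrite /comp discrepancyE// cImD cImM cIm_sum /= mul0r addr0.
by case: (torus_integral f).
Qed.

(** Common entry to both upper bounds. The zero frequency can be left out of the lists because the
    discrepancy has mean zero. *)
Lemma sup_norm_discrepancy_le (R : realType) (d : nat) (f : 'rV[R]_d -> R[i])
    (alpha : 'rV[R]_d) (N : nat) (B : R) : (0 < N)%N -> torus_continuous f ->
  (forall s : seq 'rV[int]_d, uniq s -> 0 \notin s ->
    \sum_(m <- s) normc (exp_sum (@Phi R) N (dotZ m alpha)) * normc (fourier_coef f m) <= B) ->
  (sup_norm (discrepancy (@Phi R) alpha f N) <= B%:E)%E.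
Proof.
move=> N0 cf hB; apply: ge_ereal_sup => _ [x _ <-]; rewrite lee_fin.
have fi := torus_continuous_integrable cf; have [pf _ _] := cf.
apply: normc_le_fourier_sum; first exact: torus_continuous_discrepancy.
move=> s us; rewrite (bigID (fun m => m == 0)).
rewrite big1 => [|m /andP[_ /eqP ->]]; last by rewrite fourier_coef_discrepancy0// normc0.
rewrite Monoid.mul1m.
rewrite -big_filter; apply: le_trans (hB [seq m <- s | m != 0] _ _); last 2 first.
- exact: filter_uniq.
- by rewrite mem_filter eqxx.
rewrite !big_filter; apply: ler_sum => m m0.
by rewrite fourier_coef_discrepancy// normcM.
Qed.

(** * Sobolev coefficients *)

Lemma is_derive_line (R : realType) (V : normedModType R) (f : V -> R) (x v : V) (df : R) :
  is_derive (0 : R) (1 : R) (fun t : R => f (t *: v + x)) df -> is_derive x v f df.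
Proof.
have E : (fun h : R => h^-1 *: (((fun t : R => f (t *: v + x)) \o shift 0) (h *: (1 : R)) - f (0 *: v + x)))
       = (fun h => h^-1 *: ((f \o shift x) (h *: v) - f x)).
  by apply/funext => h; rewrite /= addr0 scale0r add0r /GRing.scale /= mulr1.
move=> [dv vl]; split.
  by move: dv; rewrite /derivable E.
by move: vl; rewrite /derive E.
Qed.

Section characters.
Variables (R : realType) (d : nat).

(** This family is closed under partial derivatives, so smoothness of the characters to every order
    is a single induction. *)
Definition trig (m : 'rV[int]_d) (a b : R) (x : 'rV[R]_d) : R :=
  a * cos (2 * pi * dotZ m x) + b * sin (2 * pi * dotZ m x).

Lemma is_derive_trig m a b (i : 'I_d) x :
  is_derive x (delta_mx ord0 i) (trig m a b)
    (trig m (2 * pi * (m ord0 i)%:~R * b) (- (2 * pi * (m ord0 i)%:~R * a)) x).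
Proof.
apply: is_derive_line; rewrite /trig.
have e (t : R) : dotZ m (t *: delta_mx ord0 i + x) = (m ord0 i)%:~R * t + dotZ m x.
  rewrite dotZDr dotZZr mulrC; congr (_ * _ + _).
  rewrite /dotZ (bigD1 i)//= mxE !eqxx mulr1 big1 ?addr0// => j ji.
  by rewrite mxE eqxx (negbTE ji) mulr0.
under eq_fun do rewrite e.
set k : R := (m ord0 i)%:~R; set c := dotZ m x.
apply: is_derive_eq; rewrite !mulr0 !add0r /GRing.scale /=.
by rewrite ?addr0 ?mulr1 ?mul0r ?mulr0 ?addr0 ?add0r; ring.
Qed.

Lemma continuous_dotZ (m : 'rV[int]_d) : continuous (fun x : 'rV[R]_d => dotZ m x).
Proof.
move=> x; rewrite /continuous_at /dotZ; elim: (index_enum _) => [|j s IH].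
  have -> : (fun y : 'rV[R]_d => \sum_(i <- [::]) (m ord0 i)%:~R * y ord0 i : R) = (fun=> 0).
    by apply/funext => y; rewrite big_nil.
  by rewrite big_nil; exact: (@cvg_cst R _ _ (nbhs x)).
have -> : (fun y : 'rV[R]_d => \sum_(i <- j :: s) (m ord0 i)%:~R * y ord0 i : R) =
    (fun y => (m ord0 j)%:~R * y ord0 j + \sum_(i <- s) (m ord0 i)%:~R * y ord0 i).
  by apply/funext => y; rewrite big_cons.
have cj : (fun y : 'rV[R]_d => (m ord0 j)%:~R * y ord0 j : R) @ x --> ((m ord0 j)%:~R * x ord0 j : R).
  exact: (@cvgM R _ (nbhs x) _ _ _ _ _ (@cvg_cst R _ _ (nbhs x) _) (@coord_continuous R 1 d ord0 j x)).
by rewrite big_cons; exact: (@cvgD R R _ (nbhs x) _ _ _ _ _ cj IH).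
Qed.

Lemma continuous_trig m a b : continuous (trig m a b).
Proof.
move=> x.
have cw : (fun y : 'rV[R]_d => 2 * pi * dotZ m y) @ x --> (2 * pi * dotZ m x).
  exact: (@cvgM R _ (nbhs x) _ _ _ _ _ (@cvg_cst R _ _ (nbhs x) _) (@continuous_dotZ m x)).
have h1 : (fun y : 'rV[R]_d => cos (2 * pi * dotZ m y)) @ x --> cos (2 * pi * dotZ m x).
  exact: (@continuous_comp _ _ _ (fun y : 'rV[R]_d => 2 * pi * dotZ m y) cos x cw (@continuous_cos R _)).
have h2 : (fun y : 'rV[R]_d => sin (2 * pi * dotZ m y)) @ x --> sin (2 * pi * dotZ m x).
  exact: (@continuous_comp _ _ _ (fun y : 'rV[R]_d => 2 * pi * dotZ m y) sin x cw (@continuous_sin R _)).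
have h3 := @cvgM R _ (nbhs x) _ _ _ _ _ (@cvg_cst R a _ (nbhs x) _) h1.
have h4 := @cvgM R _ (nbhs x) _ _ _ _ _ (@cvg_cst R b _ (nbhs x) _) h2.
exact: (@cvgD R R _ (nbhs x) _ _ _ _ _ (h3 _ _) (h4 _ _)).
Qed.

Lemma iter_partial_trig m a b (s : seq 'I_d) :
  exists a' b', iter_partial s (trig m a b) = trig m a' b'.
Proof.
elim: s => [|i s [a' [b' IH]]]; first by exists a, b.
rewrite /= /partial_derivative IH.
exists (2 * pi * (m ord0 i)%:~R * b'), (- (2 * pi * (m ord0 i)%:~R * a')).
by apply/funext => x; case: (is_derive_trig m a' b' i x).
Qed.

Lemma smooth_trig m a b : smooth (trig m a b).
Proof.
move=> s; have [a' [b' ->]] := iter_partial_trig m a b s.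
split; first exact: continuous_trig.
by move=> i x; case: (is_derive_trig m a' b' i x).
Qed.

Lemma test_function_expi (m : 'rV[int]_d) :
  test_function (fun x : 'rV[R]_d => expi (- dotZ m x)).
Proof.
split.
- by move=> k x; rewrite -!dotZNl periodic_expi.
- rewrite (_ : _ \o _ = trig (- m) 1 0); first exact: smooth_trig.
  by apply/funext => x; rewrite /trig mul1r mul0r addr0 dotZNl.
- rewrite (_ : _ \o _ = trig (- m) 0 1); first exact: smooth_trig.
  by apply/funext => x; rewrite /trig mul1r mul0r add0r dotZNl.
Qed.

Lemma distribution_coefE u (f : 'rV[R]_d -> R[i]) (m : 'rV[int]_d) :
  continuous_representative u f -> distribution_coef u m = fourier_coef f m.
Proof. by move=> [_ h]; rewrite /distribution_coef h//; exact: test_function_expi. Qed.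

Lemma sobolev_coef (delta : R) u (f : 'rV[R]_d -> R[i]) :
  sobolev_space delta u -> continuous_representative u f ->
  exists S : R, [/\ 0 <= S, sobolev_norm delta u = S%:E &
    forall s : seq 'rV[int]_d, uniq s ->
      \sum_(m <- s) (1 + normZ R m ^+ 2) `^ delta * normc (fourier_coef f m) ^+ 2 <= S ^+ 2].
Proof.
move=> [_]; rewrite /sobolev_norm; set E := (\esum_(_ in _) _)%E => Eoo rf.
have E0 : (0 <= E)%E.
  by apply: esum_ge0 => m _; rewrite lee_fin mulr_ge0// ?powR_ge0// exprn_ge0// normc_ge0.
have [r Er] : exists r : R, E = r%:E.
  case: E E0 Eoo => [r _ _|_|//]; first by exists r.
  by rewrite poweRyr ?ltxx// invr_neq0// pnatr_eq0.
have r0 : 0 <= r by rewrite -lee_fin -Er.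
exists (r `^ 2^-1); split; first exact: powR_ge0.
  by rewrite Er poweR_EFin.
move=> s us; rewrite powR12_sqrt// sqr_sqrtr// -lee_fin -Er.
apply: esum_ge; exists [set` s]; first by split=> //; exact: finite_seq.
rewrite -fsbig_seq// -sumEFin; apply: lee_sum => m _.
by rewrite (distribution_coefE m rf).
Qed.

End characters.

Lemma sqr_sum_mul_le (R : realType) (I : Type) (s : seq I) (a b : I -> R) :
  (\sum_(i <- s) a i * b i) ^+ 2 <= (\sum_(i <- s) a i ^+ 2) * (\sum_(i <- s) b i ^+ 2).
Proof.
elim: s => [|i s IH]; first by rewrite !big_nil expr0n mul0r.
rewrite !big_cons; set P := \sum_(j <- s) a j * b j in IH *.
set X := \sum_(j <- s) a j ^+ 2 in IH *; set Y := \sum_(j <- s) b j ^+ 2 in IH *.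
have X0 : 0 <= X by apply: sumr_ge0 => j _; exact: sqr_ge0.
have Y0 : 0 <= Y by apply: sumr_ge0 => j _; exact: sqr_ge0.
(* AM-GM together with [P^2 <= X Y]: the square of the right side is at least
   [4 X Y (a_i b_i)^2]. *)
have h : 2 * (P * (a i * b i)) <= X * b i ^+ 2 + Y * a i ^+ 2.
  have q0 : 0 <= X * b i ^+ 2 + Y * a i ^+ 2.
    exact: addr_ge0 (mulr_ge0 X0 (sqr_ge0 _)) (mulr_ge0 Y0 (sqr_ge0 _)).
  rewrite (le_trans (ler_norm _))// -(@ler_pXn2r _ 2) ?nnegrE//.
  rewrite real_normK ?num_real//.
  have h1 : P ^+ 2 * (a i * b i) ^+ 2 <= X * Y * (a i * b i) ^+ 2.
    by rewrite ler_wpM2r ?sqr_ge0.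
  have h2 := sqr_ge0 (X * b i ^+ 2 - Y * a i ^+ 2).
  by rewrite !expr2 in h1 h2 *; nra.
by rewrite !expr2 in IH h *; nra.
Qed.

Lemma sum_mul_le (R : realType) (I : Type) (s : seq I) (a b : I -> R) (A B : R) :
  0 <= A -> 0 <= B -> \sum_(i <- s) a i ^+ 2 <= A ^+ 2 ->
  \sum_(i <- s) b i ^+ 2 <= B ^+ 2 -> \sum_(i <- s) a i * b i <= A * B.
Proof.
move=> A0 B0 hA hB; have := sqr_sum_mul_le s a b; set P := \sum_(i <- s) a i * b i => h.
have [P0|P0] := leP P 0; first by rewrite (le_trans P0)// mulr_ge0.
rewrite -(@ler_pXn2r _ 2) ?nnegrE; [|by []|exact: ltW|exact: mulr_ge0].
rewrite (le_trans h)// exprMn.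
by apply: ler_pM => //; apply: sumr_ge0 => i _; exact: sqr_ge0.
Qed.

(* Cauchy-Schwarz against the Sobolev weights. *)
Lemma sup_norm_le_weighted (R : realType) (d : nat) (delta S T : R) u
    (f : 'rV[R]_d -> R[i]) (alpha : 'rV[R]_d) (N : nat) : (0 < N)%N ->
  sobolev_space delta u -> continuous_representative u f -> 0 <= T ->
  (forall s : seq 'rV[int]_d, uniq s -> 0 \notin s ->
    \sum_(m <- s) (1 + normZ R m ^+ 2) `^ (- delta) *
      normc (exp_sum (@Phi R) N (dotZ m alpha)) ^+ 2 <= T ^+ 2) ->
  (sup_norm (discrepancy (@Phi R) alpha f N) <= T%:E * sobolev_norm delta u)%E.
Proof.
move=> N0 su rf T0 hT; have [S' [S0 -> hS]] := sobolev_coef su rf.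
rewrite -EFinM; apply: sup_norm_discrepancy_le => //; first by case: rf.
move=> s us s0.
pose w (m : 'rV[int]_d) : R := (1 + normZ R m ^+ 2) `^ (delta / 2).
have w0 (m : 'rV[int]_d) : 0 < w m.
  by rewrite powR_gt0// ltr_pwDl// sqr_ge0.
have wp (m : 'rV[int]_d) : w m ^+ 2 = (1 + normZ R m ^+ 2) `^ delta.
  by rewrite -powR_mulrn ?powR_ge0// -powRrM divfK ?pnatr_eq0.
rewrite (eq_bigr (fun m => ((w m)^-1 * normc (exp_sum (@Phi R) N (dotZ m alpha))) * (w m * normc (fourier_coef f m)))).
  apply: sum_mul_le => //.
    rewrite (le_trans _ (hT s us s0))//; apply: ler_sum => m _.
    by rewrite exprMn exprVn wp powRN.
  rewrite (le_trans _ (hS s us))//; apply: ler_sum => m _.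
  by rewrite exprMn wp.
by move=> m _; rewrite mulrACA mulVf ?mul1r// gt_eqF.
Qed.

(** * Dyadic sums *)

Lemma geometric_sum_lt1 (R : realType) (q : R) (K : nat) : 0 <= q -> q < 1 ->
  \sum_(k < K) q ^+ k <= (1 - q)^-1.
Proof.
move=> q0 q1; have h := subrX1 q K.
rewrite -[leRHS]mul1r ler_pdivlMr ?subr_gt0//.
have : 0 <= q ^+ K by rewrite exprn_ge0.
by move: h; set S := \sum_(k < K) q ^+ k => h; lra.
Qed.

Lemma geometric_sum_gt1 (R : realType) (q : R) (K : nat) : 1 < q ->
  \sum_(k < K) q ^+ k <= q ^+ K / (q - 1).
Proof.
move=> q1; have h := subrX1 q K.
rewrite ler_pdivlMr ?subr_gt0//.
by move: h; set S := \sum_(k < K) q ^+ k => h; lra.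
Qed.

(** Multiplication by [1 - q] telescopes the weights [k + 1] to [1], leaving a geometric sum minus a
    nonnegative term. *)
Lemma arith_geometric_sum (R : realType) (q : R) (K : nat) : 0 <= q -> q < 1 ->
  \sum_(k < K) k.+1%:R * q ^+ k <= (1 - q)^-1 * (1 - q)^-1.
Proof.
move=> q0 q1; rewrite ler_pdivlMr ?subr_gt0//.
have -> : (\sum_(k < K) k.+1%:R * q ^+ k) * (1 - q) = \sum_(k < K) q ^+ k - K%:R * q ^+ K.
  elim: K => [|K IH]; first by rewrite !big_ord0; ring.
  by rewrite !big_ord_recr /= mulrDl IH exprS -!natr1; ring.
rewrite (le_trans _ (geometric_sum_lt1 K q0 q1))//.
by rewrite gerBl mulr_ge0// exprn_ge0.
Qed.

Lemma powR2_expn (R : realType) (x : R) (k : nat) : (2 `^ x) ^+ k = 2 `^ (x * k%:R) :> R.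
Proof. by rewrite -powR_mulrn ?powR_ge0// -powRrM. Qed.

Lemma powR2_lt1 (R : realType) (x : R) : x < 0 -> 2 `^ x < 1 :> R.
Proof.
move=> x0; rewrite /powR pnatr_eq0 /= -[X in _ < X]expR0 ltr_expR nmulr_rlt0//.
by rewrite ln_gt0// ltr1n.
Qed.

Lemma powR2_gt1 (R : realType) (x : R) : 0 < x -> 1 < 2 `^ x :> R.
Proof.
move=> x0; rewrite /powR pnatr_eq0 /= -[X in X < _]expR0 ltr_expR mulr_gt0//.
by rewrite ln_gt0// ltr1n.
Qed.

(** The second bound serves below [k0], the first from [k0] on. Enlarging the range to [k0 + K]
    terms first avoids comparing [k0] with [K]. *)
Lemma sum_min_split (R : realType) (u v : nat -> R) (K k0 : nat) :
  (forall k, 0 <= u k) -> (forall k, 0 <= v k) ->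
  \sum_(k < K) Num.min (u k) (v k) <= \sum_(k < k0) v k + \sum_(k < K) u (k0 + k)%N.
Proof.
move=> u0 v0; have m0 k : 0 <= Num.min (u k) (v k) by rewrite le_min u0 v0.
apply: (@le_trans _ _ (\sum_(k < k0 + K) Num.min (u k) (v k))).
  rewrite addnC big_split_ord /= lerDl; apply: sumr_ge0 => k _; exact: m0.
rewrite big_split_ord /= lerD//; apply: ler_sum => k _.
  by rewrite ge_min lexx orbT.
by rewrite ge_min lexx.
Qed.

(* The crossover of the two shell bounds is at [2 ^ k = N ^ gamma] with
   [gamma = theta / (tau - D / 2)]. *)
Definition dyadic_rate (R : realType) (D delta tau theta : R) (g N : nat) : R :=
  if delta < tau then
    N%:R `^ (theta / (tau - D / 2) * (tau - delta)) * ln (1 + N%:R) `^ (g%:R / 2)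
  else if delta == tau then ln (1 + N%:R) `^ ((g.+1)%:R / 2) else 1.

(** The first bound decays with [k] because [D / 2 < delta]. Up to the factor [(k + 1)^g], the
    second decays, is constant or grows according to the sign of [delta - tau], whence the three
    cases of the rate. The constant is uniform in [N] and in the number [K] of shells. *)
Lemma dyadic_sum_le (R : realType) (D delta tau theta C0 C1 : R) (g : nat) :
  (g <= 1)%N -> 0 < theta -> D / 2 < delta -> D / 2 <= tau -> 0 <= C0 -> 0 <= C1 ->
  exists2 c : R, 0 < c & forall N K : nat, (0 < N)%N ->
  \sum_(k < K) Num.min (C0 * (2 `^ (D - 2 * delta)) ^+ k)
     (C1 * N%:R `^ (- (2 * theta)) * (k.+1%:R ^+ g * (2 `^ (2 * tau - 2 * delta)) ^+ k))
  <= (c * N%:R `^ (- theta) * dyadic_rate D delta tau theta g N) ^+ 2.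
Proof.
move=> g1 t0 Dd Dt C00 C10; pose L (N : nat) : R := ln (1 + N%:R).
set a := 2 `^ (D - 2 * delta); set b := 2 `^ (2 * tau - 2 * delta).
have a0 : 0 <= a := powR_ge0 _ _.
have b0 : 0 <= b := powR_ge0 _ _.
have da : D - 2 * delta < 0 by lra.
have a1 : a < 1 by exact: powR2_lt1.
have sqN (N : nat) : (N%:R `^ (- theta)) ^+ 2 = N%:R `^ (- (2 * theta)) :> R.
  by rewrite -powR_mulrn ?powR_ge0// -powRrM; congr (_ `^ _); ring.
have ln2 : 0 < ln 2 :> R by rewrite ln_gt0// ltr1n.
have L2 (N : nat) : (0 < N)%N -> ln 2 <= L N.
  by move=> N0; rewrite /L ler_ln ?posrE ?addr_gt0 ?ltr0n// -[2]/(1 + 1) lerD2l ler1n.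
have lnN (N : nat) : (0 < N)%N -> ln N%:R <= L N.
  move=> N0; have Np : 0 < N%:R :> R by rewrite ltr0n.
  by rewrite /L ler_ln ?posrE ?addr_gt0// lerDr.
have sqrt_c (c : R) : 0 <= c -> exists2 c' : R, 0 < c' & c <= c' ^+ 2.
  move=> c0; exists (c + 1); first lra.
  by rewrite expr2; nra.
have pos_u k : 0 <= C0 * a ^+ k by rewrite mulr_ge0// exprn_ge0.
have pos_v (N : nat) k : 0 <= C1 * N%:R `^ (- (2 * theta)) * (k.+1%:R ^+ g * b ^+ k).
  by rewrite !mulr_ge0 ?powR_ge0 ?exprn_ge0.
(* For [tau < delta] the second bound alone is summable over all shells. *)
have [dt|dt] := ltP tau delta.
  have b1 : b < 1 by apply: powR2_lt1; lra.
  have [|c c0 hc] := sqrt_c (C1 * ((1 - b)^-1 * (1 - b)^-1)).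
    by apply: mulr_ge0 C10 (mulr_ge0 _ _); rewrite invr_ge0 subr_ge0 ltW.
  exists c => // N K N0; rewrite /dyadic_rate -?/(L N) ltNge (ltW dt) /= gt_eqF// mulr1 exprMn sqN.
  apply: (@le_trans _ _ (\sum_(k < K) C1 * N%:R `^ (- (2 * theta)) * (k.+1%:R * b ^+ k))).
    apply: ler_sum => k _; rewrite ge_min; apply/orP; right.
    rewrite ler_wpM2l ?mulr_ge0 ?powR_ge0// ler_wpM2r ?exprn_ge0//.
    by case: (g) (g1) => [|[|]]//= _; rewrite ?expr0 ?expr1// ler1n.
  rewrite -mulr_sumr mulrAC ler_wpM2r ?powR_ge0// (le_trans _ hc)// ler_wpM2l//.
  exact: arith_geometric_sum.
have be0 : 0 < tau - D / 2 by lra.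
pose ga := theta / (tau - D / 2).
have ga0 : 0 < ga by rewrite divr_gt0.
have gaE : ga * (tau - D / 2) = theta by rewrite divfK// gt_eqF.
(* [x N] solves [2 ^ x = N ^ ga]. For [N >= 1], [k0 N] lies in [(x N, x N + 1]], so [2 ^ k0] is
   within a factor [2] of the crossover. *)
pose x (N : nat) : R := ga * ln N%:R / ln 2.
have x0 (N : nat) : (0 < N)%N -> 0 <= x N.
  move=> N0; apply: divr_ge0 (ltW ln2); apply: mulr_ge0 (ltW ga0) _.
  by rewrite ln_ge0// ler1n.
pose k0 (N : nat) := (Num.truncn (x N)).+1.
have k0x (N : nat) : x N <= (k0 N)%:R by rewrite ltW// truncnS_gt.
have k0x1 (N : nat) : (0 < N)%N -> (k0 N)%:R <= x N + 1.
  by move=> N0; rewrite /k0 -natr1 lerD2r truncn_le x0.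
have powx (N : nat) (y : R) : (0 < N)%N -> 2 `^ (y * x N) = N%:R `^ (ga * y) :> R.
  move=> N0; rewrite /powR pnatr_eq0 /= pnatr_eq0 gtn_eqF//; congr expR.
  by rewrite /x; field; rewrite gt_eqF.
pose cL := (ga + 1) / ln 2.
have cL0 : 0 <= cL := divr_ge0 (ltW (addr_gt0 ga0 ltr01)) (ltW ln2).
have ia : 0 <= (1 - a)^-1 by rewrite invr_ge0 subr_ge0 ltW.
have il : 0 <= (ln 2)^-1 :> R by rewrite invr_ge0 ltW.
have CA : 0 <= C0 * (1 - a)^-1 := mulr_ge0 C00 ia.
have k0L (N : nat) : (0 < N)%N -> (k0 N)%:R <= cL * L N.
  move=> N0; apply: le_trans (k0x1 N N0) _.
  rewrite /cL mulrAC ler_pdivlMr// mulrDl mul1r /x divfK ?gt_eqF// mulrDl mul1r.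
  exact: lerD (ler_wpM2l (ltW ga0) (lnN N N0)) (L2 N N0).
(* Since [L N >= ln 2], powers of [L N / ln 2] can be inserted as factors at least [1]; the tail
   carries no logarithm and is fitted in this way under a rate that may have one. *)
have Lge1 (N n : nat) : (0 < N)%N -> 1 <= (L N / ln 2) ^+ n.
  by move=> N0; rewrite exprn_ege1// ler_pdivlMr// mul1r L2.
have tail (N K : nat) : (0 < N)%N ->
    \sum_(k < K) C0 * a ^+ (k0 N + k) <= C0 * (1 - a)^-1 * N%:R `^ (ga * (D - 2 * delta)).
  move=> N0; under eq_bigr do rewrite exprD mulrA.
  rewrite -mulr_sumr -mulrA [leRHS]mulrAC -[leRHS]mulrA.
  rewrite -powx// ler_wpM2l//; apply: ler_pM.
  - exact: exprn_ge0.
  - by apply: sumr_ge0 => k _; exact: exprn_ge0.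
  - by rewrite powR2_expn ler_powR ?ler1n// ler_wnM2l//; lra.
  - exact: geometric_sum_lt1.
have head (N : nat) : (0 < N)%N ->
    \sum_(k < k0 N) C1 * N%:R `^ (- (2 * theta)) * (k.+1%:R ^+ g * b ^+ k) <=
    C1 * N%:R `^ (- (2 * theta)) * ((cL * L N) ^+ g * \sum_(k < k0 N) b ^+ k).
  move=> N0; rewrite -mulr_sumr ler_wpM2l ?mulr_ge0 ?powR_ge0// mulr_sumr.
  apply: ler_sum => k _; rewrite ler_wpM2r ?exprn_ge0// lerXn2r ?nnegrE//.
    by rewrite mulr_ge0// (le_trans (ltW ln2))// L2.
  by rewrite (le_trans _ (k0L N N0))// ler_nat.
have L0 (N : nat) : (0 < N)%N -> 0 <= L N by move=> N0; rewrite (le_trans (ltW ln2))// L2.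
have sqL (N n : nat) : (0 < N)%N -> (L N `^ (n%:R / 2)) ^+ 2 = L N ^+ n.
  move=> N0; rewrite -powR_mulrn ?powR_ge0// -powRrM divfK ?pnatr_eq0//.
  by rewrite powR_mulrn ?L0.
(* For [delta = tau] the head is geometric of ratio [1]; its [k0 = O(log N)] terms produce one more
   logarithm. *)
have [td|dt'] := eqVneq delta tau.
  have b1 : b = 1 by rewrite /b td subrr powRr0.
  pose c0 := C1 * cL ^+ g.+1 + C0 * (1 - a)^-1 * (ln 2)^-1 ^+ g.+1.
  have [|c cp hc] := sqrt_c c0.
    exact: addr_ge0 (mulr_ge0 C10 (exprn_ge0 _ cL0)) (mulr_ge0 CA (exprn_ge0 _ il)).
  exists c => // N K N0; rewrite /dyadic_rate -?/(L N) td ltxx eqxx !exprMn sqN sqL//.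
  apply: le_trans (sum_min_split _ (k0 N) pos_u (pos_v N)) _.
  apply: (@le_trans _ _ (c0 * N%:R `^ (- (2 * theta)) * L N ^+ g.+1)); last first.
    by rewrite !ler_wpM2r ?powR_ge0 ?exprn_ge0 ?L0.
  have eN : ga * (D - 2 * delta) = - (2 * theta) by rewrite -gaE td; field.
  have h1 := tail N K N0; rewrite eN in h1.
  have h2 := head N N0.
  have h3 : \sum_(k < k0 N) b ^+ k <= cL * L N.
    by rewrite b1; under eq_bigr do rewrite expr1n; rewrite sumr_const card_ord k0L.
  set NP := N%:R `^ (- (2 * theta)) in h1 h2 *.
  have NP0 : 0 <= NP := powR_ge0 _ _.
  rewrite /c0 !mulrDl; apply: lerD.
    apply: le_trans h2 _; rewrite [leRHS](_ : _ = C1 * NP * ((cL * L N) ^+ g * (cL * L N))).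
      apply: ler_wpM2l (mulr_ge0 C10 NP0) _ _ _.
      exact: ler_wpM2l (exprn_ge0 _ (mulr_ge0 cL0 (L0 N N0))) _ _ h3.
    rewrite -[in RHS]exprSr [(cL * L N) ^+ _]exprMn.
    by move: (cL ^+ g.+1) (L N ^+ g.+1) => r1 r2; ring.
  apply: le_trans h1 _.
  rewrite [leRHS](_ : _ = C0 * (1 - a)^-1 * NP * (L N / ln 2) ^+ g.+1).
    by rewrite ler_peMr ?Lge1//; apply: mulr_ge0 CA _; rewrite ?mulr_ge0.
  rewrite [(L N / ln 2) ^+ _]exprMn.
  by move: (L N ^+ g.+1) ((ln 2)^-1 ^+ g.+1) => r1 r2; ring.
have dt2 : delta < tau by rewrite lt_neqAle dt' dt.
(* For [delta < tau] the head is controlled by [b ^ k0], which is at most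
   [b * N ^ (ga (2 tau - 2 delta))]. *)
have b1 : 1 < b by apply: powR2_gt1; lra.
have ib : 0 <= b / (b - 1) by apply: divr_ge0 => //; rewrite subr_ge0 ltW.
pose c0 := C1 * cL ^+ g * (b / (b - 1)) + C0 * (1 - a)^-1 * (ln 2)^-1 ^+ g.
have [|c cp hc] := sqrt_c c0.
  exact: addr_ge0 (mulr_ge0 (mulr_ge0 C10 (exprn_ge0 _ cL0)) ib) (mulr_ge0 CA (exprn_ge0 _ il)).
exists c => // N K N0; rewrite /dyadic_rate -?/(L N) dt2 !exprMn sqN sqL// -/ga.
have sqG : (N%:R `^ (ga * (tau - delta))) ^+ 2 = N%:R `^ (ga * (2 * tau - 2 * delta)) :> R.
  by rewrite -powR_mulrn ?powR_ge0// -powRrM; congr (_ `^ _); ring.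
rewrite sqG; apply: le_trans (sum_min_split _ (k0 N) pos_u (pos_v N)) _.
set G := N%:R `^ (ga * (2 * tau - 2 * delta)).
apply: (@le_trans _ _ (c0 * N%:R `^ (- (2 * theta)) * (G * L N ^+ g))); last first.
  by rewrite !ler_wpM2r ?mulr_ge0 ?powR_ge0 ?exprn_ge0 ?L0.
have eN : N%:R `^ (ga * (D - 2 * delta)) = N%:R `^ (- (2 * theta)) * G :> R.
  rewrite -powRD; last by rewrite pnatr_eq0 gtn_eqF// implybT.
  by congr (_ `^ _); rewrite -gaE; field.
have h1 := tail N K N0; rewrite eN in h1.
have h2 := head N N0.
have h3 : \sum_(k < k0 N) b ^+ k <= b / (b - 1) * G.
  apply: le_trans (geometric_sum_gt1 _ b1) _.
  have ib1 : 0 <= (b - 1)^-1 by rewrite invr_ge0 subr_ge0 ltW.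
  rewrite [leRHS]mulrAC; apply: ler_wpM2r ib1 _ _ _.
  rewrite /G -powx// powR2_expn /b -powRD; last by rewrite pnatr_eq0 implybT.
  rewrite ler_powR ?ler1n// (le_trans (ler_wpM2l _ (k0x1 N N0)))//; first lra.
  by rewrite mulrDr mulr1 addrC.
set NP := N%:R `^ (- (2 * theta)) in h1 h2 *.
have NP0 : 0 <= NP := powR_ge0 _ _.
have G0 : 0 <= G := powR_ge0 _ _.
rewrite /c0 !mulrDl; apply: lerD.
  apply: le_trans h2 _; rewrite [leRHS](_ : _ = C1 * NP * ((cL * L N) ^+ g * (b / (b - 1) * G))).
    apply: ler_wpM2l (mulr_ge0 C10 NP0) _ _ _.
      exact: ler_wpM2l (exprn_ge0 _ (mulr_ge0 cL0 (L0 N N0))) _ _ h3.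
  rewrite [(cL * L N) ^+ _]exprMn.
  by move: (cL ^+ g) (L N ^+ g) (b / (b - 1)) => r1 r2 r3; ring.
apply: le_trans h1 _.
rewrite [leRHS](_ : _ = C0 * (1 - a)^-1 * (NP * G) * (L N / ln 2) ^+ g).
  by rewrite ler_peMr ?Lge1//; apply: mulr_ge0 CA _; rewrite ?mulr_ge0.
rewrite [(L N / ln 2) ^+ _]exprMn.
by move: (L N ^+ g) ((ln 2)^-1 ^+ g) => r1 r2; ring.
Qed.

(** * Lattice points and dyadic shells *)

Section lattice.
Variable d : nat.
Implicit Types m : 'rV[int]_d.

(** The sup norm as a natural number: it is comparable to [normZ] up to the factor [d], and its
    balls are boxes, whose points are easy to count. *)
Definition nmax m : nat := \max_(i < d) `|m ord0 i|%N.

Lemma nmax_gt0 m : m != 0 -> (0 < nmax m)%N.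
Proof.
rewrite lt0n; apply: contraNneq => h; apply/eqP/rowP => i; rewrite mxE.
have : (`|m ord0 i| <= nmax m)%N by exact: leq_bigmax.
by rewrite h leqn0 absz_eq0 => /eqP.
Qed.

Lemma normZ_ge0 (R : realType) m : 0 <= normZ R m.
Proof. exact: sqrtr_ge0. Qed.

Lemma sqr_normZ (R : realType) m : normZ R m ^+ 2 = \sum_(i < d) (m ord0 i)%:~R ^+ 2.
Proof. by rewrite sqr_sqrtr// sumr_ge0// => i _; exact: sqr_ge0. Qed.

Lemma intr_absz (R : realType) (z : int) : `|z|%N%:R = `|z%:~R| :> R.
Proof. by rewrite -intr_norm -[LHS]mulrz_nat; congr (_%:~R); lia. Qed.

Lemma nmax_le_normZ (R : realType) m : (nmax m)%:R <= normZ R m.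
Proof.
rewrite /nmax; elim/big_ind: _ => [|x y hx hy|i _].
- exact: normZ_ge0.
- by rewrite /maxn; case: ifP.
rewrite intr_absz -(@ler_pXn2r _ 2) ?nnegrE ?normZ_ge0//.
rewrite sqr_normZ (bigD1 i)//= real_normK ?num_real// lerDl.
by apply: sumr_ge0 => j _; exact: sqr_ge0.
Qed.

Lemma normZ_le_nmax (R : realType) m : (0 < d)%N -> normZ R m <= d%:R * (nmax m)%:R.
Proof.
move=> d0; rewrite -(@ler_pXn2r _ 2) ?nnegrE ?normZ_ge0 ?mulr_ge0//.
rewrite sqr_normZ (@le_trans _ _ (\sum_(i < d) (nmax m)%:R ^+ 2))//.
  apply: ler_sum => i _; rewrite -real_normK ?num_real// -intr_absz.
  by rewrite lerXn2r ?nnegrE// ler_nat; exact: leq_bigmax.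
rewrite sumr_const card_ord exprMn -[leLHS]mulr_natl ler_wpM2r ?sqr_ge0//.
by rewrite expr2 ler_peMr// ler1n.
Qed.

Lemma size_box (s : seq 'rV[int]_d) (n : nat) : uniq s ->
  (forall m, m \in s -> (nmax m < n)%N) -> (size s <= (2 * n) ^ d)%N.
Proof.
move=> us hs; case: n hs => [|n] hs.
  by case: s us hs => [//|m s] _ /(_ m (mem_head _ _)).
pose f m : {ffun 'I_d -> 'I_(2 * n).+2} :=
  [ffun i => inord (absz (m ord0 i + n.+1%:Z))].
have inj : {in s &, injective f}.
  move=> m1 m2 /hs h1 /hs h2 /ffunP h; apply/rowP => i; have := h i; rewrite !ffunE.
  have b1 : (`|m1 ord0 i| <= nmax m1)%N by exact: leq_bigmax.
  have b2 : (`|m2 ord0 i| <= nmax m2)%N by exact: leq_bigmax.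
  have l1 : (absz (m1 ord0 i + n.+1%:Z)%R < (2 * n).+2)%N by lia.
  have l2 : (absz (m2 ord0 i + n.+1%:Z)%R < (2 * n).+2)%N by lia.
  move=> /(congr1 val); rewrite /= !inordK// => e.
  have a1 : m1 ord0 i + n.+1%:Z = absz (m1 ord0 i + n.+1%:Z) :> int by lia.
  have a2 : m2 ord0 i + n.+1%:Z = absz (m2 ord0 i + n.+1%:Z) :> int by lia.
  by apply: (@addIr _ n.+1%:Z); rewrite a1 a2 e.
have := max_card (mem (map f s)).
by rewrite (card_uniqP _) ?map_inj_in_uniq// size_map card_ffun !card_ord mulnS.
Qed.

(** The zero vector also gets index [0], like the vectors of sup norm [1]; hence the separate
    condition [m != 0] that goes with shells. *)
Definition shell m : nat := trunc_log 2 (nmax m).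

Lemma shell_bounds m : m != 0 -> (2 ^ shell m <= nmax m < 2 ^ (shell m).+1)%N.
Proof. by move=> /nmax_gt0 h; exact: trunc_log_bounds. Qed.

Lemma shell_sum (R : realType) (F : 'rV[int]_d -> R) (B : nat -> R) (C : R) :
  (forall k s, uniq s -> (forall m, m \in s -> m != 0 /\ shell m = k) ->
    \sum_(m <- s) F m <= B k) ->
  (forall K, \sum_(k < K) B k <= C) ->
  forall s, uniq s -> 0 \notin s -> \sum_(m <- s) F m <= C.
Proof.
move=> hB hC s us s0; pose K := (\max_(m <- s) shell m).+1.
rewrite (le_trans _ (hC K))//.
rewrite [leLHS](_ : _ = \sum_(m <- s) \sum_(k < K | k == shell m :> nat) F m); last first.
  rewrite big_seq [RHS]big_seq; apply: eq_bigr => m ms.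
  have mK : (shell m < K)%N.
    rewrite ltnS (big_rem m)//= leq_maxl//.
  by rewrite (big_pred1 (Ordinal mK)).
rewrite (exchange_big_dep xpredT)//=; apply: ler_sum => k _.
rewrite -big_filter; apply: hB; first exact: filter_uniq.
move=> m; rewrite mem_filter => /andP[/eqP -> ms]; split=> //.
by apply: contraNneq s0 => <-.
Qed.

End lattice.

(** * Sums over separated points *)

Lemma seq_max (R : realType) (I : eqType) (y : I -> R) (s : seq I) : s != [::] ->
  exists2 i, i \in s & forall j, j \in s -> y j <= y i.
Proof.
elim: s => [//|i s IH] _; have [->|s0] := eqVneq s [::].
  by exists i; [rewrite mem_head|move=> j; rewrite inE => /eqP ->].
have [k ks hk] := IH s0; have [ik|ki] := leP (y i) (y k).
  by exists k; [rewrite inE ks orbT|move=> j; rewrite inE => /predU1P[->//|/hk]].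
exists i; first by rewrite mem_head.
by move=> j; rewrite inE => /predU1P[->//|/hk h]; rewrite (le_trans h)// ltW.
Qed.

(* The j-th smallest of the separated values is at least [j * h]. *)
Lemma separated_sum (R : realType) (phi : R -> R) (h : R) (I : eqType) (y : I -> R)
    (s : seq I) : 0 < h -> (forall a b, 0 < a -> a <= b -> phi b <= phi a) -> uniq s ->
  (forall i, i \in s -> h <= y i) ->
  (forall i j, i \in s -> j \in s -> i != j -> h <= `|y i - y j|) ->
  \sum_(i <- s) phi (y i) <= \sum_(j < size s) phi (j.+1%:R * h).
Proof.
move=> h0 hphi us hs sep.
(* The induction removes the largest value, so it must also carry the lower bound [size s * h] for
   that value. *)
suff [] : \sum_(i <- s) phi (y i) <= \sum_(j < size s) phi (j.+1%:R * h) /\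
    (s != [::] -> exists2 i, i \in s & (size s)%:R * h <= y i) by [].
move: us hs sep; have [n] := ubnP (size s); elim: n => [//|n IH] in s *.
rewrite ltnS => sn us hs sep; have [->|s0] := eqVneq s [::].
  by rewrite !big_nil big_ord0.
have [i si hi] := seq_max y s0.
have sz : size s = (size (rem i s)).+1 by rewrite size_rem// prednK// lt0n size_eq0.
have sub j : j \in rem i s -> j \in s by exact: mem_rem.
have [] := IH (rem i s) _ (rem_uniq _ us) (fun j js => hs j (sub j js))
   (fun j k js ks => sep j k (sub j js) (sub k ks)).
  by rewrite -ltnS -sz.
move=> h1 h2; have yi : (size s)%:R * h <= y i.
  rewrite sz; have [r0|r0] := eqVneq (rem i s) [::].
    by rewrite r0 /= mul1r hs.
  have [k kr hk] := h2 r0.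
  have ks := sub k kr.
  have ki : i != k by move: kr; rewrite mem_rem_uniq// inE eq_sym => /andP[].
  have := sep i k si ks ki; rewrite ger0_norm ?subr_ge0 ?hi// => hh.
  by rewrite -natr1 mulrDl mul1r; lra.
split; last by move=> _; exists i.
rewrite (big_rem i)//= sz big_ord_recr /= addrC lerD// -sz.
by apply: hphi => //; rewrite mulr_gt0// ltr0n sz.
Qed.

(** The points are split by the side of the nearest integer on which they lie, whence the factor
    [2]. On one side, the distances to the integers differ as the points do, up to sign and an
    integer, so separation modulo [1] passes to the distances. *)
Lemma separated_dist_sum (R : realType) (phi : R -> R) (h : R) (I : eqType) (t : I -> R)
    (s : seq I) (n : nat) : 0 < h -> (forall a, 0 <= phi a) ->
  (forall a b, 0 < a -> a <= b -> phi b <= phi a) -> uniq s -> (size s <= n)%N ->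
  (forall i, i \in s -> h <= dist_int (t i)) ->
  (forall i j, i \in s -> j \in s -> i != j -> h <= dist_int (t i - t j)) ->
  \sum_(i <- s) phi (dist_int (t i)) <= 2 * \sum_(j < n) phi (j.+1%:R * h).
Proof.
move=> h0 phi0 hphi us sn hs sep.
have nn := fun i => cid (dist_intP (t i)).
pose k i := projT1 (nn i).
have kE i : dist_int (t i) = `|t i - (k i)%:~R| by exact: (projT2 (nn i)).1.
pose P i := (k i)%:~R <= t i.
have half (Q : pred I) : (forall i j, Q i -> Q j ->
      dist_int (t i - t j) <= `|dist_int (t i) - dist_int (t j)|) ->
    \sum_(i <- s | Q i) phi (dist_int (t i)) <= \sum_(j < n) phi (j.+1%:R * h).
  move=> hQ; rewrite -big_filter.
  have sz : (size [seq x <- s | Q x] <= n)%N by rewrite (leq_trans _ sn)// size_filter count_size.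
  apply: le_trans (separated_sum h0 hphi (filter_uniq Q us) _ _) _.
  - by move=> i; rewrite mem_filter => /andP[_ /hs].
  - move=> i j; rewrite !mem_filter => /andP[Qi si] /andP[Qj sj] ij.
    by rewrite (le_trans (sep _ _ si sj ij))// hQ.
  rewrite -(subnKC sz) big_split_ord /= lerDl; apply: sumr_ge0 => j _; exact: phi0.
rewrite (bigID P) /= mulr2n mulrDl !mul1r; apply: lerD; apply: half => i j.
  rewrite /P => pi1 pj1.
  have Pi : 0 <= t i - (k i)%:~R by rewrite subr_ge0.
  have Pj : 0 <= t j - (k j)%:~R by rewrite subr_ge0.
  rewrite !kE (ger0_norm Pi) (ger0_norm Pj).
  rewrite (le_trans (dist_int_le _ (k i - k j)))// intrB.
  by rewrite (_ : t i - t j - _ = t i - (k i)%:~R - (t j - (k j)%:~R))//; ring.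
rewrite /P -!ltNge => pi1 pj1.
have Pi : t i - (k i)%:~R < 0 by rewrite subr_lt0.
have Pj : t j - (k j)%:~R < 0 by rewrite subr_lt0.
rewrite !kE (ltr0_norm Pi) (ltr0_norm Pj).
rewrite (le_trans (dist_int_le _ (k i - k j)))// intrB distrC.
by rewrite (_ : _ - (t i - t j) = - (t i - (k i)%:~R) - - (t j - (k j)%:~R))//; ring.
Qed.

(** The [2 ^ i] integers in [(2 ^ i, 2 ^ (i + 1)]] contribute at most [2 ^ i * (2 ^ i) ^ (- p)]. *)
Lemma sum_powR_dyadic (R : realType) (p : R) (K : nat) : 0 <= p ->
  \sum_(j < 2 ^ K) (j.+1%:R : R) `^ (- p) <= 1 + \sum_(i < K) (2 `^ (1 - p)) ^+ i.
Proof.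
move=> p0; elim: K => [|K IH].
  by rewrite expn0 big_ord1 big_ord0 powR1 addr0.
rewrite expnS mul2n -addnn big_split_ord /= big_ord_recr /= addrA lerD//.
apply: (@le_trans _ _ (\sum_(j < 2 ^ K) (2 ^ K)%:R `^ (- p))).
  apply: ler_sum => j _; rewrite !powRN lef_pV2 ?posrE ?powR_gt0 ?ltr0n ?expn_gt0//.
  by rewrite ge0_ler_powR ?nnegrE// ler_nat -addnS leq_addr.
have e : (2 ^ K)%:R = 2 `^ K%:R :> R by rewrite natrX powR_mulrn.
rewrite e sumr_const card_ord -[leLHS]mulr_natl e -powRrM -powRD ?pnatr_eq0 ?implybT// powR2_expn.
by rewrite (_ : K%:R + K%:R * - p = (1 - p) * K%:R)//; ring.
Qed.

(** * Diophantine vectors *)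

(** With [z = N ||t||], the bound [1 / z] is used for [z >= 1] and the bound [1] for [z < 1]; both
    are at most [z ^ (- theta)]. This form separates [N] from [t]. *)
Lemma exp_sum_powR (R : realType) (theta t : R) (N : nat) : 0 < theta -> theta <= 1 ->
  (0 < N)%N -> 0 < dist_int t ->
  normc (exp_sum (@Phi R) N t) <= N%:R `^ (- theta) * dist_int t `^ (- theta).
Proof.
move=> t0 t1 N0 y0; have Np : 0 < N%:R :> R by rewrite ltr0n.
have h1 := exp_sum_le1 t N0; have h2 := exp_sum_dist t N0.
rewrite -powRM ?ler0n ?(ltW y0)//; set z := N%:R * dist_int t in h2 *.
have z0 : 0 < z by exact: mulr_gt0.
have [z1|z1] := leP 1 z.
  apply: (@le_trans _ _ (z `^ (- 1))).
    by rewrite powR_inv1 ?(ltW z0)// -[leRHS]mul1r ler_pdivlMr.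
  by rewrite ler_powR// lerN2.
apply: le_trans h1 _; rewrite -[leLHS](powRr0 z) ger_powR ?z0 ?(ltW z1)//.
by rewrite oppr_le0 ltW.
Qed.

Lemma weight_le (R : realType) (d : nat) (delta : R) (m : 'rV[int]_d) (k : nat) :
  0 <= delta -> (2 ^ k <= nmax m)%N ->
  (1 + normZ R m ^+ 2) `^ (- delta) <= (2 `^ (- (2 * delta))) ^+ k.
Proof.
move=> d0 hk.
have h : (2 `^ k%:R : R) ^+ 2 <= 1 + normZ R m ^+ 2.
  rewrite -[leLHS]add0r lerD// lerXn2r ?nnegrE ?normZ_ge0 ?powR_ge0//.
  rewrite (le_trans _ (nmax_le_normZ R m))// powR_mulrn// -natrX ler_nat.
  exact: hk.
rewrite powRN powR2_expn mulNr powRN lef_pV2 ?posrE ?powR_gt0//; last first.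
  by rewrite ltr_pwDl// sqr_ge0.
apply: le_trans (@ge0_ler_powR R delta d0 _ _ _ _ h); rewrite ?nnegrE ?sqr_ge0//.
- rewrite -powR_mulrn ?powR_ge0// -!powRrM le_eqVlt; apply/orP; left; apply/eqP.
  by congr (_ `^ _); ring.
- by rewrite addr_ge0// sqr_ge0.
Qed.

(** A shell lies in a box of at most [(2 * 2 ^ (k + 1)) ^ d = 4 ^ d * 2 ^ (k d)] points, each of
    weight at most [2 ^ (- 2 delta k)]. *)
Lemma shell_weight_le (R : realType) (d : nat) (delta : R) (k : nat) (s : seq 'rV[int]_d) :
  0 <= delta -> uniq s -> (forall m, m \in s -> m != 0 /\ shell m = k) ->
  \sum_(m <- s) (1 + normZ R m ^+ 2) `^ (- delta) <=
  4 ^+ d * (2 `^ (d%:R - 2 * delta)) ^+ k.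
Proof.
move=> de0 us hs.
apply: (@le_trans _ _ (\sum_(m <- s) (2 `^ (- (2 * delta))) ^+ k)).
  rewrite big_seq [leRHS]big_seq; apply: ler_sum => m ms.
  have [m0 mk] := hs m ms; have /andP[b1 b2] := shell_bounds m0.
  by apply: weight_le => //; rewrite -mk.
rewrite big_const_seq iter_addr_0 count_predT -[leLHS]mulr_natl.
have sz : (size s <= (2 * 2 ^ k.+1) ^ d)%N.
  apply: size_box => // m /hs[m0 <-].
  by have /andP[] := shell_bounds m0.
apply: (@le_trans _ _ (((2 * 2 ^ k.+1) ^ d)%:R * 2 `^ (- (2 * delta)) ^+ k)).
  by rewrite ler_wpM2r ?exprn_ge0 ?powR_ge0// ler_nat.
have -> : ((2 * 2 ^ k.+1) ^ d)%:R = 4 ^+ d * (2 `^ d%:R) ^+ k :> R.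
  rewrite natrX expnS mulnA natrM exprMn natrX; congr (_ * _).
  by rewrite powR_mulrn// -!exprM mulnC.
rewrite -mulrA -exprMn -powRD; last by rewrite pnatr_eq0 implybT.
by rewrite lexx.
Qed.

Section diophantine.
Variables (R : realType) (d : nat) (alpha : 'rV[R]_d) (H sigma theta delta : R).

Definition diophantine := forall m : 'rV[int]_d, m != 0 ->
  H * normZ R m `^ (- sigma) <= dist_int (dotZ m alpha).

Lemma nmaxB (m n : 'rV[int]_d) (K : nat) :
  (nmax m < K)%N -> (nmax n < K)%N -> (nmax (m - n) <= 2 * K)%N.
Proof.
move=> mK nK; apply/bigmax_leqP => i _; rewrite !mxE.
have b1 : (`|m ord0 i| <= nmax m)%N by exact: leq_bigmax.
have b2 : (`|n ord0 i| <= nmax n)%N by exact: leq_bigmax.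
move: (m ord0 i) (n ord0 i) (nmax m) (nmax n) b1 b2 mK nK => x y mx my.
by lia.
Qed.

Lemma diophantine_box (m : 'rV[int]_d) (K : nat) : (0 < d)%N -> 0 < H -> 0 <= sigma ->
  diophantine -> m != 0 -> (nmax m <= K)%N ->
  H * (d%:R * K%:R) `^ (- sigma) <= dist_int (dotZ m alpha).
Proof.
move=> d0 H0 s0 dio m0 mK; apply: le_trans (dio m m0).
have n0 : 0 < normZ R m.
  by rewrite (lt_le_trans _ (nmax_le_normZ R m))// ltr0n nmax_gt0.
have nK : normZ R m <= d%:R * K%:R.
  by rewrite (le_trans (normZ_le_nmax R m d0))// ler_wpM2l// ler_nat.
apply: ler_wpM2l; first exact: ltW.
rewrite !powRN lef_pV2 ?posrE ?powR_gt0//; last exact: lt_le_trans n0 nK.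
by rewrite ge0_ler_powR ?nnegrE// ?(ltW n0)// (le_trans (ltW n0)).
Qed.

(* The sum over the separated points of a shell is dominated by its last terms if
   [theta < 1/2], by its first ones if [theta > 1/2], and is logarithmic in between. *)
Definition shell_exponent : R :=
  theta * sigma + if theta < 2^-1 then d%:R * (2^-1 - theta) else 0.

Definition shell_log : nat := theta == 2^-1.

(** The [(k + 2) d] blocks come from a shell of at most [2 ^ ((k + 2) d)] points. For [theta < 1/2]
    the last block dominates: [q ^ ((k + 2) d)] is [q ^ (2 d)] times [(q ^ d) ^ k], and [q ^ d] is
    [2] to twice the excess of [shell_exponent] over [theta * sigma]. For [theta = 1/2] the blocks
    are equal and their number gives the factor [k + 1]. *)
Lemma block_sum_le : (0 < d)%N -> exists2 C : R, 0 <= C & forall k : nat,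
  1 + \sum_(i < k.+2 * d) (2 `^ (1 - 2 * theta)) ^+ i <=
  C * (k.+1%:R ^+ shell_log * (2 `^ (2 * shell_exponent - 2 * (theta * sigma))) ^+ k).
Proof.
move=> d0; rewrite /shell_log /shell_exponent; set q := 2 `^ (1 - 2 * theta).
have q0 : 0 <= q := powR_ge0 _ _.
have [t|t|t] := ltgtP theta 2^-1.
- have q1 : 1 < q by apply: powR2_gt1; lra.
  exists ((1 + (q - 1)^-1) * q ^+ (2 * d)).
    by rewrite mulr_ge0 ?exprn_ge0// addr_ge0// invr_ge0 subr_ge0 ltW.
  move=> k; rewrite expr0 mul1r.
  have -> : 2 `^ (2 * (theta * sigma + d%:R * (2^-1 - theta)) - 2 * (theta * sigma)) = q ^+ d.
    by rewrite powR2_expn; congr (_ `^ _); field.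
  rewrite -exprM -mulrA -exprD.
  have -> : (2 * d + d * k = k.+2 * d)%N by lia.
  have := geometric_sum_gt1 (k.+2 * d) q1.
  have : 1 <= q ^+ (k.+2 * d) by rewrite exprn_ege1// ltW.
  by rewrite mulrDl mul1r [(q - 1)^-1 * _]mulrC => h1 h2; exact: lerD.
- have q1 : q < 1 by apply: powR2_lt1; lra.
  exists (1 + (1 - q)^-1); first by rewrite addr_ge0// invr_ge0 subr_ge0 ltW.
  move=> k; rewrite expr0 mul1r addr0 subrr powRr0 expr1n mulr1 lerD2l.
  exact: geometric_sum_lt1.
- exists (1 + 2 * d%:R) => [|k]; first by rewrite addr_ge0// mulr_ge0.
  rewrite addr0 subrr powRr0 expr1n mulr1 expr1 /q t mulfV// subrr powRr0.
  under eq_bigr do rewrite expr1n.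
  rewrite sumr_const card_ord natrM -!natr1.
  have k0 : 0 <= k%:R :> R by [].
  have dd : 1 <= d%:R :> R by rewrite ler1n.
  by nra.
Qed.

Hypothesis dio : diophantine.

Lemma shell_le_count (N k : nat) (s : seq 'rV[int]_d) : (0 < N)%N -> 0 <= delta -> uniq s ->
  (forall m, m \in s -> m != 0 /\ shell m = k) ->
  \sum_(m <- s) (1 + normZ R m ^+ 2) `^ (- delta) *
      normc (exp_sum (@Phi R) N (dotZ m alpha)) ^+ 2 <=
  4 ^+ d * (2 `^ (d%:R - 2 * delta)) ^+ k.
Proof.
move=> N0 de0 us hs; apply: le_trans (shell_weight_le de0 us hs).
apply: ler_sum => m _; rewrite ler_piMr ?powR_ge0//.
by rewrite exprn_ile1 ?normc_ge0 ?exp_sum_le1.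
Qed.

(** Differences of distinct frequencies of a shell are nonzero of size [O(2^k)], so the Diophantine
    condition spaces the points [m.alpha] by [h], of order [2 ^ (- k sigma)], modulo [1] and keeps
    them [h] away from the integers. Then [h ^ (- 2 theta)] gives the growth
    [2 ^ (2 theta sigma k)], and the sum over the multiples of [h] gives the rest of
    [shell_exponent]. *)
Lemma shell_le_separated : (0 < d)%N -> 0 < H -> 0 <= sigma -> 0 < theta -> theta <= 1 ->
  0 <= delta -> exists2 C1 : R, 0 <= C1 & forall (N k : nat) (s : seq 'rV[int]_d),
  (0 < N)%N -> uniq s -> (forall m, m \in s -> m != 0 /\ shell m = k) ->
  \sum_(m <- s) (1 + normZ R m ^+ 2) `^ (- delta) *
      normc (exp_sum (@Phi R) N (dotZ m alpha)) ^+ 2 <=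
  C1 * N%:R `^ (- (2 * theta)) *
    (k.+1%:R ^+ shell_log * (2 `^ (2 * shell_exponent - 2 * delta)) ^+ k).
Proof.
move=> d0 H0 s0 t0 t1 de0; have [C C0 hC] := block_sum_le d0.
pose p := 2 * theta; have p0 : 0 < p by rewrite mulr_gt0.
have dp : 0 < d%:R :> R by rewrite ltr0n.
pose c1 := 2 * (H `^ (- p) * (d%:R * 4) `^ (sigma * p)).
have c10 : 0 <= c1 by rewrite !mulr_ge0 ?powR_ge0.
exists (c1 * C); first exact: mulr_ge0.
move=> N k s N0 us hs.
(* [2 * 2 ^ (k + 1)] bounds the sup norm of a difference of two frequencies of the shell, hence also
   that of a single one. *)
pose h := H * (d%:R * (2 * 2 ^ k.+1)%:R) `^ (- sigma).
have big0 : 0 < d%:R * (2 * 2 ^ k.+1)%:R :> R.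
  by rewrite mulr_gt0// ltr0n muln_gt0 expn_gt0.
have h0 : 0 < h by rewrite mulr_gt0// powR_gt0.
have yh m : m \in s -> h <= dist_int (dotZ m alpha).
  move=> /hs[m0 mk]; apply: diophantine_box => //.
  by have /andP[_] := shell_bounds m0; rewrite mk => /ltnW hh; rewrite (leq_trans hh)// leq_pmull.
have sep m n : m \in s -> n \in s -> m != n -> h <= dist_int (dotZ m alpha - dotZ n alpha).
  move=> /hs[m0 mk] /hs[n0 nk] mn; rewrite -dotZBl; apply: diophantine_box => //.
    by rewrite subr_eq0.
  have /andP[_ hm] := shell_bounds m0; have /andP[_ hn] := shell_bounds n0.
  by apply: nmaxB; rewrite -?mk// mk -nk.
have sz : (size s <= 2 ^ (k.+2 * d))%N.
  rewrite expnM expnS; apply: size_box => // m /hs[m0 <-].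
  by have /andP[] := shell_bounds m0.
have sumy : \sum_(m <- s) dist_int (dotZ m alpha) `^ (- p) <=
    2 * \sum_(j < 2 ^ (k.+2 * d)) (j.+1%:R * h) `^ (- p).
  apply: (@separated_dist_sum _ (fun y => y `^ (- p)) h _ (fun m => dotZ m alpha)) => //.
    by move=> a; exact: powR_ge0.
  move=> a b a0 ab; rewrite !powRN lef_pV2 ?posrE ?powR_gt0 ?(lt_le_trans a0)//.
  by rewrite ge0_ler_powR ?nnegrE ?(ltW p0) ?(ltW a0)// (le_trans (ltW a0)).
have hp : h `^ (- p) = H `^ (- p) * (d%:R * 4) `^ (sigma * p) * (2 `^ (2 * (theta * sigma))) ^+ k.
  rewrite /h powRM ?(ltW H0) ?powR_ge0// -mulrA; congr (_ * _).
  rewrite -powRrM (_ : (2 * 2 ^ k.+1)%:R = 4 * 2 `^ k%:R :> R); last first.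
    by rewrite powR_mulrn// expnS mulnA natrM natrX.
  rewrite mulrA powRM ?powR_ge0 ?mulr_ge0//; congr (_ `^ _ * _); first by ring.
  by rewrite -powRrM powR2_expn; congr (_ `^ _); rewrite /p; ring.
apply: (@le_trans _ _ (\sum_(m <- s) (2 `^ (- (2 * delta))) ^+ k *
    (N%:R `^ (- p) * dist_int (dotZ m alpha) `^ (- p)))).
  rewrite big_seq [leRHS]big_seq; apply: ler_sum => m ms.
  have [m0 mk] := hs m ms; have /andP[b1 b2] := shell_bounds m0.
  apply: ler_pM; rewrite ?powR_ge0 ?exprn_ge0 ?normc_ge0//.
    by apply: weight_le => //; rewrite -mk.
  have y0 : 0 < dist_int (dotZ m alpha) by apply: lt_le_trans h0 (yh m ms).
  have -> : N%:R `^ (- p) * dist_int (dotZ m alpha) `^ (- p) =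
     (N%:R `^ (- theta) * dist_int (dotZ m alpha) `^ (- theta)) ^+ 2.
    rewrite exprMn -!(@powR_mulrn _ (_ `^ _)) ?powR_ge0// -!powRrM.
    by congr (_ `^ _ * _ `^ _); rewrite /p; ring.
  rewrite lerXn2r ?nnegrE ?normc_ge0 ?mulr_ge0 ?powR_ge0//.
  exact: exp_sum_powR.
rewrite -!mulr_sumr.
have s1 : \sum_(j < 2 ^ (k.+2 * d)) (j.+1%:R * h) `^ (- p) <=
   h `^ (- p) * (C * (k.+1%:R ^+ shell_log * (2 `^ (2 * shell_exponent - 2 * (theta * sigma))) ^+ k)).
  rewrite (eq_bigr (fun j : 'I_ _ => h `^ (- p) * j.+1%:R `^ (- p))) => [|j _]; last first.
    by rewrite powRM ?(ltW h0)// mulrC.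
  rewrite -mulr_sumr ler_wpM2l ?powR_ge0//.
  exact: le_trans (sum_powR_dyadic _ (ltW p0)) (hC k).
apply: (@le_trans _ _ (2 `^ (- (2 * delta)) ^+ k * (N%:R `^ (- p) * (2 * (h `^ (- p) * (C * (k.+1%:R ^+ shell_log * (2 `^ (2 * shell_exponent - 2 * (theta * sigma))) ^+ k))))))).
  apply: ler_wpM2l; first by rewrite exprn_ge0 ?powR_ge0.
  apply: ler_wpM2l; first exact: powR_ge0.
  by apply: le_trans sumy _; rewrite ler_wpM2l.
have -> : 2 `^ (2 * shell_exponent - 2 * delta) ^+ k =
   2 `^ (- (2 * delta)) ^+ k * (2 `^ (2 * (theta * sigma))) ^+ k *
   (2 `^ (2 * shell_exponent - 2 * (theta * sigma))) ^+ k.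
  rewrite -!exprMn -!powRD ?pnatr_eq0 ?implybT//; congr ((_ `^ _) ^+ _).
  by ring.
rewrite hp /c1 le_eqVlt; apply/orP; left; apply/eqP.
move: (2 `^ (- (2 * delta)) ^+ k) (2 `^ (2 * (theta * sigma)) ^+ k) (k.+1%:R ^+ shell_log)
  (2 `^ (2 * shell_exponent - 2 * (theta * sigma)) ^+ k) (N%:R `^ (- p)) (H `^ (- p))
  ((d%:R * 4) `^ (sigma * p)) => r1 r2 r3 r4 r5 r6 r7.
by ring.
Qed.

(** For [theta <= 1/2] one has [shell_exponent - d / 2 = theta (sigma - d)], so [theta] cancels from
    the crossover exponent; at [theta = 1/2] the power [L ^ (2 / 2)] is the plain logarithm. *)
Lemma dyadic_rateE (N : nat) : (0 < d)%N -> 0 < theta -> d%:R <= sigma ->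
  dyadic_rate d%:R delta shell_exponent theta shell_log N = Xrate d delta theta sigma N.
Proof.
move=> d0 t0 ds; have dp : 0 < d%:R :> R by rewrite ltr0n.
rewrite /dyadic_rate /Xrate /shell_exponent /shell_log.
have [t|t|t] := ltgtP theta 2^-1.
- rewrite (_ : theta * sigma + d%:R * (2^-1 - theta) = theta * sigma - d%:R * (theta - 2^-1)); last by ring.
  rewrite mul0r powRr0 mulr1 mul1r.
  case: ifP => // _; congr (_ `^ _).
  rewrite (_ : theta * sigma - d%:R * (theta - 2^-1) - d%:R / 2 = theta * (sigma - d%:R)); last by field.
  rewrite invfM mulrA mulfV ?gt_eqF// mul1r mulrC; congr (_ / _); by field.
- rewrite addr0 mul0r powRr0 mulr1 mul1r.
  by case: ifP => // _; congr (_ `^ _); rewrite mulrAC.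
rewrite addr0 t (_ : 2^-1 * sigma = sigma / 2); last by rewrite mulrC.
rewrite mul1r; case: ifP => _.
  congr (_ `^ _ * _).
  rewrite (_ : sigma / 2 - d%:R / 2 = 2^-1 * (sigma - d%:R)); last by ring.
  by rewrite invfM mulrA mulfV ?invr_neq0 ?pnatr_eq0// mul1r mulrC.
by case: ifP => // _; rewrite mulfV// powRr1// ln_ge0// lerDl.
Qed.

Lemma weighted_exp_sum_le : (0 < d)%N -> 0 < H -> d%:R <= sigma -> 0 < theta ->
  theta <= 1 -> d%:R / 2 < delta -> exists2 c : R, 0 < c &
  forall (N : nat) (s : seq 'rV[int]_d), (0 < N)%N -> uniq s -> 0 \notin s ->
    \sum_(m <- s) (1 + normZ R m ^+ 2) `^ (- delta) *
      normc (exp_sum (@Phi R) N (dotZ m alpha)) ^+ 2 <=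
    (c * N%:R `^ (- theta) * Xrate d delta theta sigma N) ^+ 2.
Proof.
move=> d0 H0 ds t0 t1 Dd; have dp : 0 < d%:R :> R by rewrite ltr0n.
have de0 : 0 <= delta by lra.
have s0 : 0 <= sigma by lra.
have [C1 C10 hC1] := shell_le_separated d0 H0 s0 t0 t1 de0.
have tau_ge : d%:R / 2 <= shell_exponent.
  rewrite /shell_exponent; case: ltP => t.
    rewrite -subr_ge0 (_ : _ - _ = theta * (sigma - d%:R)); last by field.
    by rewrite mulr_ge0// ?(ltW t0)// subr_ge0.
  by nra.
have g1 : (shell_log <= 1)%N by rewrite /shell_log; case: eqP.
have [c c0 hc] := dyadic_sum_le g1 t0 Dd tau_ge (exprn_ge0 d (ler0n R 4)) C10.
exists c => // N s N0; rewrite -dyadic_rateE//.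
apply: (@shell_sum d R _ (fun k => Num.min (4 ^+ d * (2 `^ (d%:R - 2 * delta)) ^+ k)
  (C1 * N%:R `^ (- (2 * theta)) * (k.+1%:R ^+ shell_log * (2 `^ (2 * shell_exponent - 2 * delta)) ^+ k)))).
  move=> k s' us' hs'; rewrite le_min; apply/andP; split.
    exact: shell_le_count.
  exact: hC1.
by move=> K; exact: hc.
Qed.

Lemma Xrate_ge0 (N : nat) : 0 <= Xrate d delta theta sigma N.
Proof.
rewrite /Xrate; repeat case: ifP => _ //; rewrite ?mulr_ge0 ?powR_ge0//.
by rewrite ln_ge0// lerDl.
Qed.

End diophantine.

Lemma discrepancy_diophantine (R : realType) (d : nat) (theta : R)
    (alpha : 'rV[R]_d) (H sigma delta : R) :
  (0 < d)%N -> 0 < theta -> theta <= 1 -> 0 < H -> d%:R <= sigma ->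
  diophantine alpha H sigma -> d%:R / 2 < delta ->
  exists2 c : R, 0 < c &
    forall (u : ('rV[R]_d -> R[i]) -> R[i]) (f : 'rV[R]_d -> R[i]) (N : nat),
      sobolev_space delta u -> continuous_representative u f -> (1 <= N)%N ->
      (sup_norm (discrepancy (@Phi R) alpha f N)
         <= (c * N%:R `^ (- theta) * Xrate d delta theta sigma N)%:E
            * sobolev_norm delta u)%E.
Proof.
move=> d0 t0 t1 H0 ds dio Dd.
have [c c0 hc] := weighted_exp_sum_le dio d0 H0 ds t0 t1 Dd.
exists c => // u f N su rf N0; apply: sup_norm_le_weighted => //.
  by rewrite mulr_ge0 ?Xrate_ge0// mulr_ge0 ?powR_ge0// ltW.
by move=> s us s0; exact: hc.
Qed.

(** * Almost every vector *)

Lemma ler_sum_subseq (R : realType) (J : eqType) (F : J -> R) (s s' : seq J) :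
  uniq s -> uniq s' -> {subset s <= s'} -> (forall j, 0 <= F j) ->
  \sum_(j <- s) F j <= \sum_(j <- s') F j.
Proof.
move=> us us' ss' F0; rewrite [leRHS](bigID (mem s)) /=.
rewrite [X in _ <= X + _](_ : _ = \sum_(j <- s) F j).
  by rewrite lerDl sumr_ge0.
rewrite -big_filter; apply: perm_big; apply: uniq_perm => //.
  exact: filter_uniq.
by move=> j; rewrite mem_filter; apply/andP/idP => [[]//|js]; split=> //; exact: ss'.
Qed.

Lemma sum_filter_neq0 (R : realType) (J : eqType) (F : J -> R) (P : pred J) (s : seq J) :
  (forall j, j \in s -> ~~ P j -> F j = 0) ->
  \sum_(j <- s) F j = \sum_(j <- [seq j <- s | P j]) F j.
Proof.
move=> F0; rewrite big_filter [RHS]big_mkcond [LHS]big_seq [RHS]big_seq.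
by apply: eq_bigr => j js; case: ifPn => // /F0 ->.
Qed.

(** By monotone convergence the full series has a finite integral; it is thus finite almost
    everywhere and bounds its partial sums. *)
Lemma ae_bounded_partial_sums (dd : measure_display) (T : measurableType dd) (R : realType)
    (mu : {measure set T -> \bar R}) (D : set T) (f : nat -> T -> R) (S : R) :
  measurable D -> (forall n, measurable_fun D (f n)) -> (forall n x, 0 <= f n x) ->
  (forall K, (\sum_(n < K) \int[mu]_(x in D) (f n x)%:E <= S%:E)%E) ->
  {ae mu, forall x, D x -> exists B : R, forall K, \sum_(n < K) f n x <= B}.
Proof.
move=> mD mf f0 hS; pose F x := (\sum_(n <oo) (f n x)%:E)%E.
have mF : measurable_fun D F.
  apply: ge0_emeasurable_sum => [n x _ _|n _]; first by rewrite lee_fin.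
  exact/measurable_EFinP.
have intF : (\int[mu]_(x in D) F x <= S%:E)%E.
  rewrite integral_nneseries//; last 2 first.
  - by move=> n; exact/measurable_EFinP.
  - by move=> n x _; rewrite lee_fin.
  apply: lime_le.
    by apply: is_cvg_nneseries => n _ _; apply: integral_ge0 => x _; rewrite lee_fin.
  by apply: nearW => K; rewrite big_mkord; exact: hS.
have iF : mu.-integrable D F.
  apply/integrableP; split=> //; apply: le_lt_trans (ltry S).
  rewrite (eq_integral F)// => x _; rewrite gee0_abs// nneseries_ge0// => n _ _.
  by rewrite lee_fin.
have := integrable_ae mD iF; apply: filterS => x hx Dx.
exists (fine (F x)) => K; rewrite -lee_fin fineK; last exact: hx.
rewrite -sumEFin -(big_mkord xpredT (fun n => (f n x)%:E)).
by apply: nneseries_lim_ge => n _ _; rewrite lee_fin.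
Qed.

(** The index set is enumerated by its codes, with the zero function at integers that code nothing;
    every finite list sits inside an initial segment. *)
Lemma ae_bounded_sums (dd : measure_display) (T : measurableType dd) (R : realType)
    (mu : {measure set T -> \bar R}) (D : set T) (J : countType) (f : J -> T -> R) (S : R) :
  measurable D -> (forall j, measurable_fun D (f j)) -> (forall j x, 0 <= f j x) ->
  (forall s, uniq s -> (\sum_(j <- s) \int[mu]_(x in D) (f j x)%:E <= S%:E)%E) ->
  {ae mu, forall x, D x -> exists B : R, forall s, uniq s -> \sum_(j <- s) f j x <= B}.
Proof.
move=> mD mf f0 hS.
pose g n x := oapp (f^~ x) 0 (@pickle_inv J n).
have gE (V : nmodType) (h : J -> V) (K : nat) :
    \sum_(n < K) oapp h 0 (@pickle_inv J n) = \sum_(j <- pmap (@pickle_inv J) (iota 0 K)) h j.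
  rewrite -(big_mkord xpredT (fun n => oapp h 0 (@pickle_inv J n))) /index_iota subn0.
  elim: (iota 0 K) => [|n l IH]; first by rewrite !big_nil.
  by rewrite big_cons IH /=; case: (pickle_inv n) => [j|] /=; rewrite ?big_cons ?add0r.
have us K : uniq (pmap (@pickle_inv J) (iota 0 K)).
  by apply: (@pmap_uniq _ _ _ pickle); [exact: pickle_invK|exact: iota_uniq].
have : {ae mu, forall x, D x -> exists B : R, forall K, \sum_(n < K) g n x <= B}.
  apply: (@ae_bounded_partial_sums _ _ _ _ _ _ S) => // [n|n x|K].
  - by rewrite /g; case: pickle_inv => [j|] //=; exact: measurable_cst.
  - by rewrite /g; case: pickle_inv => //=.
  rewrite (eq_bigr (fun n : 'I_K => oapp (fun j => \int[mu]_(x in D) (f j x)%:E)%E 0%E (@pickle_inv J n))).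
    by rewrite (gE _ (fun j => \int[mu]_(x in D) (f j x)%:E)%E); exact: hS.
  by move=> n _; rewrite /g; case: pickle_inv => [j|] //=; rewrite integral0.
apply: filterS => x hx /hx[B hB]; exists B => s u.
pose K := (\max_(j <- s) pickle j).+1.
apply: le_trans (hB K); rewrite [leRHS](gE _ (f^~ x)).
apply: ler_sum_subseq => // j js; rewrite mem_pmap; apply/mapP; exists (pickle j).
  by rewrite mem_iota /= add0n ltnS; apply: leq_bigmax_seq.
by rewrite pickleK_inv.
Qed.

Lemma dyadic_level (R : realType) (y : R) : 0 < y -> y < 1 ->
  exists k : nat, 2^-1 ^+ k.+1 <= y < 2^-1 ^+ k.
Proof.
move=> y0 y1.
have ex : exists k, 2^-1 ^+ k <= y.
  exists (Num.bound y^-1); rewrite exprVn invf_ple ?posrE ?exprn_gt0//.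
  by apply/ltW/upper_nthrootP.
have [[|k] hk min] := ex_minnP ex; first by move: hk; rewrite expr0 leNgt y1.
exists k; rewrite hk /= ltNge; apply/negP => /min.
by rewrite ltnn.
Qed.

Lemma geometric_layers (R : realType) (q : R) (K : nat) : q < 1 ->
  \sum_(k < K) (2 `^ q) ^+ k.+1 * 2^-1 ^+ k <= 2 `^ q / (1 - 2 `^ (q - 1)) :> R.
Proof.
move=> q1; have h : 2 `^ (q - 1) < 1 :> R by apply: powR2_lt1; rewrite subr_lt0.
rewrite (eq_bigr (fun k : 'I_K => 2 `^ q * (2 `^ (q - 1)) ^+ k)) => [|k _].
  by rewrite -mulr_sumr ler_wpM2l ?powR_ge0// geometric_sum_lt1// powR_ge0.
rewrite exprS -mulrA -exprMn powRB; last by rewrite pnatr_eq0 implybT.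
by rewrite powRr1.
Qed.

(** The inclusion of l^p in l^1 for [p <= 1]: each [w^p] is at most [B], so [w = w^p * (w^p)^(1/p -
    1) <= w^p * B^(1/p - 1)]. *)
Lemma sum_powR_le (R : realType) (J : eqType) (w : J -> R) (p B : R) (s : seq J) :
  0 < p -> p <= 1 -> (forall j, 0 <= w j) -> \sum_(j <- s) w j `^ p <= B ->
  \sum_(j <- s) w j <= B * B `^ (p^-1 - 1).
Proof.
move=> p0 p1 w0 hB.
have B0 : 0 <= B by apply: le_trans hB; apply: sumr_ge0 => j _; exact: powR_ge0.
apply: (@le_trans _ _ (\sum_(j <- s) w j `^ p * B `^ (p^-1 - 1))); last first.
  by rewrite -mulr_suml ler_wpM2r ?powR_ge0.
rewrite big_seq [leRHS]big_seq; apply: ler_sum => j js.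
have wB : w j `^ p <= B.
  apply: le_trans hB; rewrite (big_rem _ js) /= lerDl.
  by apply: sumr_ge0 => i _; exact: powR_ge0.
have p1' : 0 <= p^-1 - 1 by rewrite subr_ge0 invf_ge1.
apply: (@le_trans _ _ (w j `^ p * (w j `^ p) `^ (p^-1 - 1))); last first.
  by rewrite ler_wpM2l ?powR_ge0// ge0_ler_powR ?nnegrE ?powR_ge0.
have [->|wj0] := eqVneq (w j) 0; first by rewrite mulr_ge0 ?powR_ge0.
rewrite -powRrM -powRD; last by rewrite wj0 implybT.
rewrite (_ : p + p * (p^-1 - 1) = 1) ?powRr1//.
by field; rewrite gt_eqF.
Qed.

(** A pointwise form of Holder's inequality: if the first term does not dominate, then
    [a ^ (2 - p) <= 1 / w], and raising this to the power [p / (2 - p)] gives the second term. *)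
Lemma powR_sub_le (R : realType) (a w p : R) : 0 < p -> p < 2 -> 0 <= a -> 0 < w ->
  a `^ p <= w * a ^+ 2 + w `^ (- (p / (2 - p))).
Proof.
move=> p0 p2 a0 w0; have [h|h] := leP (a `^ p) (w * a ^+ 2).
  by rewrite (le_trans h)// lerDl powR_ge0.
rewrite -[leLHS]add0r lerD//; first by rewrite mulr_ge0 ?sqr_ge0// ltW.
have [a00|an0] := eqVneq a 0; first by rewrite a00 powR0 ?powR_ge0// gt_eqF.
have ap : 0 < a by rewrite lt_def an0.
have h1 : a `^ (2 - p) <= w^-1.
  rewrite powRB; last by rewrite an0 implybT.
  rewrite powR_mulrn// ler_pdivrMr ?powR_gt0// mulrC ler_pdivlMr//.
  by rewrite mulrC ltW.
have -> : a `^ p = (a `^ (2 - p)) `^ (p / (2 - p)).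
  rewrite -powRrM; congr (_ `^ _); field.
  by rewrite subr_eq0 gt_eqF.
have -> : w `^ (- (p / (2 - p))) = w^-1 `^ (p / (2 - p)).
  by rewrite -(powR_inv1 (ltW w0)) -powRrM mulN1r.
rewrite ge0_ler_powR ?nnegrE ?powR_ge0 ?invr_ge0 ?(ltW w0)//.
by rewrite divr_ge0 ?(ltW p0)// subr_ge0 ltW.
Qed.

Lemma dist_int_lipschitz (R : realType) (s t : R) : dist_int s <= dist_int t + `|s - t|.
Proof.
have [n [-> _]] := dist_intP t; apply: le_trans (dist_int_le s n) _.
rewrite (_ : s - n%:~R = t - n%:~R + (s - t)); first exact: ler_normD.
by ring.
Qed.

Lemma measurable_dist_int (R : realType) :
  measurable_fun [set: measurableTypeR R] (@dist_int R : measurableTypeR R -> measurableTypeR R).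
Proof.
apply: continuous_measurable_fun => s; apply/cvgrPdist_lt => e e0; near=> t.
have h1 := dist_int_lipschitz s t; have h2 := dist_int_lipschitz t s.
have st : `|s - t| < e by near: t; exact: cvgr_dist_lt.
rewrite distrC in h2; rewrite ltr_norml; apply/andP; split; lra.
Unshelve. all: by end_near. Qed.

(** * Sublevel sets of the distance to the integers *)

Section sublevel_estimate.
Context (R : realType).

Definition box (d M : nat) : set 'rV[R]_d := [set x | forall i, - M%:R <= x ord0 i < M%:R].

Lemma measurable_box (d M : nat) : measurable (@box d M).
Proof.
rewrite (_ : @box d M = \bigcap_(i in [set: 'I_d])
      ((fun x : 'rV[R]_d => x ord0 i) @^-1` `[- M%:R, M%:R[%classic)).
  apply: fin_bigcap_measurable => [|i _]; first exact: finite_finset.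
  by rewrite -[X in measurable X]setTI; exact: measurable_coord.
apply/seteqP; split=> x /= h i; first by move=> _; rewrite /= in_itv; exact: h.
by have := h i I; rewrite /= in_itv.
Qed.

Lemma box_measure (d M : nat) : lebesgue_rV R d (@box d M) = ((2 * M%:R) ^+ d)%:E.
Proof.
rewrite (_ : @box d M = [set x : 'rV[R]_d | forall i, `[- M%:R, M%:R[%classic (x ord0 i)]).
  rewrite (@lebesgue_rV_box R d (fun=> `[- M%:R, M%:R[%classic)) => [|i]; last by [].
  rewrite (eq_bigr (fun=> (2 * M%:R)%:E)) => [|i _].
    by rewrite prodEFin prodr_const card_ord.
  rewrite lebesgue_measure_itv/= lte_fin; case: ltP => h; first by rewrite -EFinB; congr EFin; ring.
  by congr EFin; have := ler0n R M; lra.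
by apply/seteqP; split=> x /= h i; have := h i; rewrite in_itv.
Qed.

(** The set is covered by balls of radius [e / |k|] around the solutions of [c + k s = j], with [j]
    an integer. Their number is [O(|k| M + 1)], so [k] cancels and the bound is uniform in [k], as
    the sum over frequencies requires. *)
Lemma sublevel_itv (M : nat) (k : int) (c e : R) : k != 0 -> 0 < e -> e <= 1 ->
  (@lebesgue_measure R
    [set s | (- M%:R <= s < M%:R)%R /\ (dist_int (c + k%:~R * s) < e)%R]
   <= ((4 * M%:R + 10) * e)%:E)%E.
Proof.
move=> k0 e0 e1; pose a : R := k%:~R; have a0 : 0 < `|a| by rewrite normr_gt0 intr_eq0.
have aE : `|a| = `|k|%N%:R by rewrite intr_absz.
have a1 : 1 <= `|a| by rewrite aE ler1n absz_gt0.
(* [c + k s] ranges over an interval of length [2 |k| M], and the [5] leaves room for rounding at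
   both ends. Since [|k| >= 1], the total length [n * 2 e / |k|] is at most [(4 M + 10) e]. *)
pose n := (2 * (`|k| * M) + 5)%N.
pose z (i : nat) : R := (Num.floor c)%:~R - (`|a| * M%:R + 2) + i%:R.
apply: (@le_trans _ _ (lebesgue_measure (\big[setU/set0]_(i < n) ball ((z i - c) / a) (e / `|a|)))).
  apply: le_outer_measure => s /= [/andP[s1 s2] hs].
  have [j [jE jh]] := dist_intP (c + a * s); rewrite jE in hs.
  have as_le : `|a * s| <= `|a| * M%:R by rewrite normrM ler_wpM2l// ler_norml s1 ltW.
  have /andP[f1 f2] := floor_itv c; rewrite intrD in f2.
  have [i iE ilt] : exists2 i, j%:~R = z i & (i < n)%N.
    have zE : (Num.floor c)%:~R - (`|a| * M%:R + 2) = (Num.floor c - (`|k| * M + 2)%N%:Z)%:~R :> R.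
      by rewrite intrB; congr (_ - _); rewrite aE -[RHS]pmulrn natrD natrM.
    move: hs as_le; rewrite ltr_norml ler_norml => /andP[h1 h2] /andP[h3 h4].
    have b1 : z 0%N <= j%:~R by rewrite /z; lra.
    have b2 : j%:~R < z n.
      rewrite /z /n natrD !natrM -aE; lra.
    exists (absz (j - (Num.floor c - (`|k| * M + 2)%N%:Z))%R).
      rewrite /z zE; move: b1; rewrite /z zE addr0 ler_int => b1.
      by rewrite intr_absz -intr_norm -intrD ger0_norm ?subr_ge0// addrC subrK.
    move: b1 b2; rewrite /z zE addr0 ler_int [n%:R]pmulrn -intrD ltr_int => b1 b2.
    by rewrite -ltz_nat gez0_abs ?subr_ge0// ltrBlDl.
  have := @bigsetU_sup R i n (fun i => ball ((z i - c) / a) (e / `|a|)) ilt; apply.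
  rewrite /= /ball /= -iE.
  rewrite ltr_pdivlMr// -normrM mulrBl divfK -?normr_gt0//.
  by rewrite (le_lt_trans _ hs)// -normrN le_eqVlt; apply/orP; left; apply/eqP; congr (`|_|); rewrite /a; ring.
have mb i : (i < n)%N -> measurable (ball ((z i - c) / a) (e / `|a|)).
  by move=> _; exact: measurable_ball.
apply: (le_trans (@Boole_inequality _ _ _ (@lebesgue_measure R)
  (fun i => ball ((z i - c) / a) (e / `|a|)) n mb)).
rewrite (eq_bigr (fun=> (e / `|a| *+ 2)%:E)) => [|i _].
  rewrite sumEFin sumr_const card_ord lee_fin -mulrnA -[leLHS]mulr_natr.
  rewrite /n !(natrM, natrD) -aE [leRHS](_ : _ = (4 * (M%:R * `|a|) + 10 * `|a|) * (e / `|a|)).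
    have : 0 < e / `|a| by rewrite divr_gt0.
    have := ler0n R M.
    by move: (M%:R : R) (e / `|a|) => u v; nra.
  by field; rewrite gt_eqF.
by apply: lebesgue_measure_ball; rewrite divr_ge0// ltW.
Qed.

Lemma measurable_dist_dotZ (d : nat) (m : 'rV[int]_d) (c : R) :
  measurable_fun [set: 'rV[R]_d] (fun x => dist_int (c + dotZ m x)).
Proof.
apply: (measurableT_comp (@measurable_dist_int R)).
by apply: measurable_funD => //; exact: measurable_dotZ.
Qed.

Lemma measurable_sublevel (d M : nat) (m : 'rV[int]_d) (c e : R) :
  measurable (@box d M `&` [set x | dist_int (c + dotZ m x) < e]).
Proof.
apply: measurableI; first exact: measurable_box.
rewrite (_ : [set x | _] = (fun x => dist_int (c + dotZ m x)) @^-1` `]-oo, e[%classic); last first.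
  by apply/seteqP; split=> x /=; rewrite in_itv.
by rewrite -[X in measurable X]setTI; exact: measurable_dist_dotZ.
Qed.

(** Induction on the dimension. If [m] has a nonzero entry beyond the first, the first coordinate is
    frozen and its contribution moves into the phase [c], which is why [c] is in the statement;
    otherwise only the first coordinate matters. The constant adds up the bounds of the two
    cases. *)
Lemma sublevel_box (d M : nat) : exists2 C : R, 0 <= C &
  forall (m : 'rV[int]_d) (c e : R), m != 0 -> 0 < e -> e <= 1 ->
  (lebesgue_rV R d (@box d M `&` [set x | (dist_int (c + dotZ m x) < e)%R]) <= (C * e)%:E)%E.
Proof.
elim: d => [|d [C C0 IH]].
  exists 0 => // m c e; have -> : m = 0 by apply/rowP => -[].
  by rewrite eqxx.
have M0 : 0 <= M%:R :> R by [].
exists (C * (2 * M%:R) + (2 * M%:R) ^+ d * (4 * M%:R + 10)).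
  by rewrite addr_ge0 ?mulr_ge0 ?exprn_ge0 ?addr_ge0 ?mulr_ge0.
move=> m c e m0 e0 e1.
pose m' : 'rV[int]_d := \row_i m ord0 (lift ord0 i).
pose J : set (measurableTypeR R) := `[- M%:R, M%:R[%classic.
have mJ : measurable J by exact: measurable_itv.
have JE : lebesgue_measure J = (2 * M%:R)%:E.
  rewrite lebesgue_measure_itv/= lte_fin; case: ltP => h; first by rewrite -EFinB; congr EFin; ring.
  by congr EFin; lra.
have dE s y : dotZ m (consV (s, y)) = (m ord0 ord0)%:~R * s + dotZ m' y.
  rewrite /dotZ big_ord_recl consVE0; congr (_ + _).
  by apply: eq_bigr => i _; rewrite consVES mxE.
have boxS s y : @box d.+1 M (consV (s, y)) <-> J s /\ @box d M y.
  rewrite /J /= in_itv /=; split.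
    move=> h; split; first by have := h ord0; rewrite consVE0.
    by move=> i; have := h (lift ord0 i); rewrite consVES.
  move=> [h0 h] i; case: (unliftP ord0 i) => [j|] ->.
    by rewrite consVES; exact: h.
  by rewrite consVE0.
rewrite lebesgue_rVS.
have [m'0|m'0] := eqVneq m' 0.
  have k0 : m ord0 ord0 != 0.
    apply: contraNneq m0 => h; apply/eqP/rowP => i; rewrite mxE.
    case: (unliftP ord0 i) => [j|] -> //.
    by have /rowP/(_ j) := m'0; rewrite !mxE.
  pose E := [set s : R | (- M%:R <= s < M%:R)%R /\ (dist_int (c + (m ord0 ord0)%:~R * s) < e)%R].
  have mE : measurable (E : set (measurableTypeR R)).
    rewrite (_ : E = J `&` (fun s : measurableTypeR R => dist_int (c + (m ord0 ord0)%:~R * s) : measurableTypeR R) @^-1` `]-oo, e[%classic).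
      apply: measurableI => //; rewrite -[X in measurable X]setTI.
      apply: (measurableT_comp (@measurable_dist_int R)) => //.
      by apply: measurable_funD => //; exact: measurable_funM.
    by apply/seteqP; split=> s /=; rewrite /J /= !in_itv.
  have eL s : lebesgue_rV R d [set y | (@box d.+1 M `&` [set x | (dist_int (c + dotZ m x) < e)%R]) (consV (s, y))]
      = (((2 * M%:R) ^+ d)%:E * (\1_E s)%:E)%E.
    rewrite indicE; have [sE|sE] := boolP (s \in E).
      rewrite mule1 -box_measure; congr (lebesgue_rV R d _).
      have /set_mem [s1 s2] := sE; apply/seteqP; split=> y /=; first by move=> [/boxS[]].
      move=> yb; split; first by apply/boxS; rewrite /J /= in_itv.
      by rewrite dE m'0 dotZ0l addr0.
    rewrite mule0 (_ : [set y | _] = set0) ?measure0//.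
    apply/seteqP; split=> y //= [/boxS[h _]]; rewrite dE m'0 dotZ0l addr0 => hs.
    by move/negP: sE; apply; apply/mem_set; split=> //; move: h; rewrite /J /= in_itv.
  under eq_integral do rewrite eL.
  rewrite ge0_integralZl//; last by apply/measurable_EFinP; exact: measurable_indic.
  rewrite integral_indic// setIT.
  apply: (@le_trans _ _ (((2 * M%:R) ^+ d)%:E * ((4 * M%:R + 10) * e)%:E)%E).
    by apply: lee_wpmul2l; [rewrite lee_fin exprn_ge0// mulr_ge0|exact: sublevel_itv].
  rewrite -EFinM lee_fin -subr_ge0; set P := (2 * M%:R) ^+ d.
  rewrite (_ : _ - _ = C * (2 * M%:R) * e); last by ring.
  by rewrite !mulr_ge0// ltW.
apply: (@le_trans _ _ (\int[lebesgue_measure]_(s in J) (C * e)%:E)%E).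
  rewrite [leRHS]integral_mkcond.
  apply: ge0_le_integral => //.
  - apply: measurable_section; exact: measurable_sublevel.
  - by apply/(measurable_restrictT _ _).1.
  move=> s _; rewrite patchE; case: ifPn => [sJ|/negP sJ].
    apply: le_trans (IH m' (c + (m ord0 ord0)%:~R * s) e m'0 e0 e1).
    apply: le_measure; rewrite ?inE.
    - rewrite (_ : [set y | _] = xsection (@consV R d @^-1` (@box d.+1 M `&` [set x | dist_int (c + dotZ m x) < e])) s).
        apply: measurable_xsection; rewrite -[X in measurable X]setTI.
        by apply: measurable_consV => //; exact: measurable_sublevel.
      by rewrite xsectionE.
    - exact: measurable_sublevel.
    by move=> y /= [/boxS[_ yb]]; rewrite dE addrA => h.
  rewrite (_ : [set y | _] = set0) ?measure0//.
  by apply/seteqP; split=> y //= [/boxS[h _] _]; apply: sJ; exact: mem_set.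
rewrite integral_cst// [X in (_ * X)%E](JE : _ = _) -EFinM lee_fin -subr_ge0.
set P := (2 * M%:R) ^+ d.
rewrite (_ : _ - _ = P * (4 * M%:R + 10) * e); last by ring.
by rewrite !mulr_ge0 ?exprn_ge0 ?addr_ge0 ?mulr_ge0// ltW.
Qed.

End sublevel_estimate.

Section layers.
Context (dd : measure_display) (T : measurableType dd) (R : realType) (J : countType).

(** Where [2 ^ (- k - 1) <= y < 2 ^ (- k)] one has [y ^ (- q) <= 2 ^ (q (k + 1))], with
    [q = p theta]. The layer functions [f], indexed by pairs [(j, k)], have integrals of order
    [a_j^p * 2 ^ ((q - 1) k)], summable since [q < 1]. The inclusion of l^p in l^1 then returns from
    the exponent [p] to [1]. *)
Lemma ae_sum_powR (mu : {measure set T -> \bar R}) (D : set T) (y : J -> T -> R)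
    (a : J -> R) (C S p theta : R) :
  measurable D -> (forall j e, measurable (D `&` [set x | y j x < e])) ->
  0 <= C ->
  (forall j e, 0 < a j -> 0 < e -> e <= 1 ->
     (mu (D `&` [set x | (y j x < e)%R]) <= (C * e)%:E)%E) ->
  (forall j x, y j x < 1) -> (forall j, 0 <= a j) ->
  0 < p -> p < 1 -> 0 < theta -> theta <= 1 ->
  (forall s, uniq s -> \sum_(j <- s) a j `^ p <= S) ->
  {ae mu, forall x, D x -> exists B : R, forall s, uniq s ->
     (forall j, j \in s -> 0 < a j) ->
     (forall j, j \in s -> 0 < y j x) /\
     \sum_(j <- s) a j * y j x `^ (- theta) <= B}.
Proof.
move=> mD mE C0 muE y1 a0 p0 p1 t0 t1 hS.
pose q := p * theta; have q1 : q < 1 by rewrite /q; nra.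
pose E (jk : J * nat) := D `&` [set x | y jk.1 x < 2^-1 ^+ jk.2].
pose W (jk : J * nat) := a jk.1 `^ p * (2 `^ q) ^+ jk.2.+1.
have W0 jk : 0 <= W jk by rewrite mulr_ge0 ?exprn_ge0 ?powR_ge0.
pose f jk x := W jk * \1_(E jk) x.
have h2 k : 0 < 2^-1 ^+ k :> R by rewrite exprn_gt0.
have : {ae mu, forall x, D x -> exists B : R, forall s, uniq s -> \sum_(jk <- s) f jk x <= B}.
  apply: (@ae_bounded_sums _ T R mu D _ f (S * (C * (2 `^ q / (1 - 2 `^ (q - 1))))) mD) => [jk|jk x|s us].
- by apply: measurable_funM => //; apply: measurable_indic; exact: mE.
- by rewrite mulr_ge0.
- have intf jk : (\int[mu]_(x in D) (f jk x)%:E <= (W jk * (C * 2^-1 ^+ jk.2))%:E)%E.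
    under eq_integral do rewrite EFinM.
    rewrite ge0_integralZl//; last 2 first.
    - by apply/measurable_EFinP; apply: measurable_indic; exact: mE.
    - by rewrite lee_fin.
    rewrite integral_indic//; last exact: mE.
    rewrite setIidl; last by move=> x [].
    have [aj|aj] := ltP 0 (a jk.1).
      rewrite [leRHS]EFinM; apply: lee_wpmul2l; first by rewrite lee_fin.
      by apply: muE => //; rewrite exprn_ile1// invf_le1// ler1n.
    by rewrite /W (_ : a jk.1 = 0) ?powR0 ?gt_eqF// ?mul0r ?mul0e//; apply/eqP; rewrite eq_le aj a0.
  apply: le_trans (lee_sum _ (fun jk _ => intf jk)) _.
  rewrite sumEFin lee_fin.
  pose s1 := undup (map fst s).
  have [K hK] : exists K, forall jk, jk \in s -> (jk.2 < K)%N.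
    by exists (\max_(jk <- s) jk.2).+1 => jk js; rewrite ltnS; exact: leq_bigmax_seq.
  apply: (@le_trans _ _ (\sum_(jk <- [seq (j, k) | j <- s1, k <- iota 0 K]) W jk * (C * 2^-1 ^+ jk.2))).
    apply: ler_sum_subseq => //.
    - by apply: allpairs_uniq; rewrite ?undup_uniq ?iota_uniq// => -[? ?] [? ?].
    - move=> [j k] js; apply/allpairsP; exists (j, k); split=> //.
        by rewrite mem_undup; apply/mapP; exists (j, k).
      by rewrite mem_iota add0n; exact: (hK (j, k)).
    - by move=> jk; rewrite mulr_ge0// mulr_ge0// ltW.
  rewrite big_allpairs_dep.
  apply: (@le_trans _ _ (\sum_(j <- s1) a j `^ p * (C * (2 `^ q / (1 - 2 `^ (q - 1)))))); last first.
    rewrite -mulr_suml ler_wpM2r ?hS ?undup_uniq// mulr_ge0// divr_ge0 ?powR_ge0//.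
    by rewrite subr_ge0 ltW// powR2_lt1// subr_lt0.
  apply: ler_sum => j _.
  rewrite -[K in iota 0 K]subn0 -/(index_iota 0 K) big_mkord.
  rewrite (eq_bigr (fun k : 'I_K => a j `^ p * C * ((2 `^ q) ^+ k.+1 * 2^-1 ^+ k))) => [|k _]; last first.
    by rewrite /W /=; ring.
  by rewrite -mulr_sumr mulrA ler_wpM2l ?geometric_layers// mulr_ge0 ?powR_ge0.
apply: filterS => x hx Dx; have [B hB] := hx Dx.
have fE j k : y j x < 2^-1 ^+ k -> f (j, k) x = a j `^ p * (2 `^ q) ^+ k.+1.
  by move=> h; rewrite /f indicE mem_set ?mulr1.
have q0 : 0 < q by rewrite mulr_gt0.
exists (B * B `^ (p^-1 - 1)) => s us as0.
(* If [y j x <= 0], then [x] lies in every layer set of [j], each contributing at least [a j ^ p],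
   and [K] of them exceed [B]. *)
have y0 j : j \in s -> 0 < y j x.
  move=> js; rewrite ltNge; apply/negP => yj.
  have ap : 0 < a j `^ p by rewrite powR_gt0// as0.
  pose K := Num.bound (B / a j `^ p).
  have uK : uniq [seq (j, k) | k <- iota 0 K].
    by rewrite map_inj_uniq ?iota_uniq// => ? ? [].
  have := hB _ uK; rewrite big_map leNgt => /negP; apply.
  apply: (@lt_le_trans _ _ (\sum_(k <- iota 0 K) a j `^ p)).
    rewrite big_const_seq count_predT size_iota iter_addr_0 -[ltRHS]mulr_natr.
    rewrite mulrC -ltr_pdivrMr//.
    have [B0|B0] := leP 0 B; first by apply: archi_boundP; rewrite divr_ge0// ltW.
    by rewrite (lt_le_trans _ (ler0n _ _))// pmulr_llt0 ?invr_gt0.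
  apply: ler_sum => k _; rewrite fE ?(le_lt_trans yj)// ler_peMr ?powR_ge0//.
  by rewrite exprn_ege1// ltW// powR2_gt1.
split=> //.
have hk j : exists k, j \in s -> 2^-1 ^+ k.+1 <= y j x < 2^-1 ^+ k.
  have [js|js] := boolP (j \in s); last by exists 0%N.
  by have [k hk] := dyadic_level (y0 j js) (y1 j x); exists k.
have /choice[k kP] := hk.
pose w j := if j \in s then a j * y j x `^ (- theta) else 0.
rewrite big_seq (eq_bigr w) -?big_seq => [|j js]; last by rewrite /w js.
apply: (@sum_powR_le _ _ w p) => //; first exact: ltW.
  by move=> j; rewrite /w; case: ifP => // _; rewrite mulr_ge0 ?powR_ge0.
(* One layer per index, the one containing [y j x], already majorises the [p]-th power of the
   term. *)
have us' : uniq [seq (j, k j) | j <- s] by rewrite map_inj_uniq// => ? ? [].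
apply: le_trans (hB _ us'); rewrite big_map [leLHS]big_seq [leRHS]big_seq.
apply: ler_sum => j js; have /andP[k1 k2] := kP j js; rewrite fE// /w js.
rewrite powRM ?powR_ge0// ler_wpM2l ?powR_ge0//.
rewrite -powRrM mulNr mulrC -/q powRN -[leRHS]invrK lef_pV2 ?posrE ?powR_gt0 ?y0 ?invr_gt0 ?exprn_gt0 ?powR_gt0//.
apply: (@le_trans _ _ ((2^-1 ^+ (k j).+1) `^ q)).
  rewrite -exprVn -powRN (_ : 2 `^ (- q) = 2^-1 `^ q).
    by rewrite -!powR_mulrn ?powR_ge0// -!powRrM mulrC.
  by rewrite -powR_inv1// -powRrM mulN1r.
by rewrite ge0_ler_powR ?nnegrE ?(ltW q0) ?exprn_ge0// ltW// y0.
Qed.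

End layers.

(** The pointwise Holder inequality leaves the sum of [(1 + |m|^2) ^ (- de)] with
    [de = delta p / (2 - p)]. It converges for [d < 2 de], that is [2 d < p (2 delta + d)], which
    some [p < 1] satisfies because [d / 2 < delta]. *)
Lemma sobolev_coef_powR (R : realType) (d : nat) (delta : R) u (f : 'rV[R]_d -> R[i]) :
  d%:R / 2 < delta -> sobolev_space delta u -> continuous_representative u f ->
  exists p S : R, [/\ 0 < p, p < 1 & forall s : seq 'rV[int]_d, uniq s -> 0 \notin s ->
    \sum_(m <- s) normc (fourier_coef f m) `^ p <= S].
Proof.
move=> Dd su rf; have [S [S0 _ hS]] := sobolev_coef su rf.
have D0 : 0 <= d%:R :> R by [].
(* The midpoint between the critical exponent [2 d / (2 delta + d)] and [1]. *)
pose p := 2^-1 * (1 + 2 * d%:R / (2 * delta + d%:R)).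
have dd0 : 0 < 2 * delta + d%:R by lra.
have r1 : 2 * d%:R / (2 * delta + d%:R) < 1 by rewrite ltr_pdivrMr//; lra.
have r0 : 0 <= 2 * d%:R / (2 * delta + d%:R) by rewrite divr_ge0 ?mulr_ge0// ltW.
have p0 : 0 < p by rewrite /p; lra.
have p1 : p < 1 by rewrite /p; lra.
have p2 : 0 < 2 - p by lra.
have hp : 2 * d%:R < p * (2 * delta + d%:R) by rewrite -ltr_pdivrMr// /p; lra.
clearbody p.
pose de := delta * (p / (2 - p)).
have de0 : 0 <= de by rewrite mulr_ge0 ?divr_ge0 ?(ltW p0) ?(ltW p2)//; lra.
have dde : d%:R < 2 * de.
  rewrite /de !mulrA ltr_pdivlMr//.
  by lra.
pose q : R := 2 `^ (d%:R - 2 * de).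
have q1 : q < 1 by apply: powR2_lt1; rewrite subr_lt0.
have q0 : 0 <= q by exact: powR_ge0.
exists p, (S ^+ 2 + 4 ^+ d * (1 - q)^-1); split=> // s us s0.
pose w (m : 'rV[int]_d) : R := 1 + normZ R m ^+ 2.
have w0 (m : 'rV[int]_d) : 0 < w m by rewrite ltr_pwDl// sqr_ge0.
apply: (@le_trans _ _ (\sum_(m <- s) (w m `^ delta * normc (fourier_coef f m) ^+ 2 + w m `^ (- de)))).
  apply: ler_sum => m _.
  rewrite (_ : w m `^ (- de) = (w m `^ delta) `^ (- (p / (2 - p)))).
    by apply: powR_sub_le; rewrite ?normc_ge0 ?powR_gt0//; lra.
  by rewrite -powRrM mulrN.
rewrite big_split lerD ?hS//.
apply: (@shell_sum d R _ (fun k => 4 ^+ d * q ^+ k)) => // [k s' us' hs'|K].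
  exact: shell_weight_le.
by rewrite -mulr_sumr ler_wpM2l ?exprn_ge0// geometric_sum_lt1.
Qed.

Lemma ae_discrepancy_bound (R : realType) (d : nat) (theta delta : R)
    (u : ('rV[R]_d -> R[i]) -> R[i]) (f : 'rV[R]_d -> R[i]) :
  0 < theta -> theta <= 1 -> d%:R / 2 < delta ->
  sobolev_space delta u -> continuous_representative u f ->
  {ae lebesgue_rV R d, forall alpha : 'rV[R]_d,
    exists2 c : R, 0 < c & forall N : nat, (1 <= N)%N ->
      (sup_norm (discrepancy (@Phi R) alpha f N) <= (c * N%:R `^ (- theta))%:E)%E}.
Proof.
move=> t0 t1 Dd su rf; have [p [S [p0 p1 hS]]] := sobolev_coef_powR Dd su rf.
(* The zero frequency gets coefficient [0]: there [||m.alpha||] vanishes identically and has no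
   sublevel estimate. *)
pose a (m : 'rV[int]_d) : R := if m == 0 then 0 else normc (fourier_coef f m).
have a0 m : 0 <= a m by rewrite /a; case: ifP => // _; exact: normc_ge0.
have aS s : uniq s -> \sum_(m <- s) a m `^ p <= S.
  move=> us; rewrite (bigID (fun m => m == 0))/= big1 ?add0r => [|m /eqP ->]; last first.
    by rewrite /a eqxx powR0// gt_eqF.
  rewrite -big_filter (le_trans _ (hS [seq m <- s | m != 0] _ _)) ?filter_uniq//.
    rewrite big_filter [leRHS]big_filter; apply: ler_sum => m m0.
    by rewrite /a (negPf m0).
  by rewrite mem_filter eqxx.
have box_ae M : {ae lebesgue_rV R d, forall x, @box R d M x -> exists B : R,
    forall s, uniq s -> (forall m, m \in s -> 0 < a m) ->
     (forall m, m \in s -> 0 < dist_int (dotZ m x)) /\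
     \sum_(m <- s) a m * dist_int (dotZ m x) `^ (- theta) <= B}.
  have [C C0 hC] := sublevel_box R d M.
  have e0 m : (fun x : 'rV[R]_d => dist_int (dotZ m x)) = (fun x => dist_int (0 + dotZ m x)).
    by apply/funext => x; rewrite add0r.
  apply: (@ae_sum_powR _ _ _ _ _ _ (fun m x => dist_int (dotZ m x)) a C S p) => //.
  - exact: measurable_box.
  - move=> m e; have := measurable_sublevel M m 0 e.
    by under eq_set do rewrite add0r.
  - move=> m e am ep e1; have m0 : m != 0.
      by apply/eqP => m0; move: am; rewrite m0 /a eqxx ltxx.
    by have := hC m 0 e m0 ep e1; under eq_set do rewrite add0r.
  by move=> m x; rewrite (le_lt_trans (dist_int_le_half _))// invf_lt1// ltr1n.
(* Countably many boxes exhaust the space, and their exceptional sets have a null union. *)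
have := ae_foralln box_ae; apply: filterS => x hx.
have [M xM] : exists M, @box R d M x.
  exists (Num.bound (\sum_(i < d) `|x ord0 i|)) => i.
  have h : `|x ord0 i| < (Num.bound (\sum_(i < d) `|x ord0 i|))%:R.
    apply: le_lt_trans (archi_boundP _); last by apply: sumr_ge0.
    by rewrite (bigD1 i)//= lerDl sumr_ge0.
  by move: h; rewrite ltr_norml => /andP[/ltW -> ->].
have [B hB] := hx M xM.
have B0 : 0 <= B by have [//|_] := hB [::] isT _; rewrite big_nil.
exists (B + 1); first by rewrite ltr_wpDl.
move=> N N0; apply: sup_norm_discrepancy_le => //; first by case: rf.
move=> s us s0.
(* Frequencies with vanishing coefficient are discarded: [dist_int (dotZ m x)] is only known to be
   positive for the others. *)
pose s' := [seq m <- s | 0 < a m].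
have s'0 m : m \in s' -> 0 < a m by rewrite mem_filter => /andP[].
have [y0 hs'] := hB s' (filter_uniq _ us) s'0.
apply: (@le_trans _ _ (B * N%:R `^ (- theta))); last first.
  by rewrite ler_wpM2r ?powR_ge0// lerDl.
rewrite (@sum_filter_neq0 _ _ _ (fun m => 0 < a m)) => [|m ms am]; last first.
  have m0 : m != 0 by apply: contraNneq s0 => <-.
  move: am; rewrite /a (negPf m0) -leNgt => am.
  have -> : normc (fourier_coef f m) = 0 by apply/eqP; rewrite eq_le am normc_ge0.
  by rewrite mulr0.
apply: le_trans (ler_wpM2r (powR_ge0 _ _) hs').
rewrite mulr_suml big_seq [leRHS]big_seq; apply: ler_sum => m ms.
have m0 : m != 0 by apply/eqP => m0; move: (s'0 m ms); rewrite m0 /a eqxx ltxx.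
rewrite /a (negPf m0) mulrC -mulrA ler_wpM2l ?normc_ge0// mulrC.
by apply: exp_sum_powR => //; exact: y0.
Qed.

(** * Lower bound *)

Section negligible.
Context (dd : measure_display) (T : measurableType dd) (R : realType).
Import HBNNSimple.

(* The integral of a nonnegative function is a supremum over simple functions,
   so that null sets are irrelevant even for functions that are not measurable. *)
Lemma ge0_integral_off_null (mu : {measure set T -> \bar R}) (F : T -> \bar R) (B : set T) :
  measurable B -> mu B = 0%E -> (forall x, 0 <= F x)%E ->
  (\int[mu]_x F x = \int[mu]_x (F \_ (~` B)) x)%E.
Proof.
move=> mB B0 F0; have mCB := measurableC mB.
have F0' x : (0 <= (F \_ (~` B)) x)%E by rewrite patchE; case: ifP.
rewrite !ge0_integralTE//; apply/eqP; rewrite eq_le; apply/andP; split.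
  apply: ge_ereal_sup => _ [h hF <-]; apply: ereal_sup_ubound.
  (* Multiplying the simple function by the indicator of the complement of [B] changes it on a null
     set only. *)
  exists (proj_nnsfun h mCB).
    move=> x; have -> : proj_nnsfun h mCB x = h x * \1_(~` B) x by [].
    rewrite patchE indicE; case: ifPn => xB; first by rewrite mulr1.
    by rewrite mulr0.
  rewrite -!integralT_nnsfun; apply: ge0_ae_eq_integral => //.
  - exact/measurable_EFinP.
  - exact/measurable_EFinP.
  - by move=> x _; rewrite lee_fin.
  - by move=> x _; rewrite lee_fin.
  exists B; split=> // x /= /not_implyP[_] h1; apply: contrapT => xB; apply: h1.
  by rewrite /= mindicE mem_set// mulr1.
apply: le_ereal_sup => _ [h hF <-]; exists h => // x.
by rewrite (le_trans (hF x))// patchE; case: ifP.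
Qed.

Lemma integral_eq_off_null (mu : {measure set T -> \bar R}) (D B : set T) (f h : T -> \bar R) :
  measurable B -> mu B = 0%E -> (forall x, D x -> ~ B x -> f x = h x) ->
  (\int[mu]_(x in D) f x = \int[mu]_(x in D) h x)%E.
Proof.
move=> mB B0 fh; rewrite integralE [RHS]integralE.
have e (k1 k2 : T -> \bar R) : (forall x, 0 <= k1 x)%E -> (forall x, 0 <= k2 x)%E ->
    (forall x, D x -> ~ B x -> k1 x = k2 x) ->
    (\int[mu]_(x in D) k1 x = \int[mu]_(x in D) k2 x)%E.
  move=> k10 k20 k12; rewrite integral_mkcond [RHS]integral_mkcond.
  rewrite (ge0_integral_off_null mB)//; last by move=> x; rewrite patchE; case: ifP.
  rewrite [RHS](ge0_integral_off_null mB)//; last by move=> x; rewrite patchE; case: ifP.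
  apply: eq_integral => x _; rewrite !patchE; case: ifPn => // /set_mem xB.
  by case: ifPn => // /set_mem xD; exact: k12.
by congr (_ - _)%E; apply: e => // x Dx Bx; rewrite ?funeposE ?funenegE fh.
Qed.

End negligible.

Section torus_off_null.
Context (R : realType) (d : nat).
Implicit Types (f h : 'rV[R]_d -> R[i]) (B : set 'rV[R]_d).

Lemma torus_integral_off_null f h B : measurable B -> lebesgue_rV R d B = 0%E ->
  (forall x, unit_cube x -> ~ B x -> f x = h x) -> torus_integral f = torus_integral h.
Proof.
move=> mB B0 fh; rewrite /torus_integral /Rintegral; congr (fine _ +i* fine _);
  by apply: (integral_eq_off_null mB B0) => x xD xB; rewrite fh.
Qed.

Lemma cintegrable_patch f B : measurable B -> cintegrable f ->
  cintegrable (fun x => if x \in @unit_cube R d `\` B then f x else 0).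
Proof.
have mc := @measurable_cube R d; move=> mB.
have e (k : 'rV[R]_d -> R) : cube_integrable k ->
    cube_integrable (fun x => if x \in @unit_cube R d `\` B then k x else 0).
  move=> ki; have := integrableS mc (measurableD mc mB) (@subDsetl _ _ _) ki.
  move/(integrable_mkcond _ (measurableD mc mB)).
  move/(integrableS measurableT mc (@subsetT _ _)).
  rewrite /cube_integrable (_ : _ \_ _ = EFin \o (fun x => if x \in @unit_cube R d `\` B then k x else 0))//.
  by apply/funext => x; rewrite patchE /=; case: ifP.
move=> [f1 f2]; split.
  rewrite (_ : _ \o _ = fun x => if x \in @unit_cube R d `\` B then complex.Re (f x) else 0).
    exact: e.
  by apply/funext => x /=; case: ifP.
rewrite (_ : _ \o _ = fun x => if x \in @unit_cube R d `\` B then complex.Im (f x) else 0).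
  exact: e.
by apply/funext => x /=; case: ifP.
Qed.

Lemma normc_torus_integral_off_null f B (M : R) : cintegrable f -> 0 <= M ->
  measurable B -> lebesgue_rV R d B = 0%E ->
  (forall x, unit_cube x -> ~ B x -> normc (f x) <= M) -> normc (torus_integral f) <= M.
Proof.
move=> fi M0 mB B0 fM.
rewrite (@torus_integral_off_null _ (fun x => if x \in @unit_cube R d `\` B then f x else 0) B)//.
  apply: normc_torus_integral_bound; first exact: cintegrable_patch.
  move=> x xc; case: ifPn => [/set_mem [_ xB]|_]; first exact: fM.
  by rewrite normc0.
by move=> x xc xB; rewrite mem_set.
Qed.

End torus_off_null.

Lemma sup_norm_ge (R : realType) (d : nat) (f : 'rV[R]_d -> R[i]) x :
  ((normc (f x))%:E <= sup_norm f)%E.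
Proof. by apply: ereal_sup_ubound; exists x. Qed.

Lemma sup_norm_ge0 (R : realType) (d : nat) (f : 'rV[R]_d -> R[i]) : (0 <= sup_norm f)%E.
Proof. by rewrite (le_trans _ (sup_norm_ge f 0))// lee_fin normc_ge0. Qed.

(** The discrepancy of [f] agrees off a null set with that of a periodic Borel function [h]. The
    coefficient of the latter is bounded through its values off that set, and these are values of
    the discrepancy of [f]. *)
Lemma fourier_coef_le_sup_norm (R : realType) (d : nat) (f : 'rV[R]_d -> R[i])
    (m : 'rV[int]_d) (alpha : 'rV[R]_d) (N : nat) :
  torus_integrable f -> m != 0 -> (0 < N)%N ->
  ((normc (exp_sum (@Phi R) N (dotZ m alpha)) * normc (fourier_coef f m))%:E <=
    sup_norm (discrepancy (@Phi R) alpha f N))%E.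
Proof.
move=> [pf [g [g1 g2 [B [mB B0 fgB]]]]] m0 N0.
have mc := @measurable_cube R d.
have fg x : unit_cube x -> ~ B x -> f x = g x.
  by move=> xc xB; apply: contrapT => h; apply: xB; apply: fgB => /(_ xc).
(* [g] is tied to [f] only on the unit cube; [rotV 0] reduces modulo [1], so [h] is the periodic
   extension of [g] from the cube. *)
pose h := g \o rotV 0.
have ih : cintegrable h by exact: cintegrable_rotV.
have ph : Zperiodic h.
  move=> n x; congr g; apply/rowP => i; rewrite !mxE !addr0; exact: fracrDz.
have rot0 (x : 'rV[R]_d) : unit_cube x -> rotV 0 x = x.
  by move=> xc; apply/rowP => i; rewrite !mxE addr0 fracr_id//; exact: xc.
have fh x : unit_cube x -> ~ B x -> f x = h x.
  by move=> xc xB; rewrite /h /= rot0// fg.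
have -> : fourier_coef f m = fourier_coef h m.
  by apply: (torus_integral_off_null mB B0) => x xc xB; rewrite fh.
have ifh : torus_integral f = torus_integral h by exact: (torus_integral_off_null mB B0).
pose v (j : nat) : 'rV[R]_d := (j%:R - N%:R) *: alpha.
(* The points some translate of which falls into [B] modulo [1]; null as a countable union of
   preimages under measure-preserving rotations. *)
pose B' : set 'rV[R]_d := \bigcup_j (@unit_cube R d `&` rotV (v j) @^-1` B).
have mBj j : measurable (@unit_cube R d `&` rotV (v j) @^-1` B).
  apply: measurableI => //; rewrite -[X in measurable X]setTI.
  exact: measurable_rotV.
have mB' : measurable B' by exact: bigcup_measurable.
have B'0 : lebesgue_rV R d B' = 0%E.
  apply/eqP; rewrite -measure_le0 (le_trans (generalized_Boole_inequality _ mBj mB'))//.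
  rewrite eseries0// => j _ _; apply: (etrans (rotV_preserving (v j) mB)).
    by apply: (subset_measure0 _ mB _ B0); [exact: measurableI|exact: subIsetr].
have dfh x : unit_cube x -> ~ B' x ->
    discrepancy (@Phi R) alpha f N x = discrepancy (@Phi R) alpha h N x.
  move=> xc xB; rewrite !discrepancyE// ifh; congr (_ * _ - _).
  apply: eq_bigr => j _; rewrite -(periodic_rotV _ _ pf) -(periodic_rotV _ _ ph).
  apply: fh; first exact: rotV_cube.
  by move=> h'; apply: xB; exists (j : nat).
rewrite -normcM -fourier_coef_discrepancy//.
have s0 := sup_norm_ge0 (discrepancy (@Phi R) alpha f N).
have sM := sup_norm_ge (discrepancy (@Phi R) alpha f N).
case: (sup_norm _) s0 sM => [M|_ _|//]; last by rewrite leey.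
rewrite lee_fin => M0 sM; rewrite lee_fin.
apply: (normc_torus_integral_off_null _ M0 mB' B'0).
  have := cintegrableM_expi (- m) (cintegrable_discrepancy alpha N0 ph ih).
  by under eq_fun do rewrite dotZNl.
by move=> x xc xB; rewrite normcM normc_expi mulr1 -dfh// -lee_fin.
Qed.

(** The case [c = 0] is separate since [limn_esup u] may be infinite, with [+oo * 0 = 0]; for
    [c > 0] one can divide by [c] in the suprema. *)
Lemma limn_esup_leMr (R : realType) (u v : (\bar R)^nat) (c : R) : 0 <= c ->
  (forall n, 0 <= v n)%E -> (forall n, u n * c%:E <= v n)%E ->
  (limn_esup u * c%:E <= limn_esup v)%E.
Proof.
rewrite le_eqVlt => /predU1P[<-|c0] v0 uv.
  by rewrite mule0; apply: limf_esup_ge0 => //; exact: filter_not_empty.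
rewrite /limn_esup !limf_esupE; apply: le_ereal_inf_tmp => _ [V FV <-].
rewrite -lee_pdivlMr//; apply: (@le_trans _ _ (ereal_sup (u @` V))).
  by apply: ereal_inf_lbound; exists V.
apply: ge_ereal_sup => _ [n Vn <-]; rewrite lee_pdivlMr//.
by rewrite (le_trans (uv n))//; apply: ereal_sup_ubound; exists n.
Qed.

Theorem corollary1p7 (R : realType) (d : nat) (theta : R)
    (d_ge1 : (1 <= d)%N) (theta_gt0 : 0 < theta) (theta_le1 : theta <= 1) :
  (exists2 K : R, 0 < K &
    forall (N : nat) (t : R), (1 <= N)%N ->
      normc (exp_sum (@Phi R) N t) <= K * (1 + N%:R * dist_int t) `^ (- theta))
  /\
  (forall (delta : R) (u : ('rV[R]_d -> R[i]) -> R[i]) (f : 'rV[R]_d -> R[i]),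
    (theta < 1 -> d%:R / 2 < delta) ->
    (1 <= theta -> d%:R * theta - d%:R / 2 < delta) ->
    sobolev_space delta u -> continuous_representative u f ->
    {ae lebesgue_rV R d, forall alpha : 'rV[R]_d,
      exists2 c : R, 0 < c &
        forall N : nat, (1 <= N)%N ->
          (sup_norm (discrepancy (@Phi R) alpha f N)
             <= (c * N%:R `^ (- theta))%:E)%E})
  /\
  (forall (alpha : 'rV[R]_d) (H sigma delta : R),
    irrational_vector alpha -> 0 < H -> d%:R <= sigma ->
    (forall m : 'rV[int]_d, m != 0 ->
      H * normZ R m `^ (- sigma) <= dist_int (dotZ m alpha)) ->
    d%:R / 2 < delta ->
    exists2 c : R, 0 < c &
      forall (u : ('rV[R]_d -> R[i]) -> R[i]) (f : 'rV[R]_d -> R[i]) (N : nat),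
        sobolev_space delta u -> continuous_representative u f -> (1 <= N)%N ->
        (sup_norm (discrepancy (@Phi R) alpha f N)
           <= (c * N%:R `^ (- theta) * Xrate d delta theta sigma N)%:E
              * sobolev_norm delta u)%E)
  /\
  (forall (f : 'rV[R]_d -> R[i]) (m : 'rV[int]_d) (alpha : 'rV[R]_d),
    torus_integrable f -> m != 0 ->
    (Climsup theta (dotZ m alpha) * (normc (fourier_coef f m))%:E
       <= limn_esup (fun N : nat =>
            (N%:R `^ theta)%:E * sup_norm (discrepancy (@Phi R) alpha f N)))%E).
Proof.
split; first by exists 2 => // N t N1; exact: exp_sum_bound.
split.
  move=> delta u f h1 h2; apply: ae_discrepancy_bound => //.
  (* Otherwise [theta = 1], and [d theta - d / 2] is again [d / 2]. *)
  have [t1|t1] := ltP theta 1; first exact: h1.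
  have te : theta = 1 by apply/eqP; rewrite eq_le theta_le1.
  by have := h2 t1; rewrite te mulr1; lra.
split.
  move=> alpha H sigma delta _ H0 ds dio Dd.
  exact: (@discrepancy_diophantine R d theta alpha H).
move=> f m alpha fi m0; apply: limn_esup_leMr => [|N|N].
- exact: normc_ge0.
- by rewrite mule_ge0 ?sup_norm_ge0// lee_fin powR_ge0.
(* At the junk index [N = 0] both sides vanish, because [0 ^ theta = 0] for [theta > 0]. *)
have [->|N0] := posnP N.
  by rewrite powR0 ?gt_eqF// mul0r !mul0e.
rewrite -EFinM -mulrA EFinM; apply: lee_wpmul2l; first by rewrite lee_fin powR_ge0.
exact: fourier_coef_le_sup_norm.
Qed.
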